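(* For all odd $n\geq 5$, the right-angled Artin group $A(C_n)$ embeds into a diagram group but is not a diagram group itself.
   Context: $C_n$ denotes a cycle of length $n$. For a simplicial graph $\Gamma$ with vertex set $V(\Gamma)$ and edge set $E(\Gamma)$, $A(\Gamma)=\langle v\in V(\Gamma)\mid [u,v]=1,\ (u,v)\in E(\Gamma)\rangle$. A semigroup presentation $\mathcal{P}=\langle\Sigma\mid\mathcal{R}\rangle$ consists of an alphabet $\Sigma$ and a set $\mathcal{R}$ of relations $u=v$ with $u,v\in\Sigma^+$, where $\Sigma^+$ is the free semigroup of non-empty words and $\Sigma^*=\Sigma^+\cup\{1\}$ also contains the empty word. Convention: if $u=v\in\mathcal{R}$ then $v=u\notin\mathcal{R}$ (in particular $u=u\notin\mathcal{R}$). The Squier complex $S(\mathcal{P})$ is the cube complex whose vertices are the words over $\Sigma$; whose oriented edges are $(a,u\to v,b)$ with $a,b\in\Sigma^*$ and $u=v$ or $v=u$ in $\mathcal{R}$, going from $aub$ to $avb$ (and $(a,v\to u,b)$ is the same edge with opposite orientation); and whose $n$-cubes are similarly $(a_1,u_1\to v_1,\dots,a_n,u_n\to v_n,a_{n+1})$, spanned by the vertices $a_1w_1\cdots a_nw_na_{n+1}$ with $w_i\in\{u_i,v_i\}$. For $w\in\Sigma^+$, $S(\mathcal{P},w)$ is the connected component containing $w$, and the diagram group $D(\mathcal{P},w)$ is $\pi_1(S(\mathcal{P},w),w)$. A group is a diagram group if it is isomorphic to $D(\mathcal{P},w)$ for some semigroup presentation $\mathcal{P}$ and some $w\in\Sigma^+$.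 *)

(* Defs.v *)
From HB Require Import structures.
From mathcomp Require Import all_boot.
From mathcomp Require Import boolp.
From Stdlib Require Import Relation_Operators.

Set Implicit Arguments.
Unset Strict Implicit.
Unset Printing Implicit Defensive.

Local Open Scope quotient_scope.

Record move_system := MoveSystem {
  ms_sort :> Type;
  ms_move : ms_sort -> ms_sort -> Prop;
  ms_mul : ms_sort -> ms_sort -> ms_sort;
  ms_one : ms_sort;
  ms_inv : ms_sort -> ms_sort;
  ms_mulA : associative ms_mul;
  ms_1mul : left_id ms_one ms_mul;
  ms_mul1 : right_id ms_one ms_mul;
  ms_Vmul : forall x,
    clos_refl_sym_trans _ ms_move (ms_mul (ms_inv x) x) ms_one;
  ms_mulV : forall x,
    clos_refl_sym_trans _ ms_move (ms_mul x (ms_inv x)) ms_one;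
  ms_moveMl : forall z x y, ms_move x y ->
    clos_refl_sym_trans _ ms_move (ms_mul z x) (ms_mul z y);
  ms_moveMr : forall z x y, ms_move x y ->
    clos_refl_sym_trans _ ms_move (ms_mul x z) (ms_mul y z);
  ms_moveV : forall x y, ms_move x y ->
    clos_refl_sym_trans _ ms_move (ms_inv x) (ms_inv y) }.

Section ClassGroup.
Variable M : move_system.

Definition ms_eqv : M -> M -> Prop := clos_refl_sym_trans M (@ms_move M).

Definition ms_eqvb (x y : {classic M}) : bool := `[< ms_eqv x y >].

Lemma ms_eqvb_refl : reflexive ms_eqvb.
Proof. by move=> x; apply/asboolP; apply: rst_refl. Qed.

Lemma ms_eqvb_sym : symmetric ms_eqvb.
Proof.
by move=> x y; apply/asboolP/asboolP => h; apply: rst_sym.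
Qed.

Lemma ms_eqvb_trans : transitive ms_eqvb.
Proof.
by move=> y x z /asboolP hxy /asboolP hyz; apply/asboolP; apply: rst_trans hyz.
Qed.

Canonical ms_equiv := EquivRel ms_eqvb ms_eqvb_refl ms_eqvb_sym ms_eqvb_trans.

Definition class_group : Type := {eq_quot ms_equiv}.

HB.instance Definition _ := Choice.on class_group.
HB.instance Definition _ := EqQuotient.on class_group.

Definition class_of (x : M) : class_group := \pi_class_group (x : {classic M}).

Lemma class_ofP (x y : M) : class_of x = class_of y <-> ms_eqv x y.
Proof. by split=> [/eqmodP/asboolP|h] //; apply/eqmodP/asboolP. Qed.

Lemma class_of_repr (a : class_group) : class_of (repr a) = a.
Proof. exact: reprK. Qed.

Lemma ms_eqvM (x y z t : M) :
  ms_eqv x y -> ms_eqv z t -> ms_eqv (ms_mul x z) (ms_mul y t).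
Proof.
move=> hxy hzt; apply: (@rst_trans _ _ _ (ms_mul y z)).
  elim: hxy => {x y} [x y h|x|x y _ h|x u y _ h _ h'].
  - exact: ms_moveMr.
  - exact: rst_refl.
  - exact: rst_sym.
  - exact: rst_trans h'.
elim: hzt => {z t} [z t h|z|z t _ h|z u t _ h _ h'].
- exact: ms_moveMl.
- exact: rst_refl.
- exact: rst_sym.
- exact: rst_trans h'.
Qed.

Lemma ms_eqvV (x y : M) : ms_eqv x y -> ms_eqv (ms_inv x) (ms_inv y).
Proof.
elim=> {x y} [x y h|x|x y _ h|x u y _ h _ h'].
- exact: ms_moveV.
- exact: rst_refl.
- exact: rst_sym.
- exact: rst_trans h'.
Qed.

Definition class_mul (a b : class_group) : class_group :=
  class_of (ms_mul (repr a : M) (repr b : M)).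
Definition class_one : class_group := class_of (ms_one M).
Definition class_inv (a : class_group) : class_group :=
  class_of (ms_inv (repr a : M)).

Lemma class_mulE (x y : M) :
  class_mul (class_of x) (class_of y) = class_of (ms_mul x y).
Proof.
by apply/class_ofP; apply: ms_eqvM; apply/class_ofP; rewrite class_of_repr.
Qed.

Lemma class_invE (x : M) : class_inv (class_of x) = class_of (ms_inv x).
Proof.
by apply/class_ofP; apply: ms_eqvV; apply/class_ofP; rewrite class_of_repr.
Qed.

Lemma class_mulA : associative class_mul.
Proof.
move=> a b c; rewrite -(class_of_repr a) -(class_of_repr b) -(class_of_repr c).
by rewrite !class_mulE ms_mulA.
Qed.

Lemma class_1mul : left_id class_one class_mul.
Proof. by move=> a; rewrite -(class_of_repr a) class_mulE ms_1mul. Qed.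

Lemma class_mul1 : right_id class_one class_mul.
Proof. by move=> a; rewrite -(class_of_repr a) class_mulE ms_mul1. Qed.

Lemma class_Vmul : left_inverse class_one class_inv class_mul.
Proof.
move=> a; rewrite -(class_of_repr a) class_invE class_mulE.
by apply/class_ofP; apply: ms_Vmul.
Qed.

Lemma class_mulV : right_inverse class_one class_inv class_mul.
Proof.
move=> a; rewrite -(class_of_repr a) class_invE class_mulE.
by apply/class_ofP; apply: ms_mulV.
Qed.

HB.instance Definition _ := isGroup.Build class_group
  class_mulA class_1mul class_mul1 class_Vmul class_mulV.

End ClassGroup.

Definition isomorphic (G H : groupType) : Prop :=
  exists f : {multiplicative G -> H}, bijective f.

Definition embeds (G H : groupType) : Prop :=
  exists f : {multiplicative G -> H}, injective f.

Section Presentation.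
Variables (X : Type) (relator : seq (X * bool) -> Prop).

(* [(x, false)] stands for the generator [x] and [(x, true)] for its inverse. *)
Local Notation letter := (X * bool)%type.

Definition inv_letter (s : letter) : letter := (s.1, ~~ s.2).
Definition inv_word (w : seq letter) : seq letter := rev (map inv_letter w).

Inductive pres_move : seq letter -> seq letter -> Prop :=
| pres_cancel l s r : pres_move (l ++ [:: s; inv_letter s] ++ r) (l ++ r)
| pres_relator l w r : relator w -> pres_move (l ++ w ++ r) (l ++ r).

Local Notation eqv := (clos_refl_sym_trans _ pres_move).

Lemma inv_letterK : involutive inv_letter.
Proof. by case=> x b; rewrite /inv_letter /= negbK. Qed.

Lemma inv_wordK : involutive inv_word.
Proof.
move=> w; rewrite /inv_word map_rev revK -map_comp.
by elim: w => //= s w ->; rewrite inv_letterK.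
Qed.

Lemma inv_word_cat u v : inv_word (u ++ v) = inv_word v ++ inv_word u.
Proof. by rewrite /inv_word map_cat rev_cat. Qed.

Lemma pres_moveMl z x y : pres_move x y -> eqv (z ++ x) (z ++ y).
Proof.
case=> [l s r|l w r hw]; apply: rst_step; rewrite !(catA z).
  exact: pres_cancel.
exact: pres_relator.
Qed.

Lemma pres_moveMr z x y : pres_move x y -> eqv (x ++ z) (y ++ z).
Proof.
case=> [l s r|l w r hw]; apply: rst_step; rewrite -!catA.
  exact: pres_cancel.
exact: pres_relator.
Qed.

Lemma pres_mulV_ctx l w r : eqv (l ++ (w ++ inv_word w) ++ r) (l ++ r).
Proof.
elim: w l r => [|s w IH] l r; first exact: rst_refl.
rewrite -cat1s inv_word_cat -!catA.
apply: rst_trans (rst_step _ _ _ _ (pres_cancel l s r)).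
have := IH (l ++ [:: s]) ([:: inv_letter s] ++ r).
by rewrite -!catA.
Qed.

Lemma pres_mulV w : eqv (w ++ inv_word w) [::].
Proof. by have := pres_mulV_ctx [::] w [::]; rewrite cats0. Qed.

Lemma pres_Vmul w : eqv (inv_word w ++ w) [::].
Proof. by have := pres_mulV (inv_word w); rewrite inv_wordK. Qed.

Lemma pres_moveV x y : pres_move x y -> eqv (inv_word x) (inv_word y).
Proof.
case=> [l s r|l w r hw]; rewrite !inv_word_cat -!catA.
  have -> : inv_word [:: s; inv_letter s] = [:: s; inv_letter s].
    by rewrite /inv_word /= inv_letterK.
  by apply: rst_step; apply: pres_cancel.
apply: (@rst_trans _ _ _ (inv_word r ++ inv_word w ++ w ++ inv_word l)).
  apply: rst_sym; apply: rst_step.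
  by have := pres_relator (inv_word r ++ inv_word w) (inv_word l) hw;
     rewrite -!catA.
by have := pres_mulV_ctx (inv_word r) (inv_word w) (inv_word l);
   rewrite inv_wordK -!catA.
Qed.

Definition pres_moves : move_system :=
  @MoveSystem (seq letter) pres_move cat [::] inv_word
    (@catA _) (@cat0s _) (@cats0 _) pres_Vmul pres_mulV
    pres_moveMl pres_moveMr pres_moveV.

Definition presented_group : groupType := class_group pres_moves.

End Presentation.

Record simplicial_graph := SimplicialGraph {
  gvertex :> Type;
  adj : gvertex -> gvertex -> Prop;
  adj_sym : forall u v, adj u v -> adj v u;
  adj_irr : forall u, ~ adj u u }.

Inductive raag_relator (Gamma : simplicial_graph) :
    seq (Gamma * bool) -> Prop :=
| RaagRelator u v : adj u v ->
    raag_relator [:: (u, true); (v, true); (u, false); (v, false)].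

Definition raag (Gamma : simplicial_graph) : groupType :=
  presented_group (@raag_relator Gamma).

(* [ordS i] is [i + 1] modulo [n]; the disequality only matters for [n = 1]. *)
Definition cycle_adj (n : nat) (i j : 'I_n) : Prop :=
  i <> j /\ (j = ordS i \/ i = ordS j).

Lemma cycle_adj_sym n (i j : 'I_n) : cycle_adj i j -> cycle_adj j i.
Proof. by case=> hij h; split; [exact: nesym | case: h; [right | left]]. Qed.

Lemma cycle_adj_irr n (i : 'I_n) : ~ cycle_adj i i.
Proof. by case. Qed.

(* The cycle of length [n], for [n >= 3]. *)
Definition cycle_graph (n : nat) : simplicial_graph :=
  SimplicialGraph (@cycle_adj_sym n) (@cycle_adj_irr n).

(* The 2-skeleton of a cube complex, which determines its fundamental group.
   Edges are oriented. [square e1 e2 f1 f2] says that [e1 e2] and [f1 f2] are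
   the two edge paths of length two joining opposite corners of a square. *)
Record square_complex := SquareComplex {
  vertex : Type;
  edge : Type;
  src : edge -> vertex;
  tgt : edge -> vertex;
  rev_edge : edge -> edge;
  src_rev : forall e, src (rev_edge e) = tgt e;
  tgt_rev : forall e, tgt (rev_edge e) = src e;
  rev_edgeK : involutive rev_edge;
  square : edge -> edge -> edge -> edge -> Prop;
  squareP : forall e1 e2 f1 f2, square e1 e2 f1 f2 ->
    [/\ src e1 = src f1, tgt e1 = src e2, tgt f1 = src f2 & tgt e2 = tgt f2];
  square_rev : forall e1 e2 f1 f2, square e1 e2 f1 f2 ->
    square (rev_edge f2) (rev_edge f1) (rev_edge e2) (rev_edge e1) }.

Section FundamentalGroup.
Variable C : square_complex.
Implicit Types (x y z : vertex C) (p q : seq (edge C)).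

Fixpoint is_path x p y : Prop :=
  if p is e :: p' then src e = x /\ is_path (tgt e) p' y else x = y.

Definition rev_path p : seq (edge C) := rev (map (@rev_edge C) p).

Inductive path_move : seq (edge C) -> seq (edge C) -> Prop :=
| path_backtrack l e r : path_move (l ++ [:: e; rev_edge e] ++ r) (l ++ r)
| path_square l e1 e2 f1 f2 r : square e1 e2 f1 f2 ->
    path_move (l ++ [:: e1; e2] ++ r) (l ++ [:: f1; f2] ++ r).

Variable x0 : vertex C.

Record loop := Loop {
  loop_path : seq (edge C);
  loopP : is_path x0 loop_path x0 }.

(* Both sides are loops, so the closure of this relation is homotopy through
   edge loops based at [x0]. *)
Definition loop_move (p q : loop) : Prop :=
  path_move (loop_path p) (loop_path q).

Lemma loop_inj (p q : loop) : loop_path p = loop_path q -> p = q.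
Proof.
case: p q => [p hp] [q hq] /= e; case: _ / e hq => hq.
by rewrite (Prop_irrelevance hp hq).
Qed.

Lemma is_path_cat x p q z :
  is_path x (p ++ q) z <-> exists y, is_path x p y /\ is_path y q z.
Proof.
elim: p x => [|e p IH] x /=.
  by split=> [h|[y [-> //]]]; exists x.
split=> [[hx /IH [y [hp hq]]]|[y [[hx hp] hq]]]; first by exists y.
by split=> //; apply/IH; exists y.
Qed.

Lemma is_path_rev x p y : is_path x p y -> is_path y (rev_path p) x.
Proof.
elim: p x => [|e p IH] x /= => [->//|[hx hp]].
rewrite /rev_path /= rev_cons -cats1; apply/is_path_cat; exists (tgt e).
by split; [exact: IH | rewrite /= src_rev tgt_rev].
Qed.

Lemma rev_pathK : involutive rev_path.
Proof.
move=> p; rewrite /rev_path map_rev revK -map_comp.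
by elim: p => //= e p ->; rewrite rev_edgeK.
Qed.

Lemma rev_path_cat p q : rev_path (p ++ q) = rev_path q ++ rev_path p.
Proof. by rewrite /rev_path map_cat rev_cat. Qed.

Lemma loop_mul_subproof (p q : loop) :
  is_path x0 (loop_path p ++ loop_path q) x0.
Proof. by apply/is_path_cat; exists x0; split; apply: loopP. Qed.

Definition loop_mul (p q : loop) : loop := Loop (loop_mul_subproof p q).
Definition loop_one : loop := @Loop [::] (erefl x0).
Definition loop_inv (p : loop) : loop := Loop (is_path_rev (loopP p)).

Local Notation eqv := (clos_refl_sym_trans _ loop_move).

Lemma loop_mulA : associative loop_mul.
Proof. by move=> p q r; apply: loop_inj; rewrite /= catA. Qed.

Lemma loop_1mul : left_id loop_one loop_mul.
Proof. by move=> p; apply: loop_inj. Qed.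

Lemma loop_mul1 : right_id loop_one loop_mul.
Proof. by move=> p; apply: loop_inj; rewrite /= cats0. Qed.

Lemma loop_invK : involutive loop_inv.
Proof. by move=> p; apply: loop_inj; rewrite /= rev_pathK. Qed.

Lemma loop_moveMl (r p q : loop) : loop_move p q -> eqv (loop_mul r p) (loop_mul r q).
Proof.
rewrite /loop_move => h; apply: rst_step; rewrite /loop_move /=.
case: h => [l e t|l e1 e2 f1 f2 t hs]; rewrite !(catA (loop_path r)).
  exact: path_backtrack.
exact: path_square.
Qed.

Lemma loop_moveMr (r p q : loop) : loop_move p q -> eqv (loop_mul p r) (loop_mul q r).
Proof.
rewrite /loop_move => h; apply: rst_step; rewrite /loop_move /=.
case: h => [l e t|l e1 e2 f1 f2 t hs]; rewrite -!catA.
  exact: path_backtrack.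
exact: path_square.
Qed.

Lemma loop_moveV (p q : loop) : loop_move p q -> eqv (loop_inv p) (loop_inv q).
Proof.
rewrite /loop_move => h.
have : path_move (loop_path (loop_inv p)) (loop_path (loop_inv q)) \/
       path_move (loop_path (loop_inv q)) (loop_path (loop_inv p)).
  rewrite /=; case: h => [l e r|l e1 e2 f1 f2 r hs]; rewrite !rev_path_cat -!catA.
    have -> : rev_path [:: e; rev_edge e] = [:: e; rev_edge e].
      by rewrite /rev_path /= rev_edgeK.
    by left; apply: path_backtrack.
  by right; apply: (path_square _ _ (square_rev hs)).
by case=> h'; [|apply: rst_sym]; apply: rst_step.
Qed.

Lemma loop_mulV_ctx l (p : seq (edge C)) r
  (h : is_path x0 (l ++ (p ++ rev_path p) ++ r) x0)
  (h' : is_path x0 (l ++ r) x0) : eqv (Loop h) (Loop h').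
Proof.
elim: p l r h h' => [|e p IH] l r h h'.
  by rewrite (Prop_irrelevance h h'); apply: rst_refl.
have eqp : l ++ ((e :: p) ++ rev_path (e :: p)) ++ r =
           (l ++ [:: e]) ++ (p ++ rev_path p) ++ ([:: rev_edge e] ++ r).
  by rewrite -[e :: p]cat1s rev_path_cat -!catA.
have h1 : is_path x0 ((l ++ [:: e]) ++ ([:: rev_edge e] ++ r)) x0.
  move: h; rewrite eqp -!catA => /is_path_cat [y [hl /= [hy]]].
  move=> /is_path_cat [y1 [_ /is_path_cat [y2 [_ /= [_ hr]]]]].
  by apply/is_path_cat; exists y; rewrite /= src_rev.
have h2 : is_path x0 ((l ++ [:: e]) ++ (p ++ rev_path p) ++ ([:: rev_edge e] ++ r)) x0.
  by rewrite -eqp.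
have -> : Loop h = Loop h2 by apply: loop_inj.
apply: rst_trans (IH _ _ h2 h1) _; apply: rst_step.
by rewrite /loop_move /= -catA; apply: path_backtrack.
Qed.

Lemma loop_mulV (p : loop) : eqv (loop_mul p (loop_inv p)) loop_one.
Proof.
have h : is_path x0
    ([::] ++ (loop_path p ++ rev_path (loop_path p)) ++ [::]) x0.
  by rewrite cats0; exact: loopP (loop_mul p (loop_inv p)).
have -> : loop_mul p (loop_inv p) = Loop h.
  by apply: loop_inj; rewrite /= cats0.
exact: loop_mulV_ctx.
Qed.

Lemma loop_Vmul (p : loop) : eqv (loop_mul (loop_inv p) p) loop_one.
Proof. by have := loop_mulV (loop_inv p); rewrite loop_invK. Qed.

Definition loop_moves : move_system :=
  @MoveSystem loop loop_move loop_mul loop_one loop_inv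
    loop_mulA loop_1mul loop_mul1 loop_Vmul loop_mulV
    loop_moveMl loop_moveMr loop_moveV.

Definition fundamental_group : groupType := class_group loop_moves.

End FundamentalGroup.

Record semigroup_presentation := SemigroupPresentation {
  alphabet : Type;
  rels : seq alphabet -> seq alphabet -> Prop;
  rels_nonempty : forall u v, rels u v -> u <> [::] /\ v <> [::];
  rels_asym : forall u v, rels u v -> ~ rels v u }.

Section Squier.
Variable P : semigroup_presentation.
Local Notation word := (seq (alphabet P)).

Definition applicable (u v : word) : Prop := rels u v \/ rels v u.

Lemma applicable_sym u v : applicable u v -> applicable v u.
Proof. by case; [right | left]. Qed.

(* The oriented edge (a, u -> v, b). *)
Record squier_edge := SquierEdge {
  se_left : word; se_from : word; se_to : word; se_right : word;
  se_applicable : applicable se_from se_to }.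

Definition squier_src (e : squier_edge) : word :=
  se_left e ++ se_from e ++ se_right e.
Definition squier_tgt (e : squier_edge) : word :=
  se_left e ++ se_to e ++ se_right e.
Definition squier_rev (e : squier_edge) : squier_edge :=
  SquierEdge (se_left e) (se_right e) (applicable_sym (se_applicable e)).

(* The square (a, u1 -> v1, b, u2 -> v2, c). *)
Inductive squier_square :
    squier_edge -> squier_edge -> squier_edge -> squier_edge -> Prop :=
| SquierSquare a u1 v1 b u2 v2 c
    (h1 : applicable u1 v1) (h2 : applicable u2 v2) :
    squier_square
      (SquierEdge a (b ++ u2 ++ c) h1) (SquierEdge (a ++ v1 ++ b) c h2)
      (SquierEdge (a ++ u1 ++ b) c h2) (SquierEdge a (b ++ v2 ++ c) h1).

Lemma squier_src_rev e : squier_src (squier_rev e) = squier_tgt e.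
Proof. by []. Qed.

Lemma squier_tgt_rev e : squier_tgt (squier_rev e) = squier_src e.
Proof. by []. Qed.

Lemma squier_revK : involutive squier_rev.
Proof. by case=> a u v b h; congr SquierEdge; apply: Prop_irrelevance. Qed.

Lemma squier_squareP e1 e2 f1 f2 : squier_square e1 e2 f1 f2 ->
  [/\ squier_src e1 = squier_src f1, squier_tgt e1 = squier_src e2,
      squier_tgt f1 = squier_src f2 & squier_tgt e2 = squier_tgt f2].
Proof.
by case=> *; rewrite /squier_src /squier_tgt /=; split; rewrite -!catA.
Qed.

Lemma squier_square_rev e1 e2 f1 f2 : squier_square e1 e2 f1 f2 ->
  squier_square (squier_rev f2) (squier_rev f1) (squier_rev e2) (squier_rev e1).
Proof. by case=> a u1 v1 b u2 v2 c h1 h2; apply: SquierSquare. Qed.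

Definition squier_complex : square_complex :=
  SquareComplex squier_src_rev squier_tgt_rev squier_revK
    squier_squareP squier_square_rev.

(* Edge loops based at [w] stay in the connected component of [w], so this is
   the fundamental group of that component. *)
Definition diagram_group (w : word) : groupType :=
  @fundamental_group squier_complex w.

End Squier.

Definition is_diagram_group (G : groupType) : Prop :=
  exists (P : semigroup_presentation) (w : seq (alphabet P)),
    w <> [::] /\ isomorphic G (diagram_group w).

(* Main.v *)
(** Embedding.  Over the presentation [<a, b, c | aa = b, b = c, c = aa>], the
    loops [aa -> b -> c -> aa] at positions [0, ..., 12] of the word [a^14]
    commute when their positions differ by at least two; counting the rewritings
    [b -> c] according to their position is a left inverse, so the right-angled
    Artin group on the complement of a path embeds.  The pentagon group embeds
    there by sending [v] to the product of the letters [r] with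
    [2 r = v] modulo [5]: otherwise an innermost arc matching two letters over
    one vertex would contain an arc over the next vertex, and so on through all
    five vertices.  Longer cycles embed in the pentagon group by repeatedly
    passing to a subgroup of index two.

    Obstruction.  A diagram group acts on the universal cover of the Squier
    complex, where hyperplanes that cross are ordered from left to right, and the
    stabilizer of a hyperplane is the product of two commuting subgroups acting
    on its left and on its right.  If [h] is transverse to the axes of a
    generator [X_i] of [A(C_n)], then its stabilizer contains non-commuting
    products of powers of [X_i] with powers of [X_(i-1)] and of [X_(i+1)], which
    forces exactly one of the two factors to be nontrivial and gives [h] a sign.
    A hyperplane of [X_i] yields one of the opposite sign for [X_(i+1)], and all
    hyperplanes of [X_i] have the same sign, since otherwise a power of [X_i]
    would split at a cut of the word.  Signs therefore alternate along the cycle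
    and [n] is even. *)

From HB Require Import structures.
From mathcomp Require Import all_boot all_order all_algebra zify.
From mathcomp Require Import boolp.
From Stdlib Require Import Relation_Operators.
Require Import Defs.

Set Implicit Arguments.
Unset Strict Implicit.
Unset Printing Implicit Defensive.

(** * Paths in the Squier complex *)

(** The geometry is obtained without pictures of diagrams and without CAT(0) theory. That crossing
    hyperplanes are ordered depends on which letters survive a rewriting; this is tested by letting
    paths act on tuples of streams, where a surviving letter is a copied coordinate. Geodesics are
    paths meeting no hyperplane twice, and signed crossing numbers, which are homotopy invariants,
    replace half-spaces and convexity. The obstacle is that an element commuting with [g] permutes
    the finitely many [g]-orbits of hyperplanes of [g]: only its powers can be controlled.
    Everything asked of the cycle group is therefore a statement about nonzero powers of generators;
    it holds because cycles of length at least 5 contain neither triangles nor squares. Inside Artin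
    groups, words are handled by planar matchings of letters. The same tool computes the
    centralizers needed for the obstruction and proves that the pentagon group embeds. The word
    [a^14] has 13 positions because a chain of five consecutive letters must fit both above and
    below a starting letter, taken between 4 and 8. *)

Section IntegerPowers.
Variable G : groupType.
Implicit Types (x y : G) (a b : int).
Local Open Scope group_scope.

Definition zexp x a : G := if a is Negz n then x ^- n.+1 else x ^+ `|a|.

Lemma zexp_nat x (n : nat) : zexp x n = x ^+ n. Proof. by []. Qed.
Lemma zexp0 x : zexp x 0 = 1. Proof. by []. Qed.
Lemma zexp1 x : zexp x 1 = x. Proof. by []. Qed.

Lemma zexpS x a : zexp x (a + 1)%R = zexp x a * x.
Proof.
case: a => [n|[|n]].
- by rewrite (_ : (Posz n + 1)%R = n.+1) ?zexp_nat ?expgSr //; lia.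
- by rewrite /= mulVg.
rewrite (_ : (Negz n.+1 + 1)%R = Negz n) /=; last by lia.
by rewrite [x ^+ n.+2]expgS invgM mulgVK.
Qed.

Lemma zexpB1 x a : zexp x (a - 1)%R = zexp x a * x^-1.
Proof. by rewrite -{2}[a](GRing.subrK 1%R) zexpS mulgK. Qed.

Lemma zexp_ind (P : int -> Prop) : P 0%R -> (forall a, P a -> P (a + 1)%R) ->
  (forall a, P a -> P (a - 1)%R) -> forall a, P a.
Proof.
move=> h0 hp hm; elim/int_rect => // n IH.
- by rewrite (_ : Posz n.+1 = (Posz n + 1)%R); [apply: hp|lia].
- by rewrite (_ : (- Posz n.+1)%R = (- Posz n - 1)%R); [apply: hm|lia].
Qed.

Lemma zexpD x a b : zexp x (a + b)%R = zexp x a * zexp x b.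
Proof.
elim/zexp_ind: b => [|b IH|b IH]; first by rewrite GRing.addr0 mulg1.
- by rewrite GRing.addrA !zexpS IH mulgA.
- by rewrite GRing.addrA !zexpB1 IH mulgA.
Qed.

Lemma zexpN x a : zexp x (- a)%R = (zexp x a)^-1.
Proof. by apply: (mulIg (zexp x a)); rewrite -zexpD GRing.addNr mulVg. Qed.

Lemma zexpM x a b : zexp x (a * b)%R = zexp (zexp x a) b.
Proof.
elim/zexp_ind: b => [|b IH|b IH]; first by rewrite GRing.mulr0.
- by rewrite zexpS -IH -zexpD; congr zexp; lia.
- by rewrite zexpB1 -IH -zexpN -zexpD; congr zexp; lia.
Qed.

Lemma commute_zexp x y a : commute x y -> commute x (zexp y a).
Proof. by case: a => n h; [apply: commuteX|apply/commuteV/commuteX]. Qed.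

Lemma commute_zexp2 x y a b : commute x y -> commute (zexp x a) (zexp y b).
Proof. by move=> h; apply/commute_zexp/commute_sym/commute_zexp/commute_sym. Qed.

Lemma zexpMg x y a : commute x y -> zexp (x * y) a = zexp x a * zexp y a.
Proof.
move=> h; elim/zexp_ind: a => [|a IH|a IH]; first by rewrite mulg1.
- have c := commute_zexp a h.
  by rewrite !zexpS IH -!mulgA; congr (_ * _); rewrite !mulgA c.
have c := commute_zexp a (commute_sym h).
rewrite !zexpB1 IH invgM -!mulgA; congr (_ * _).
have c' : commute (zexp y a) x^-1 by apply/commuteV/commute_sym/commute_zexp.
by rewrite [RHS]mulgA -c' -mulgA; congr (_ * _); rewrite -!invgM h.
Qed.

Lemma zexpJ x y a : zexp (y * x * y^-1) a = y * zexp x a * y^-1.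
Proof.
elim/zexp_ind: a => [|a IH|a IH]; first by rewrite !zexp0 mulg1 mulgV.
- by rewrite !zexpS IH !mulgA mulgVK.
- by rewrite !zexpB1 IH !invgM invgK !mulgA mulgVK.
Qed.

End IntegerPowers.
Arguments zexp {G} x%_g a%_R : simpl never.

Section MultiplicativeMaps.
Variables (G H : groupType) (f : {multiplicative G -> H}).
Local Open Scope group_scope.

Lemma mult1 : f 1 = 1.
Proof. by apply: (mulgI (f 1)); rewrite -gmulfM !mulg1. Qed.

Lemma multV x : f x^-1 = (f x)^-1.
Proof. by apply: (mulgI (f x)); rewrite -gmulfM !mulgV mult1. Qed.

Lemma mult_zexp x a : f (zexp x a) = zexp (f x) a.
Proof.
elim/zexp_ind: a => [|a IH|a IH]; first by rewrite !zexp0 mult1.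
- by rewrite !zexpS gmulfM IH.
- by rewrite !zexpB1 gmulfM multV IH.
Qed.

Lemma mult_inj : (forall x, f x = 1 -> x = 1) -> injective f.
Proof.
move=> fI x y xy; apply: (mulIg y^-1); rewrite mulgV; apply: fI.
by rewrite gmulfM multV xy mulgV.
Qed.

End MultiplicativeMaps.

(** * Homotopy of edge paths and sums of paths *)

Section SquierPaths.
Variable P : semigroup_presentation.
Local Notation word := (seq (alphabet P)).
Local Notation edge := (squier_edge P).
Local Notation src := (@squier_src P).
Local Notation tgt := (@squier_tgt P).
Local Notation redge := (@squier_rev P).
Local Notation move := (@path_move (squier_complex P)).
Local Notation rpath := (@rev_path (squier_complex P)).
Implicit Types (a b c u v w x y z : word) (e f : edge) (p q r l : seq edge).

Lemma edge_ext e f : se_left e = se_left f -> se_from e = se_from f ->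
  se_to e = se_to f -> se_right e = se_right f -> e = f.
Proof.
case: e f => [a u v b h] [a' u' v' b' h'] /= -> eu ev ->; move: h'; rewrite -eu -ev.
by move=> h'; congr SquierEdge; apply: Prop_irrelevance.
Qed.

Lemma se_from_neq0 e : se_from e <> [::].
Proof. by case: e => a u v b /= [] /rels_nonempty []. Qed.

Lemma size_from_gt0 e : 0 < size (se_from e).
Proof. by case: (se_from e) (@se_from_neq0 e). Qed.

(** [is_path] is split into validity and a computed endpoint, so that the end of a path is a
    function of its start and its edges rather than one more word to carry along. *)
Fixpoint valid x p : Prop :=
  if p is e :: p' then src e = x /\ valid (tgt e) p' else True.

Fixpoint endw x p : word := if p is e :: p' then endw (tgt e) p' else x.

Lemma is_pathE x p y : @is_path (squier_complex P) x p y <-> valid x p /\ endw x p = y.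
Proof.
elim: p x => [|e p IH] x /=; first by split=> [->|[]].
by rewrite IH; split=> [[? []]|[[]]].
Qed.

Lemma valid_cat x p q : valid x (p ++ q) <-> valid x p /\ valid (endw x p) q.
Proof.
elim: p x => [|e p IH] x /=; first by split=> [|[]].
by rewrite IH; split=> [[? []]|[[]]].
Qed.

Lemma endw_cat x p q : endw x (p ++ q) = endw (endw x p) q.
Proof. by elim: p x => //= e p IH x. Qed.

Lemma valid_rcons x p e : valid x (rcons p e) <-> valid x p /\ src e = endw x p.
Proof. by rewrite -cats1 valid_cat /=; split=> [[? []]|[]]. Qed.

Lemma rpath_cat p q : rpath (p ++ q) = rpath q ++ rpath p.
Proof. exact: rev_path_cat. Qed.

Lemma rpath_cons e p : rpath (e :: p) = rpath p ++ [:: redge e].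
Proof. by rewrite -cat1s rpath_cat. Qed.

Lemma rpathK p : rpath (rpath p) = p.
Proof. exact: rev_pathK. Qed.

Lemma valid_rpath x p : valid x p -> valid (endw x p) (rpath p).
Proof.
move=> h; have: @is_path (squier_complex P) x p (endw x p) by apply/is_pathE.
by move/is_path_rev/is_pathE => [].
Qed.

Lemma endw_rpath x p : valid x p -> endw (endw x p) (rpath p) = x.
Proof.
move=> h; have: @is_path (squier_complex P) x p (endw x p) by apply/is_pathE.
by move/is_path_rev/is_pathE => [].
Qed.

(** [path_move] says nothing about composability, and read backwards it inserts any edge with its
    inverse anywhere; validity is therefore demanded on both sides of every step. *)
Definition hstep x p q := [/\ valid x p, valid x q & move p q].
Definition hom x : seq edge -> seq edge -> Prop := clos_refl_sym_trans _ (hstep x).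

Lemma hom_refl x p : hom x p p. Proof. exact: rst_refl. Qed.
Lemma hom_sym x p q : hom x p q -> hom x q p. Proof. exact: rst_sym. Qed.
Lemma hom_trans x q p r : hom x p q -> hom x q r -> hom x p r.
Proof. exact: rst_trans. Qed.
Hint Resolve hom_refl : core.

Lemma move_end x p q : valid x p -> valid x q -> move p q -> endw x p = endw x q.
Proof.
move=> hp hq m; case: m hp hq => [l e r|l e1 e2 f1 f2 r /squier_squareP [_ _ _ h]].
  by move=> /valid_cat [_ /= [h _]] _; rewrite !endw_cat /= -h.
by move=> _ _; rewrite !endw_cat /= h.
Qed.

Lemma hom_end x p q : hom x p q -> endw x p = endw x q.
Proof.
elim=> {p q} [p q [hp hq m]|p|p q _ ->|p q r _ -> _ ->] //.
exact: move_end m.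
Qed.

Lemma hom_validE x p q : hom x p q -> valid x p <-> valid x q.
Proof. by elim=> {p q} [p q [hp hq m]|p|p q _ ->|p q r _ -> _ ->]. Qed.

Lemma hom_valid x p q : hom x p q -> valid x p -> valid x q.
Proof. by move/hom_validE => h; apply: (proj1 h). Qed.

Lemma move_catl l p q : move p q -> move (l ++ p) (l ++ q).
Proof.
case=> [l' e r|l' e1 e2 f1 f2 r h]; rewrite !(catA l).
  exact: path_backtrack.
exact: path_square.
Qed.

Lemma move_catr r p q : move p q -> move (p ++ r) (q ++ r).
Proof.
case=> [l e r'|l e1 e2 f1 f2 r' h]; rewrite -!catA.
  exact: path_backtrack.
exact: path_square.
Qed.

Lemma hom_catl x l p q : valid x l -> hom (endw x l) p q -> hom x (l ++ p) (l ++ q).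
Proof.
move=> hl; elim=> {p q} [p q [hp hq m]|p|p q _ h|p q r _ h _ h'].
- by apply: rst_step; split; [apply/valid_cat|apply/valid_cat|apply: move_catl].
- by [].
- exact: hom_sym.
- exact: hom_trans h'.
Qed.

Lemma hom_catr x r p q : hom x p q -> valid (endw x p) r -> hom x (p ++ r) (q ++ r).
Proof.
elim=> {p q} [p q [hp hq m]|p|p q h IH|p q s h IH h' IH'] hr.
- apply: rst_step; split; [by apply/valid_cat| |exact: move_catr].
  by apply/valid_cat; rewrite -(move_end hp hq m).
- by [].
- by apply/hom_sym/IH; rewrite (hom_end h).
- by apply: hom_trans (IH hr) _; apply: IH'; rewrite -(hom_end h).
Qed.

Lemma hom_cons e p q : hom (tgt e) p q -> hom (src e) (e :: p) (e :: q).
Proof. by move=> h; apply: (@hom_catl (src e) [:: e]). Qed.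

Lemma hom_cat x p p' q q' : valid x p -> valid (endw x p) q ->
  hom x p p' -> hom (endw x p) q q' -> hom x (p ++ q) (p' ++ q').
Proof.
move=> hp hq h h'; apply: hom_trans (hom_catl hp h') _.
by apply: hom_catr => //; apply: hom_valid h' hq.
Qed.

Lemma hom_backtrack x l e r : valid x l -> src e = endw x l -> valid (src e) r ->
  hom x (l ++ [:: e; redge e] ++ r) (l ++ r).
Proof.
move=> hl he hr; apply: rst_step; split; last exact: path_backtrack.
  by apply/valid_cat; split.
by apply/valid_cat; rewrite -he.
Qed.

Lemma hom_rpathr x p : valid x p -> hom x (p ++ rpath p) [::].
Proof.
elim: p x => [|e p IH] x //= [<- hp]; rewrite rpath_cons.
have -> : e :: p ++ rpath p ++ [:: redge e] = [:: e] ++ (p ++ rpath p) ++ [:: redge e].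
  by rewrite /= catA.
apply: hom_trans (_ : hom _ ([:: e] ++ [::] ++ [:: redge e]) _).
  apply: hom_catl => //=; apply: (@hom_catr _ [:: redge e] _ [::]); first exact: IH.
  by rewrite endw_cat endw_rpath.
by apply: (@hom_backtrack _ [::] e [::]).
Qed.

Lemma hom_rpathl x p : valid x p -> hom (endw x p) (rpath p ++ p) [::].
Proof.
by move=> hp; have := hom_rpathr (valid_rpath hp); rewrite rpathK.
Qed.

Lemma hom_cancel x l p q : valid x l -> valid (endw x l) p -> valid (endw x l) q ->
  hom x (l ++ p) (l ++ q) -> hom (endw x l) p q.
Proof.
move=> hl hp hq h.
have vr := valid_rpath hl; have er := endw_rpath hl.
have h1 s : valid (endw x l) s -> hom (endw x l) (rpath l ++ l ++ s) s.
  by move=> hs; rewrite catA; apply: (@hom_catr _ s _ [::]);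
     [exact: hom_rpathl|rewrite endw_cat er].
apply: hom_trans (hom_sym (h1 _ hp)) _; apply: hom_trans (h1 _ hq).
by apply: hom_catl => //; rewrite er.
Qed.

Definition lift a b e : edge :=
  SquierEdge (a ++ se_left e) (se_right e ++ b) (se_applicable e).

Lemma src_lift a b e : src (lift a b e) = a ++ src e ++ b.
Proof. by rewrite /squier_src /= -!catA. Qed.
Lemma tgt_lift a b e : tgt (lift a b e) = a ++ tgt e ++ b.
Proof. by rewrite /squier_tgt /= -!catA. Qed.
Lemma lift_rev a b e : lift a b (redge e) = redge (lift a b e).
Proof. exact: edge_ext. Qed.
Lemma lift_lift a b a' b' e : lift a b (lift a' b' e) = lift (a ++ a') (b' ++ b) e.
Proof. by apply: edge_ext; rewrite //= -?catA. Qed.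
Lemma lift0 e : lift [::] [::] e = e.
Proof. by apply: edge_ext; rewrite //= cats0. Qed.

Lemma maplift_lift a b a' b' p :
  map (lift a b) (map (lift a' b') p) = map (lift (a ++ a') (b' ++ b)) p.
Proof. by rewrite -map_comp; apply: eq_map => e /=; rewrite lift_lift. Qed.
Lemma maplift0 p : map (lift [::] [::]) p = p.
Proof. by rewrite -[RHS]map_id; apply: eq_map => e; rewrite lift0. Qed.

Lemma valid_lift a b x p : valid x p -> valid (a ++ x ++ b) (map (lift a b) p).
Proof.
by elim: p x => //= e p IH x [<- hp]; rewrite src_lift tgt_lift; split=> //; apply: IH.
Qed.

Lemma endw_lift a b x p : endw (a ++ x ++ b) (map (lift a b) p) = a ++ endw x p ++ b.
Proof. by elim: p x => //= e p IH x; rewrite tgt_lift IH. Qed.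

Lemma rpath_lift a b p : rpath (map (lift a b) p) = map (lift a b) (rpath p).
Proof.
by rewrite /rev_path /= !map_rev -!map_comp; congr rev; apply: eq_map => e /=.
Qed.

Lemma move_lift a b p q : move p q -> move (map (lift a b) p) (map (lift a b) q).
Proof.
case=> [l e r|l e1 e2 f1 f2 r h]; rewrite !map_cat /=.
  exact: path_backtrack.
apply: path_square; case: h => a1 u1 v1 b1 u2 v2 c h1 h2 /=.
have := SquierSquare (a ++ a1) b1 (c ++ b) h1 h2.
by rewrite /lift /= -!catA.
Qed.

Lemma hom_lift a b x p q : hom x p q ->
  hom (a ++ x ++ b) (map (lift a b) p) (map (lift a b) q).
Proof.
elim=> {p q} [p q [hp hq m]|p|p q _ h|p q r _ h _ h'].
- by apply: rst_step; split; [exact: valid_lift|exact: valid_lift|exact: move_lift].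
- by [].
- exact: hom_sym.
- exact: hom_trans h'.
Qed.

Lemma hom_square m e f :
  hom (src e ++ m ++ src f)
      [:: lift [::] (m ++ src f) e; lift (tgt e ++ m) [::] f]
      [:: lift (src e ++ m) [::] f; lift [::] (m ++ tgt f) e].
Proof.
apply: rst_step; split.
- by rewrite /= !src_lift tgt_lift /= cats0 -!catA.
- by rewrite /= !src_lift tgt_lift /= !cats0 -!catA.
have h := @SquierSquare P (se_left e) _ _ (se_right e ++ m ++ se_left f) _ _ (se_right f)
  (se_applicable e) (se_applicable f).
have := @path_square (squier_complex P) [::] _ _ _ _ [::] h.
rewrite !cat0s !cats0.
by congr path_move; congr [:: _; _]; apply: edge_ext;
  rewrite /= /squier_src /squier_tgt /= -?catA ?cats0.
Qed.

(** The sum of two diagrams with the idle word [m] between them, as an edge path: [sump] runs [p] on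
    the left before [q] on the right, [sump'] runs them in the other order. *)
Definition sump a m b p q : seq edge :=
  map (lift [::] (m ++ b)) p ++ map (lift (endw a p ++ m) [::]) q.
Definition sump' a m b p q : seq edge :=
  map (lift (a ++ m) [::]) q ++ map (lift [::] (m ++ endw b q)) p.

Lemma valid_sump a m b p q : valid a p -> valid b q -> valid (a ++ m ++ b) (sump a m b p q).
Proof.
move=> hp hq; apply/valid_cat; split.
  exact: (@valid_lift [::] (m ++ b)).
rewrite (@endw_lift [::]) /=.
by have := @valid_lift (endw a p ++ m) [::] _ _ hq; rewrite cats0 -catA.
Qed.

Lemma endw_sump a m b p q : endw (a ++ m ++ b) (sump a m b p q) = endw a p ++ m ++ endw b q.
Proof.
rewrite endw_cat (@endw_lift [::]) /=.
by have := @endw_lift (endw a p ++ m) [::] b q; rewrite !cats0 -!catA => ->.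
Qed.

Lemma hom_edge_path a m e q : valid a q ->
  hom (src e ++ m ++ a) (sump (src e) m a [:: e] q) (sump' (src e) m a [:: e] q).
Proof.
elim: q a => [|f q IH] a /= hq; first exact: hom_refl.
case: hq => <- hq; rewrite /sump /sump' /=.
have h1 := hom_square m e f.
set e1 := lift _ _ e in h1 *; set f1 := lift _ _ f in h1 *.
set f2 := lift _ _ f; set e2 := lift [::] (m ++ tgt f) e in h1.
rewrite -[_ :: _ :: map _ q]cat1s.
have -> : [:: e1] ++ f1 :: map (lift (tgt e ++ m) [::]) q =
  [:: e1; f1] ++ map (lift (tgt e ++ m) [::]) q by [].
apply: hom_trans (hom_catr h1 _) _.
  rewrite /= tgt_lift /= cats0.
  by have := @valid_lift (tgt e ++ m) [::] _ _ hq; rewrite cats0.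
have ef : tgt f2 = src e ++ m ++ tgt f by rewrite tgt_lift cats0 -catA.
have sf : src f2 = src e ++ m ++ src f by rewrite src_lift cats0 -catA.
rewrite -sf; apply: (@hom_cons f2); rewrite ef; exact: IH.
Qed.

(** Rewritings of disjoint factors are exchanged one square at a time: each edge of [p] is moved
    past the whole of [q]. *)
Lemma interchange a m b p q : valid a p -> valid b q ->
  hom (a ++ m ++ b) (sump a m b p q) (sump' a m b p q).
Proof.
elim: p a => [|e p IH] a /= hp hq.
  by rewrite /sump /sump' /= cats0; apply: hom_refl.
case: hp => <- hp.
have vl := @valid_lift [::] (m ++ b) _ _ hp.
have h1 : hom (src e ++ m ++ b) (sump (src e) m b (e :: p) q)
   ([:: lift [::] (m ++ b) e] ++ sump' (tgt e) m b p q).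
  rewrite /sump /= -!/(sump _ _ _ _ _).
  have := @hom_cons (lift [::] (m ++ b) e) _ _ _.
  rewrite src_lift tgt_lift; apply; exact: IH.
apply: hom_trans h1 _.
have := @hom_catr _ (map (lift [::] (m ++ endw b q)) p) _ _ (hom_edge_path m e hq).
rewrite /sump /sump' /= -catA; apply.
rewrite tgt_lift /=.
have := @endw_lift (tgt e ++ m) [::] b q; rewrite !cats0 -!catA => ->.
by have := @valid_lift [::] (m ++ endw b q) _ _ hp; rewrite /= /squier_tgt -!catA.
Qed.

End SquierPaths.
Hint Resolve hom_refl : core.

(** * Bijections between powers of the set of streams *)

Section StreamPairing.
Implicit Types (x y s : nat -> bool) (t : seq (nat -> bool)).

Definition interleave x y : nat -> bool := fun n => if odd n then y n./2 else x n./2.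
Definition evens s : nat -> bool := fun n => s n.*2.
Definition odds s : nat -> bool := fun n => s n.*2.+1.

Lemma evens_interleave x y : evens (interleave x y) = x.
Proof. by apply/funext => n; rewrite /evens /interleave odd_double doubleK. Qed.

Lemma odds_interleave x y : odds (interleave x y) = y.
Proof. by apply/funext => n; rewrite /odds /interleave /= odd_double /= uphalf_double. Qed.

Lemma interleaveK s : interleave (evens s) (odds s) = s.
Proof.
apply/funext => n; rewrite /interleave /evens /odds.
by have := odd_double_half n; case: (odd n) => <-; rewrite ?add0n ?add1n /= ?uphalf_double ?doubleK.
Qed.

(** With [unpack], a bijection between the tuples of any given positive length and the single
    streams. The two sides of a relation may have different lengths, so the set attached to a letter
    must be in bijection with all its positive powers; [interleave] provides this. *)
Fixpoint pack t : nat -> bool :=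
  match t with
  | [::] => fun _ => false
  | x :: t' => if t' is [::] then x else interleave x (pack t')
  end.

Fixpoint unpack n s : seq (nat -> bool) :=
  match n with
  | 0 => [::]
  | n'.+1 => if n' is 0 then [:: s] else evens s :: unpack n' (odds s)
  end.

Lemma size_unpack n s : size (unpack n s) = n.
Proof. by elim: n s => //= -[|n] IH s //; rewrite /= IH. Qed.

Lemma unpackK n s : 0 < n -> pack (unpack n s) = s.
Proof.
elim: n s => //= -[|n] IH s _ //.
have := IH (odds s) isT; have := size_unpack n.+1 (odds s).
by case: (unpack n.+1 (odds s)) => //= x t _ ->; rewrite interleaveK.
Qed.

Lemma packK t : unpack (size t) (pack t) = t.
Proof.
elim: t => //= x [|y t] IH //.
by rewrite -[size (y :: t)]/(size t).+1 evens_interleave odds_interleave IH.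
Qed.

End StreamPairing.

(* A letter is interpreted as the set of streams, a word as a power of it and
   a relation as a bijection between two powers.  Edge paths then act on
   tuples of streams, homotopic ones in the same way, and an untouched letter
   is a coordinate copied from the input to the output. *)
Section StreamAction.
Variable P : semigroup_presentation.
Local Notation word := (seq (alphabet P)).
Local Notation edge := (squier_edge P).
Local Notation src := (@squier_src P).
Local Notation tgt := (@squier_tgt P).
Local Notation move := (@path_move (squier_complex P)).
Local Notation stream := (nat -> bool).
Implicit Types (a b c u v w x y z m : word) (e f : edge) (p q r l : seq edge).
Implicit Types (t : seq stream).

Definition act_edge t e : seq stream :=
  take (size (se_left e)) t ++
  unpack (size (se_to e)) (pack (take (size (se_from e)) (drop (size (se_left e)) t))) ++
  drop (size (se_left e) + size (se_from e)) t.

Definition act_path p t : seq stream := foldl act_edge t p.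

Lemma act_edgeE t1 t2 t3 e : size t1 = size (se_left e) -> size t2 = size (se_from e) ->
  act_edge (t1 ++ t2 ++ t3) e = t1 ++ unpack (size (se_to e)) (pack t2) ++ t3.
Proof.
move=> h1 h2; rewrite /act_edge -h1 -h2 take_size_cat // drop_size_cat // take_size_cat //.
by rewrite [X in drop _ X]catA drop_size_cat // size_cat.
Qed.

Lemma split3 t a u b : size t = size (a ++ u ++ b) ->
  exists t1 t2 t3, [/\ t = t1 ++ t2 ++ t3, size t1 = size a, size t2 = size u & size t3 = size b].
Proof.
rewrite !size_cat => h; exists (take (size a) t), (take (size u) (drop (size a) t)).
exists (drop (size u) (drop (size a) t)); rewrite !cat_take_drop.
have h1 : size a <= size t by lia.
have h2 : size u <= size t - size a by lia.
by rewrite !size_takel ?size_drop //; split=> //; lia.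
Qed.

Lemma size_act_edge t e : size t = size (src e) -> size (act_edge t e) = size (tgt e).
Proof.
move=> /split3 [t1 [t2 [t3 [-> h1 h2 h3]]]].
by rewrite act_edgeE // !size_cat size_unpack h1 h3.
Qed.

Lemma size_act_path x p t : valid x p -> size t = size x ->
  size (act_path p t) = size (endw x p).
Proof.
elim: p x t => //= e p IH x t [<- hp] ht; apply: IH => //; exact: size_act_edge.
Qed.

Lemma act_path_cat p q t : act_path (p ++ q) t = act_path q (act_path p t).
Proof. exact: foldl_cat. Qed.

Lemma act_edgeK t e : size t = size (src e) -> act_edge (act_edge t e) (squier_rev e) = t.
Proof.
move=> /split3 [t1 [t2 [t3 [-> h1 h2 h3]]]].
rewrite act_edgeE // act_edgeE // ?size_unpack //= unpackK -?h2 ?packK //.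
exact: size_from_gt0 (squier_rev e).
Qed.

Lemma act_path_square e1 e2 f1 f2 t : squier_square e1 e2 f1 f2 ->
  size t = size (src e1) -> act_edge (act_edge t e1) e2 = act_edge (act_edge t f1) f2.
Proof.
case=> a u1 v1 b u2 v2 c h1 h2; rewrite /squier_src /= => /split3 [t1 [t2 [t' [-> s1 s2]]]].
move=> /split3 [t3 [t4 [t5 [-> s3 s4 s5]]]].
have E1 (w w' : word) (b' : seq stream) (h : applicable w w') (s : seq stream) : size s = size w ->
  act_edge (t1 ++ s ++ b') (SquierEdge a (b ++ u2 ++ c) h) =
  t1 ++ unpack (size w') (pack s) ++ b'.
  by move=> hs; rewrite act_edgeE.
have E2 w (r : word) (s : seq stream) : size s = size w ->
  act_edge (t1 ++ s ++ t3 ++ t4 ++ t5) (SquierEdge (a ++ w ++ b) r h2) =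
  t1 ++ s ++ t3 ++ unpack (size v2) (pack t4) ++ t5.
  move=> hs; rewrite (_ : t1 ++ _ = (t1 ++ s ++ t3) ++ t4 ++ t5); last by rewrite -!catA.
  by rewrite act_edgeE //= ?size_cat ?s1 ?s3 ?hs // -!catA.
rewrite (E1 _ _ _ h1) // E2 ?size_unpack // E2 //.
by rewrite act_edgeE.
Qed.

Lemma act_path_hom x p q t : hom x p q -> valid x p -> size t = size x ->
  act_path p t = act_path q t.
Proof.
move=> h; elim: h t => {p q} [p q [hp hq m]|p|p q h IH|p q r h IH h' IH'] t hv ht //.
- case: m hp hq => [l e r|l e1 e2 f1 f2 r s] hp hq.
    move/valid_cat: hp => [hl /= [he _]].
    rewrite !act_path_cat /= act_edgeK // (size_act_path hl ht).
    by rewrite he.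
  move/valid_cat: hp => [hl /= [he _]].
  rewrite !act_path_cat /= (act_path_square s) // (size_act_path hl ht).
  by rewrite he.
- by rewrite IH //; apply/(hom_validE h).
- by rewrite IH // IH' //; apply/(hom_validE h).
Qed.

Lemma act_path_lift a b x p t1 t2 t3 : valid x p -> size t1 = size a -> size t2 = size x ->
  act_path (map (lift a b) p) (t1 ++ t2 ++ t3) = t1 ++ act_path p t2 ++ t3.
Proof.
elim: p x t2 => //= e p IH x t2 [<- hp] h1 h2.
have -> : act_edge (t1 ++ t2 ++ t3) (lift a b e) = t1 ++ act_edge t2 e ++ t3.
  case/split3: h2 => [s1 [s2 [s3 [-> q1 q2 q3]]]].
  rewrite (@act_edgeE s1) // (_ : t1 ++ _ = (t1 ++ s1) ++ s2 ++ (s3 ++ t3)); last by rewrite -!catA.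
  by rewrite act_edgeE ?size_cat ?h1 ?q1 //= -!catA.
apply: (IH (tgt e)) => //; exact: size_act_edge.
Qed.

Lemma act_path_sump a m b p q t1 t2 t3 : valid a p -> valid b q ->
  size t1 = size a -> size t2 = size m -> size t3 = size b ->
  act_path (sump a m b p q) (t1 ++ t2 ++ t3) = act_path p t1 ++ t2 ++ act_path q t3.
Proof.
move=> hp hq h1 h2 h3; rewrite /sump act_path_cat.
have /= -> := @act_path_lift [::] (m ++ b) a p [::] t1 (t2 ++ t3) hp erefl h1.
have := @act_path_lift (endw a p ++ m) [::] b q (act_path p t1 ++ t2) t3 [::] hq.
by rewrite !cats0 -!catA; apply=> //; rewrite !size_cat h2 (size_act_path hp h1).
Qed.

Local Notation nths := (nth (fun _ : nat => false)).

(** These two homotopy invariants stand for the wires of a diagram: a letter untouched by [p] is a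
    copied coordinate, and an output produced by one side of a sum ignores the inputs of the other
    side. They exclude each other because there are two different streams. *)
Definition copies x p i j := forall t, size t = size x -> nths (act_path p t) j = nths t i.
Definition ignores x p i j := forall t t', size t = size x -> size t' = size x ->
  (forall k, k != i -> nths t k = nths t' k) ->
  nths (act_path p t) j = nths (act_path p t') j.

Lemma copies_hom x p q i j : hom x p q -> valid x p -> copies x p i j -> copies x q i j.
Proof. by move=> h hv c t ht; rewrite -(act_path_hom h hv ht) c. Qed.

Lemma ignores_hom x p q i j : hom x p q -> valid x p -> ignores x p i j -> ignores x q i j.
Proof.
by move=> h hv c t t' ht ht'; rewrite -(act_path_hom h hv ht) -(act_path_hom h hv ht'); apply: c.
Qed.

Lemma copies_ignores x p i j : i < size x -> copies x p i j -> ignores x p i j -> False.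
Proof.
move=> hi hc hg.
pose T (s : nat -> bool) := mkseq (fun k => if k == i then s else fun _ => false) (size x).
have := hg (T (fun _ => true)) (T (fun _ => false)).
rewrite !hc ?size_mkseq // !nth_mkseq // eqxx => /(_ erefl erefl) h.
suff /(congr1 (fun s => s 0)) : (fun _ : nat => true) = (fun _ => false) by [].
apply: h => k ki; case: (ltnP k (size x)) => hk; last by rewrite !nth_default // size_mkseq.
by rewrite !nth_mkseq // (negbTE ki).
Qed.

Lemma copies_inj x p i i' j : i < size x -> copies x p i j -> copies x p i' j -> i = i'.
Proof.
move=> hi hc hc'; apply/eqP; apply/negPn/negP => ne.
apply: (copies_ignores hi hc) => t t' ht ht' h.
by rewrite !hc' // h // eq_sym.
Qed.

Lemma copies_sump a m b p q k : valid a p -> valid b q -> k < size m ->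
  copies (a ++ m ++ b) (sump a m b p q) (size a + k) (size (endw a p) + k).
Proof.
move=> hp hq hk t /split3 [t1 [t2 [t3 [-> h1 h2 h3]]]].
rewrite act_path_sump // !nth_cat (size_act_path hp h1) h1.
by rewrite !(ltnNge (_ + k)) !leq_addr /= !addKn h2 hk.
Qed.

Lemma ignores_sump_right a m b p q i j : valid a p -> valid b q ->
  size (endw a p) + size m <= j -> i < size a + size m ->
  ignores (a ++ m ++ b) (sump a m b p q) i j.
Proof.
move=> hp hq hj hi t t' /split3 [t1 [t2 [t3 [-> h1 h2 h3]]]].
move=> /split3 [t1' [t2' [t3' [-> h1' h2' h3']]]] h.
rewrite !act_path_sump // !nth_cat !(size_act_path hp) // h2 h2'.
have -> : (j < size (endw a p)) = false by lia.
have -> : (j - size (endw a p) < size m) = false by lia.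
congr nth; congr act_path; apply: (@eq_from_nth _ (fun _ => false)); first by rewrite h3 h3'.
move=> k hk; have := h (size a + size m + k).
rewrite !nth_cat h1 h1' h2 h2'.
have -> : (size a + size m + k < size a) = false by lia.
have -> : (size a + size m + k - size a < size m) = false by lia.
have -> : size a + size m + k - size a - size m = k by lia.
by apply; lia.
Qed.

Lemma ignores_sump_left a m b p q i j : valid a p -> valid b q ->
  j < size (endw a p) -> size a <= i ->
  ignores (a ++ m ++ b) (sump a m b p q) i j.
Proof.
move=> hp hq hj hi t t' /split3 [t1 [t2 [t3 [-> h1 h2 h3]]]].
move=> /split3 [t1' [t2' [t3' [-> h1' h2' h3']]]] h.
rewrite !act_path_sump // !nth_cat !(size_act_path hp) // hj.
congr nth; congr act_path; apply: (@eq_from_nth _ (fun _ => false)); first by rewrite h1 h1'.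
move=> k hk; have := h k; rewrite !nth_cat hk h1' -h1 hk; apply; lia.
Qed.

End StreamAction.

(** * Composition of sums of paths *)

Section Sump.
Variable P : semigroup_presentation.
Local Notation word := (seq (alphabet P)).
Local Notation edge := (squier_edge P).
Local Notation src := (@squier_src P).
Local Notation tgt := (@squier_tgt P).
Local Notation redge := (@squier_rev P).
Local Notation rpath := (@rev_path (squier_complex P)).
Implicit Types (a b c u v w x y z m : word) (e f : edge) (p q r l : seq edge).

Lemma hom_sump a m b p p' q q' : valid a p -> valid b q -> hom a p p' -> hom b q q' ->
  hom (a ++ m ++ b) (sump a m b p q) (sump a m b p' q').
Proof.
move=> hp hq h h'; rewrite /sump -(hom_end h).
have e1 := @endw_lift _ [::] (m ++ b) a p.
apply: hom_cat.
- exact: (@valid_lift _ [::] (m ++ b)).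
- rewrite e1 /=; have := @valid_lift _ (endw a p ++ m) [::] _ _ hq.
  by rewrite cats0 -catA.
- exact: (@hom_lift _ [::] (m ++ b)).
- rewrite e1 /=; have := @hom_lift _ (endw a p ++ m) [::] _ _ _ h'.
  by rewrite cats0 -catA.
Qed.

(** Only the middle factors are out of order: [q] on the right has to be exchanged with [p'] on the
    left. *)
Lemma sump_sump a m b p q p' q' : valid a (p ++ p') -> valid b (q ++ q') ->
  hom (a ++ m ++ b) (sump a m b p q ++ sump (endw a p) m (endw b q) p' q')
     (sump a m b (p ++ p') (q ++ q')).
Proof.
move=> /valid_cat [hp hp'] /valid_cat [hq hq']; rewrite /sump !map_cat endw_cat -!catA.
have v1 := @valid_lift _ [::] (m ++ b) _ _ hp.
apply: hom_catl => //; rewrite (@endw_lift _ [::]) /= !(catA (map _ q)).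
rewrite [X in hom _ _ X]catA.
apply: hom_catr; last first.
  have -> : endw (endw a p ++ m ++ b)
     ([seq lift (endw a p ++ m) [::] i | i <- q] ++
      [seq lift [::] (m ++ endw b q) i | i <- p']) = endw (endw a p) p' ++ m ++ endw b q.
    rewrite endw_cat; have := @endw_lift _ (endw a p ++ m) [::] b q.
    by rewrite !cats0 -!catA => ->; rewrite (@endw_lift _ [::]).
  by have := @valid_lift _ (endw (endw a p) p' ++ m) [::] _ _ hq'; rewrite cats0 -catA.
exact/hom_sym/interchange.
Qed.

(** The squares that [e] spans with the edges of [p] on its left and of [q] on its right fill a
    strip with ends [e] and [f]. This is what lets parallelism pass to the reversed edges. *)
Lemma hom_sump_mid e p q : valid (se_left e) p -> valid (se_right e) q ->
  let f := SquierEdge (endw (se_left e) p) (endw (se_right e) q) (se_applicable e) in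
  hom (src e) (sump (se_left e) (se_from e) (se_right e) p q ++ [:: f])
     (e :: sump (se_left e) (se_to e) (se_right e) p q).
Proof.
case: e => a u v b h /= hp hq; set a' := endw a p; set b' := endw b q.
rewrite /squier_src /=.
pose e0 := SquierEdge [::] [::] h.
have s0 : src e0 = u by rewrite /squier_src /= cats0.
have t0 : tgt e0 = v by rewrite /squier_tgt /= cats0.
have := @interchange _ u [::] b [:: e0] q; rewrite /= s0 ?t0 => /(_ (conj erefl I) hq).
rewrite /sump /sump' /= ?t0 !cats0 => h1.
have := @interchange _ a [::] (u ++ b) p [:: lift [::] b e0] hp.
rewrite /= src_lift ?tgt_lift s0 ?t0 /= => /(_ (conj erefl I)).
rewrite /sump /sump' /= !cats0 => h2.
have lE c : lift c [::] (lift [::] b e0) = SquierEdge c b h.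
  by rewrite lift_lift; apply: edge_ext; rewrite /= ?cats0.
have lE' : lift [::] b' e0 = SquierEdge [::] b' h by apply: edge_ext.
rewrite !lE tgt_lift t0 /= in h2.
have h1' := hom_lift a' [::] (hom_sym h1); rewrite map_cat /= !cats0 !maplift_lift /= in h1'.
rewrite lE -/b' lE' in h1'.
have eq1 : lift a' [::] (SquierEdge [::] b' h) = SquierEdge a' b' h.
  by apply: edge_ext; rewrite /= ?cats0.
rewrite eq1 in h1'.
rewrite -catA; set al := map _ p.
have val : valid (a ++ u ++ b) al by exact: (@valid_lift _ [::] (u ++ b)).
have eal : endw (a ++ u ++ b) al = a' ++ u ++ b by exact: (@endw_lift _ [::] (u ++ b)).
apply: hom_trans (_ : hom _ (al ++ [:: SquierEdge a' b h] ++ _) _).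
  by apply: hom_catl => //; rewrite eal; exact: h1'.
rewrite -cat_cons (catA al); apply: (hom_catr h2).
rewrite endw_cat eal /= /squier_tgt /=.
by have := @valid_lift _ (a' ++ v) [::] _ _ hq; rewrite cats0 -catA.
Qed.

End Sump.

(** * Hyperplanes of the universal cover *)

Section Cover.
Local Open Scope quotient_scope.
Variables (P : semigroup_presentation) (w0 : seq (alphabet P)).
Local Notation word := (seq (alphabet P)).
Local Notation edge := (squier_edge P).
Local Notation src := (@squier_src P).
Local Notation tgt := (@squier_tgt P).
Local Notation redge := (@squier_rev P).
Local Notation rpath := (@rev_path (squier_complex P)).
Local Notation G := (@diagram_group P w0).
Implicit Types (a b c u v w x y z m : word) (e f : edge) (p q r l : seq edge).

Record based_path := BasedPath { bpath : seq edge; bpathP : valid w0 bpath }.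

Definition bp_eqv (p q : {classic based_path}) : bool := `[< hom w0 (bpath p) (bpath q) >].
Lemma bp_eqv_refl : reflexive bp_eqv.
Proof. by move=> p; apply/asboolP. Qed.
Lemma bp_eqv_sym : symmetric bp_eqv.
Proof. by move=> p q; apply/asboolP/asboolP; apply: hom_sym. Qed.
Lemma bp_eqv_trans : transitive bp_eqv.
Proof. by move=> q p r /asboolP h /asboolP h'; apply/asboolP; apply: hom_trans h'. Qed.
Canonical bp_equiv := EquivRel bp_eqv bp_eqv_refl bp_eqv_sym bp_eqv_trans.

(* The vertices of the universal cover of the component of [w0]. *)
Definition cover : Type := {eq_quot bp_equiv}.
HB.instance Definition _ := Choice.on cover.
HB.instance Definition _ := EqQuotient.on cover.

Implicit Types (Q R S Z : cover) (g k : G).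

Definition bp_nil : based_path := @BasedPath [::] I.

(* Junk value [cl [::]] when [p] does not start at [w0]. *)
Definition cl p : cover :=
  \pi_cover (if pselect (valid w0 p) is left h then BasedPath h else bp_nil : {classic based_path}).
Definition vrep Q : seq edge := bpath (repr Q).
Definition ev Q : word := endw w0 (vrep Q).

Lemma vrepP Q : valid w0 (vrep Q).
Proof. exact: bpathP. Qed.
Hint Resolve vrepP : core.

Lemma clP p q : valid w0 p -> valid w0 q -> cl p = cl q <-> hom w0 p q.
Proof.
move=> hp hq; rewrite /cl; case: pselect => // hp'; case: pselect => // hq'.
by split=> [/eqmodP/asboolP|h] //; apply/eqmodP/asboolP.
Qed.

Lemma vrepK Q : cl (vrep Q) = Q.
Proof.
rewrite /cl; case: pselect => [h|/(_ (vrepP Q))//].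
by rewrite -[RHS]reprK; apply/eqmodP/asboolP; apply: hom_refl.
Qed.

Lemma vrep_cl p : valid w0 p -> hom w0 (vrep (cl p)) p.
Proof. by move=> hp; apply/clP => //; rewrite vrepK. Qed.

Lemma ev_cl p : valid w0 p -> ev (cl p) = endw w0 p.
Proof. by move=> /vrep_cl /hom_end. Qed.

(** The end of the lift of the edge path [p] that starts at [Q]; meaningful when [p] is valid from
    the word [ev Q]. *)
Definition walk Q p : cover := cl (vrep Q ++ p).
Definition base : cover := cl [::].

Lemma vrep_walk Q p : valid (ev Q) p -> hom w0 (vrep (walk Q p)) (vrep Q ++ p).
Proof. by move=> hp; apply: vrep_cl; apply/valid_cat. Qed.

Lemma ev_walk Q p : valid (ev Q) p -> ev (walk Q p) = endw (ev Q) p.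
Proof. by move=> hp; rewrite ev_cl ?endw_cat //; apply/valid_cat. Qed.

Lemma walk_cl p q : valid w0 p -> valid (endw w0 p) q -> walk (cl p) q = cl (p ++ q).
Proof.
move=> hp hq; have h := vrep_cl hp; apply/clP.
- by apply/valid_cat; rewrite (hom_end h).
- exact/valid_cat.
- by apply: hom_catr => //; rewrite (hom_end h).
Qed.

Lemma walk0 Q : walk Q [::] = Q.
Proof. by rewrite /walk cats0 vrepK. Qed.

Lemma walk_cat Q p q : valid (ev Q) p -> valid (endw (ev Q) p) q ->
  walk (walk Q p) q = walk Q (p ++ q).
Proof.
move=> hp hq; rewrite [X in walk X q]/walk walk_cl -?catA //; first exact/valid_cat.
by rewrite endw_cat.
Qed.

Lemma walk_hom Q p q : valid (ev Q) p -> hom (ev Q) p q -> walk Q p = walk Q q.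
Proof.
move=> hp h; apply/clP; [exact/valid_cat| |exact: hom_catl].
by apply/valid_cat; split => //; apply: hom_valid h hp.
Qed.

(** Simple connectedness of the cover; the homotopy is obtained by cancelling the chosen path from
    the base vertex to [Q]. *)
Lemma walk_inj Q p q : valid (ev Q) p -> valid (ev Q) q -> walk Q p = walk Q q ->
  hom (ev Q) p q.
Proof.
move=> hp hq /clP h; apply: (hom_cancel (vrepP Q)) => //.
by apply: h; apply/valid_cat.
Qed.

Lemma ev_base : ev base = w0.
Proof. by rewrite ev_cl. Qed.

Lemma base_walk Q : walk base (vrep Q) = Q.
Proof. by rewrite walk_cl ?vrepK. Qed.

Lemma walk_rpath Q p : valid (ev Q) p -> walk (walk Q p) (rpath p) = Q.
Proof.
move=> hp; have v := valid_rpath hp; rewrite walk_cat //.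
have vv : valid (ev Q) (p ++ rpath p) by apply/valid_cat.
by rewrite (walk_hom vv (hom_rpathr hp)) walk0.
Qed.

Lemma walk_cons Q e p : src e = ev Q -> valid (tgt e) p ->
  walk Q (e :: p) = walk (walk Q [:: e]) p.
Proof. by move=> he hp; rewrite walk_cat //= -?he. Qed.

Lemma ev_walk1 Q e : src e = ev Q -> ev (walk Q [:: e]) = tgt e.
Proof. by move=> he; rewrite ev_walk. Qed.

Lemma walk_backtrack Q e : src e = ev Q -> walk (walk Q [:: e]) [:: redge e] = Q.
Proof. by move=> he; apply: (@walk_rpath Q [:: e]). Qed.

Lemma walk_ex Q R : exists p, valid (ev Q) p /\ walk Q p = R.
Proof.
exists (rpath (vrep Q) ++ vrep R).
have h1 := valid_rpath (vrepP Q).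
have h2 : valid (ev Q) (rpath (vrep Q) ++ vrep R).
  by apply/valid_cat; split => //; rewrite endw_rpath.
split=> //; rewrite -walk_cat //; last by rewrite endw_rpath.
rewrite -{1}(base_walk Q) walk_rpath ?base_walk //.
by rewrite ev_base.
Qed.

Definition lrep g : seq edge := loop_path (repr g : loop (C := squier_complex P) w0).

Lemma lrepP g : valid w0 (lrep g) /\ endw w0 (lrep g) = w0.
Proof. exact/is_pathE/loopP. Qed.

Definition act g Q : cover := cl (lrep g ++ vrep Q).

Lemma loop_eqv_hom (l1 l2 : loop (C := squier_complex P) w0) :
  @ms_eqv (loop_moves (C := squier_complex P) w0) l1 l2 <-> hom w0 (loop_path l1) (loop_path l2).
Proof.
split.
  elim=> {l1 l2} [l1 l2 h|l|l l' _ h|l l' l'' _ h _ h'].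
  - by apply: rst_step; split=> //;
      [case/is_pathE: (loopP l1)|case/is_pathE: (loopP l2)].
  - exact: rst_refl.
  - exact: hom_sym.
  - exact: hom_trans h'.
have gen p q : hom w0 p q -> forall hp hq,
   @ms_eqv (loop_moves (C := squier_complex P) w0) (@Loop (squier_complex P) w0 p hp) (@Loop (squier_complex P) w0 q hq).
  elim=> {p q} [p q [hp hq m]|p|p q h IH|p q s h IH h' IH'] hp' hq'.
  - by apply: rst_step.
  - by rewrite (Prop_irrelevance hp' hq'); apply: rst_refl.
  - by apply: rst_sym; apply: IH.
  - have hq : @is_path (squier_complex P) w0 q w0.
      move/is_pathE: hp' => [v e]; apply/is_pathE; split; first exact: (hom_valid h).
      by rewrite -(hom_end h).
    exact: rst_trans (IH hp' hq) (IH' hq hq').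
by case: l1 l2 => [p hp] [q hq] /= h; apply: gen.
Qed.

Lemma lrepM g k : hom w0 (lrep (g * k)%g) (lrep g ++ lrep k).
Proof.
by apply/(@loop_eqv_hom _ (loop_mul (repr g : loop _) (repr k : loop _)))/class_ofP;
   rewrite class_of_repr.
Qed.

Lemma lrep1 : hom w0 (lrep 1%g) [::].
Proof. by apply/(@loop_eqv_hom _ (@loop_one (squier_complex P) w0))/class_ofP; rewrite class_of_repr. Qed.

Lemma lrep_inj g k : hom w0 (lrep g) (lrep k) -> g = k.
Proof.
by move/loop_eqv_hom => h; rewrite -(class_of_repr g) -(class_of_repr k); apply/class_ofP.
Qed.

Lemma lrep_ex p : valid w0 p -> endw w0 p = w0 -> exists g, hom w0 (lrep g) p.
Proof.
move=> hp ep; have lp : @is_path (squier_complex P) w0 p w0 by apply/is_pathE.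
exists (class_of (M := loop_moves (C := squier_complex P) w0) (Loop lp)).
by apply/(@loop_eqv_hom _ (Loop lp))/class_ofP; rewrite class_of_repr.
Qed.

Lemma act_cl g p : valid w0 p -> act g (cl p) = cl (lrep g ++ p).
Proof.
move=> hp; case: (lrepP g) => hg eg; apply/clP.
- by apply/valid_cat; rewrite eg.
- by apply/valid_cat; rewrite eg.
- by apply: hom_catl => //; rewrite eg; apply: vrep_cl.
Qed.

Lemma actM g k Q : act (g * k)%g Q = act g (act k Q).
Proof.
have [hg eg] := lrepP g; have [hk ek] := lrepP k.
have hQ : valid w0 (lrep k ++ vrep Q) by apply/valid_cat; rewrite ek.
rewrite [act k Q]/act act_cl //; apply/clP.
- by apply/valid_cat; split; [case: (lrepP (g * k)%g)|case: (lrepP (g * k)%g) => _ ->].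
- by apply/valid_cat; rewrite eg.
- rewrite catA; apply: hom_catr; first exact: lrepM.
  by case: (lrepP (g * k)%g) => _ ->.
Qed.

Lemma act1 Q : act 1%g Q = Q.
Proof.
have [h1 e1] := lrepP 1%g.
rewrite -[RHS]vrepK; apply/clP => //; first by apply/valid_cat; rewrite e1.
by apply: (@hom_catr _ _ (vrep Q) _ [::]); [exact: lrep1|rewrite e1].
Qed.

Lemma actK g Q : act g^-1%g (act g Q) = Q.
Proof. by rewrite -actM mulVg act1. Qed.
Lemma actKV g Q : act g (act g^-1%g Q) = Q.
Proof. by rewrite -actM mulgV act1. Qed.

Lemma ev_act g Q : ev (act g Q) = ev Q.
Proof.
have [hg eg] := lrepP g.
by rewrite ev_cl; [rewrite endw_cat eg|apply/valid_cat; rewrite eg].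
Qed.

Lemma act_walk g Q p : valid (ev Q) p -> act g (walk Q p) = walk (act g Q) p.
Proof.
have [hg eg] := lrepP g; move=> hp.
rewrite /walk act_cl; last exact/valid_cat.
rewrite -/(walk _ _) walk_cl ?endw_cat ?eg // ?catA //.
by apply/valid_cat; rewrite eg.
Qed.

Lemma act_free g Q : act g Q = Q -> g = 1%g.
Proof.
have [hg eg] := lrepP g; have [h1 e1] := lrepP 1%g.
rewrite -{2}[Q]act1 => /clP h; apply: lrep_inj.
have v k : valid w0 (lrep k ++ vrep Q).
  by have [hk ek] := lrepP k; apply/valid_cat; rewrite ek.
have {h} := h (v _) (v _).
move=> /(@hom_catr _ _ (rpath (vrep Q))); rewrite endw_cat eg => /(_ (valid_rpath (vrepP Q))).
have e k : hom w0 ((lrep k ++ vrep Q) ++ rpath (vrep Q)) (lrep k).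
  have [hk ek] := lrepP k; rewrite -catA -[X in hom _ _ X]cats0; apply: hom_catl => //.
  by rewrite ek; apply: hom_rpathr.
by move=> h; apply: hom_trans (hom_sym (e _)) _; apply: hom_trans h (e _).
Qed.

Lemma act_inj g k Q : act g Q = act k Q -> g = k.
Proof.
move=> h; have : act (k^-1 * g)%g Q = Q by rewrite actM h actK.
by move/act_free => h1; rewrite -[g](mulVKg k) h1 mulg1.
Qed.

(** Going out along the path of [R] and returning along that of [Q] projects to a loop at [w0], and
    this loop is the required element. *)
Lemma act_trans Q R : ev Q = ev R -> exists g, act g Q = R.
Proof.
move=> e; have vR := valid_rpath (vrepP Q).
have v : valid w0 (vrep R ++ rpath (vrep Q)) by apply/valid_cat; rewrite -/(ev R) -e.
have [|g hg] := @lrep_ex _ v.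
  by rewrite endw_cat -/(ev R) -e endw_rpath.
have [vg eg] := lrepP g.
exists g; rewrite -[RHS]vrepK; apply/clP => //; first by apply/valid_cat; rewrite eg.
apply: hom_trans (hom_catr hg _) _; first by rewrite eg.
rewrite -catA -[X in hom _ _ X]cats0; apply: hom_catl => //.
by rewrite -/(ev R) -e; apply: hom_rpathl.
Qed.

End Cover.
Hint Resolve vrepP : core.

Lemma cat_eq_prefix (T : Type) (x y x' y' : seq T) : x ++ y = x' ++ y' ->
  size x <= size x' -> exists m, x' = x ++ m /\ y = m ++ y'.
Proof.
elim: x x' => [|t x IH] [|t' x'] //= h hs; [by exists [::]|by exists (t' :: x')|].
by case: h => -> /IH /(_ hs) [m [-> ->]]; exists m.
Qed.

Lemma cat_eq_right (T : Type) (x y z : seq T) : x ++ y = x ++ z -> y = z.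
Proof. by elim: x => //= t x IH [/IH]. Qed.

(** * Parallel edges and the order of crossing hyperplanes *)

Section Hyperplanes.
Variables (P : semigroup_presentation) (w0 : seq (alphabet P)).
Local Notation word := (seq (alphabet P)).
Local Notation edge := (squier_edge P).
Local Notation src := (@squier_src P).
Local Notation tgt := (@squier_tgt P).
Local Notation redge := (@squier_rev P).
Local Notation rpath := (@rev_path (squier_complex P)).
Local Notation G := (@diagram_group P w0).
Local Notation cover := (@cover P w0).
Implicit Types (a b c u v w x y z m : word) (e f g : edge) (p q r l : seq edge).
Implicit Types (Q R S Z : cover).

Definition hyperplane : Type := {classic (cover -> edge -> Prop)}.
HB.instance Definition _ := Choice.on hyperplane.
Implicit Types (h k : hyperplane).

Definition slide e p q : edge :=
  SquierEdge (endw (se_left e) p) (endw (se_right e) q) (se_applicable e).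
Definition slide_path e p q : seq edge := sump (se_left e) (se_from e) (se_right e) p q.

(* Parallel oriented edges of the universal cover: opposite sides of a chain
   of squares. *)
Definition par Q e R f := exists p q,
  [/\ valid (se_left e) p, valid (se_right e) q, f = slide e p q & R = walk Q (slide_path e p q)].

Lemma valid_slide e p q : valid (se_left e) p -> valid (se_right e) q ->
  valid (src e) (slide_path e p q).
Proof. exact: valid_sump. Qed.

Lemma endw_slide e p q : endw (src e) (slide_path e p q) = src (slide e p q).
Proof. exact: endw_sump. Qed.

Lemma par_src Q e R f : src e = ev Q -> par Q e R f -> src f = ev R.
Proof.
move=> he [p [q [hp hq -> ->]]]; rewrite ev_walk -he ?endw_slide //.
exact: valid_slide.
Qed.

Lemma par_refl Q e : src e = ev Q -> par Q e Q e.
Proof. by exists [::], [::]; split; rewrite ?walk0 //; apply: edge_ext. Qed.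

Lemma par_trans R f Q e S g : src e = ev Q -> par Q e R f -> par R f S g -> par Q e S g.
Proof.
move=> he [p [q [hp hq -> ->]]] [p' [q' [/= hp' hq' -> ->]]].
have v1 : valid (se_left e) (p ++ p') by apply/valid_cat.
have v2 : valid (se_right e) (q ++ q') by apply/valid_cat.
exists (p ++ p'), (q ++ q'); split=> //.
  by apply: edge_ext; rewrite //= endw_cat.
have v3 := valid_slide hp hq.
rewrite walk_cat -?he //; last by rewrite endw_slide; apply: valid_sump.
apply: walk_hom; rewrite -he.
  by apply/valid_cat; split => //; rewrite endw_slide; apply: valid_sump.
exact: sump_sump.
Qed.

Lemma par_sym Q e R f : src e = ev Q -> par Q e R f -> par R f Q e.
Proof.
move=> he [p [q [hp hq -> ->]]].
have hp' := valid_rpath hp; have hq' := valid_rpath hq.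
exists (rpath p), (rpath q); split=> //.
  by apply: edge_ext; rewrite //= endw_rpath.
have v3 := valid_slide hp hq.
rewrite walk_cat -?he //; last by rewrite endw_slide; apply: valid_sump.
rewrite -[LHS]walk0; apply: walk_hom => //; rewrite -he; apply/hom_sym.
have v1 : valid (se_left e) (p ++ rpath p) by apply/valid_cat.
have v2 : valid (se_right e) (q ++ rpath q) by apply/valid_cat.
apply: hom_trans (sump_sump (se_from e) v1 v2) _.
by apply: (@hom_sump _ _ _ _ _ [::] _ [::]) => //; apply: hom_rpathr.
Qed.

Lemma par_rev Q e R f : src e = ev Q -> par Q e R f ->
  par (walk Q [:: e]) (redge e) (walk R [:: f]) (redge f).
Proof.
move=> he [p [q [hp hq -> ->]]]; exists p, q; split=> //.
have v3 := valid_slide hp hq.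
have v4 : valid (tgt e) (slide_path (redge e) p q) by apply: valid_sump.
rewrite walk_cat -?he //; last by rewrite endw_slide.
rewrite -walk_cons //; apply: walk_hom; rewrite -he.
  by apply/valid_cat; split=> //; rewrite endw_slide.
exact: hom_sump_mid.
Qed.

Lemma redgeK e : redge (redge e) = e. Proof. exact: edge_ext. Qed.

Definition hyp Q e : hyperplane :=
  fun R f => src f = ev R /\ (par Q e R f \/ par (walk Q [:: e]) (redge e) R f).

Lemma hyp_par Q e R f : src e = ev Q -> par Q e R f -> hyp Q e = hyp R f.
Proof.
move=> he hp; have hf := par_src he hp.
have hp' := par_sym he hp; have hr := par_rev he hp; have hr' := par_rev hf hp'.
have er : src (redge e) = ev (walk Q [:: e]) by rewrite ev_walk1.
have fr : src (redge f) = ev (walk R [:: f]) by rewrite ev_walk1.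
apply/funext => S; apply/funext => g; apply/propext; split=> -[hg [h|h]]; split=> //.
- by left; apply: (par_trans hf hp' h).
- by right; apply: (par_trans fr hr' h).
- by left; apply: (par_trans he hp h).
- by right; apply: (par_trans er hr h).
Qed.

Lemma hyp_rev Q e : src e = ev Q -> hyp (walk Q [:: e]) (redge e) = hyp Q e.
Proof.
move=> he; apply/funext => S; apply/funext => g; apply/propext.
rewrite /hyp redgeK walk_backtrack //.
by split=> -[hg [h|h]]; split=> //; [right|left|right|left].
Qed.

Lemma hyp_eq_par Q e R f : src e = ev Q -> src f = ev R -> hyp Q e = hyp R f ->
  par Q e R f \/ par (walk Q [:: e]) (redge e) R f.
Proof.
move=> he hf h.
have : hyp R f R f by split=> //; left; apply: par_refl.
by rewrite -h => -[].
Qed.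

(** Relations are ordered pairs, which orients every hyperplane consistently with parallelism and
    with the group action: no element can invert a hyperplane. The sign changes under reversal
    because a relation and its converse never both belong to the presentation. *)
Definition sgn e : int := (if `[< rels (se_from e) (se_to e) >] then 1 else -1)%R.

Lemma sgn_rev e : sgn (redge e) = (- sgn e)%R.
Proof.
rewrite /sgn /=; case: (asboolP (rels (se_from e) _)) => h; case: asboolP => h' //.
- by case: (rels_asym h h').
- by case: (se_applicable e).
Qed.

Lemma sgn_cases e : sgn e = 1%R \/ sgn e = (-1)%R.
Proof. by rewrite /sgn; case: asboolP; [left|right]. Qed.

Lemma sgn_neq0 e : sgn e <> 0%R.
Proof. by case: (sgn_cases e) => ->. Qed.

Lemma sgn_par Q e R f : par Q e R f -> sgn f = sgn e.
Proof. by case=> p [q [_ _ -> _]]. Qed.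

Lemma hyp_sgn_par Q e R f : src e = ev Q -> src f = ev R -> hyp Q e = hyp R f ->
  sgn e = sgn f -> par Q e R f.
Proof.
move=> he hf h hs; case: (hyp_eq_par he hf h) => // /sgn_par; rewrite sgn_rev -hs.
by case: (sgn_cases e) => ->.
Qed.

Fixpoint hyps Q p : seq hyperplane :=
  if p is e :: p' then hyp Q e :: hyps (walk Q [:: e]) p' else [::].

Fixpoint cnt h Q p : int :=
  (if p is e :: p' then
    (if h == hyp Q e then sgn e else 0) + cnt h (walk Q [:: e]) p' else 0)%R.

Lemma hyps_cat Q p q : valid (ev Q) (p ++ q) -> hyps Q (p ++ q) = hyps Q p ++ hyps (walk Q p) q.
Proof.
elim: p Q => [|e p IH] Q /=; first by rewrite walk0.
move=> [he hv]; rewrite IH ?ev_walk1 //.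
by move/valid_cat: hv => [hp _]; rewrite -walk_cons.
Qed.

Lemma size_hyps Q p : size (hyps Q p) = size p.
Proof. by elim: p Q => //= e p IH Q; rewrite IH. Qed.

Lemma cnt_cat h Q p q : valid (ev Q) (p ++ q) ->
  cnt h Q (p ++ q) = (cnt h Q p + cnt h (walk Q p) q)%R.
Proof.
elim: p Q => [|e p IH] Q /=; first by rewrite walk0 GRing.add0r.
move=> [he hv]; rewrite IH ?ev_walk1 //.
by move/valid_cat: hv => [hp _]; rewrite -walk_cons // GRing.addrA.
Qed.

Lemma cnt_notin h Q p : h \notin hyps Q p -> cnt h Q p = 0%R.
Proof.
elim: p Q => //= e p IH Q; rewrite inE negb_or => /andP [/negbTE -> /IH ->].
by [].
Qed.

Lemma in_hyps h Q p : valid (ev Q) p -> h \in hyps Q p ->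
  exists p1 e p2, p = p1 ++ e :: p2 /\ h = hyp (walk Q p1) e.
Proof.
elim: p Q => //= e p IH Q [he hp]; rewrite inE => /orP [/eqP ->|].
  by exists [::], e, p; rewrite walk0.
rewrite -(ev_walk1 he) in hp.
move=> /(IH _ hp) [p1 [f [p2 [ep ->]]]]; exists (e :: p1), f, p2; split; first by rewrite ep.
by move: hp; rewrite ep ev_walk1 // => /valid_cat [hp1 _]; rewrite (walk_cons he hp1).
Qed.

Lemma not_uniq_hyps Q p : valid (ev Q) p -> ~~ uniq (hyps Q p) ->
  exists p1 e p2 f p3, p = p1 ++ e :: p2 ++ f :: p3 /\
    hyp (walk Q p1) e = hyp (walk Q (p1 ++ e :: p2)) f.
Proof.
elim: p Q => //= e p IH Q [he hp]; rewrite -(ev_walk1 he) in hp.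
rewrite negb_and negbK => /orP [/(in_hyps hp) [p1 [f [p2 [ep eh]]]]|].
  exists [::], e, p1, f, p2; split; first by rewrite ep.
  rewrite walk0 eh [_ ++ _]/=.
  by move: hp; rewrite ep ev_walk1 // => /valid_cat [hp1 _]; rewrite (walk_cons he hp1).
move=> /(IH _ hp) [p1 [f [p2 [g [p3 [ep eh]]]]]].
exists (e :: p1), f, p2, g, p3; split; first by rewrite ep.
move: hp; rewrite ep => /valid_cat [h1 /= [h2 /valid_cat [h3 _]]]; rewrite ev_walk1 // in h1 h2.
have h4 : valid (tgt e) (p1 ++ f :: p2) by apply/valid_cat.
by rewrite (walk_cons he h1) eh (walk_cons he h4).
Qed.

(* [disj e f]: the two edges rewrite disjoint subwords, that of [e] being on
   the left. *)
Definition disj e f := exists m,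
  se_right e = m ++ se_from f ++ se_right f /\ se_left f = se_left e ++ se_from e ++ m.

Lemma disj_src e f : disj e f -> src e = src f.
Proof. by move=> [m [h1 h2]]; rewrite /squier_src h1 h2 -!catA. Qed.

Lemma disj_square Q e f : src e = ev Q -> disj e f -> exists e' f',
  [/\ hom (ev Q) [:: e; f'] [:: f; e'], valid (ev Q) [:: e; f'] /\ valid (ev Q) [:: f; e'],
      par Q f (walk Q [:: e]) f', par Q e (walk Q [:: f]) e' &
      disj (redge e) f' /\ disj e' (redge f)].
Proof.
move=> he [m [h1 h2]].
pose f' := SquierEdge (se_left e ++ se_to e ++ m) (se_right f) (se_applicable f).
pose e' := SquierEdge (se_left e) (m ++ se_to f ++ se_right f) (se_applicable e).
have efQ : src f = ev Q by rewrite -he; apply/esym/disj_src; exists m.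
exists e', f'; split.
- rewrite -he; apply: rst_step; split.
  + by split=> //; split=> //; rewrite /squier_src /squier_tgt /= h1 -!catA.
  + split; first by rewrite he efQ.
    by split=> //; rewrite /squier_src /squier_tgt /= h2 -!catA.
  have s := @SquierSquare P (se_left e) _ _ m _ _ (se_right f) (se_applicable e) (se_applicable f).
  have E1 : SquierEdge (se_left e) (m ++ se_from f ++ se_right f) (se_applicable e) = e.
    by apply: edge_ext; rewrite //= h1.
  have E2 : SquierEdge (se_left e ++ se_from e ++ m) (se_right f) (se_applicable f) = f.
    by apply: edge_ext; rewrite //= h2.
  rewrite E1 E2 in s.
  exact: (@path_square (squier_complex P) [::] _ _ _ _ [::] s).
- by split; split=> //; split=> //; rewrite /squier_src /squier_tgt /= ?h1 ?h2 -!catA.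
- exists [:: SquierEdge (se_left e) m (se_applicable e)], [::]; split.
  + by split=> //; rewrite /squier_src /= h2.
  + by [].
  + by apply: edge_ext.
  by congr walk; rewrite /slide_path /sump /=; congr [:: _]; apply: edge_ext; rewrite //= h1.
- exists [::], [:: SquierEdge m (se_right f) (se_applicable f)]; split.
  + by [].
  + by split=> //; rewrite /squier_src /= h1.
  + by apply: edge_ext.
  by congr walk; rewrite /slide_path /sump /=; congr [:: _];
    apply: edge_ext; rewrite //= ?h2 ?cats0 -?catA.
- by split; exists m.
Qed.

Definition left_of k h := exists Q e f,
  [/\ src e = ev Q, disj e f, k = hyp Q e & h = hyp Q f].

(** The four corners of a square realize the four choices of orientation for its two sides. *)
Lemma left_of_sgn k h e0 f0 : left_of k h -> exists Q e f,
  [/\ src e = ev Q, disj e f, k = hyp Q e, h = hyp Q f & sgn e = sgn e0 /\ sgn f = sgn f0].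
Proof.
move=> [Q [e [f [he d -> ->]]]].
have [Q1 [e1 [f1 [h1 d1 k1 l1 s1]]]] : exists Q' e' f',
   [/\ src e' = ev Q', disj e' f', hyp Q e = hyp Q' e', hyp Q f = hyp Q' f' & sgn e' = sgn e0].
  case: (eqVneq (sgn e) (sgn e0)) => s; first by exists Q, e, f.
  have [e' [f' [_ _ hf _ [d' _]]]] := disj_square he d.
  exists (walk Q [:: e]), (redge e), f'; split=> //; rewrite ?ev_walk1 ?hyp_rev //.
    by apply: hyp_par => //; rewrite -he; apply/esym/disj_src.
  rewrite sgn_rev; move/eqP: s.
  by case: (sgn_cases e) => ->; case: (sgn_cases e0) => ->.
case: (eqVneq (sgn f1) (sgn f0)) => s.
  by exists Q1, e1, f1; split.
have hf1 : src f1 = ev Q1 by rewrite -h1; apply/esym/disj_src.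
have [e' [f' [_ _ _ hp [_ d']]]] := disj_square h1 d1.
exists (walk Q1 [:: f1]), e', (redge f1); split=> //.
- by rewrite (disj_src d') ev_walk1.
- by rewrite k1; apply: hyp_par.
- by rewrite hyp_rev.
split; first by rewrite (sgn_par hp).
rewrite sgn_rev; move/eqP: s.
by case: (sgn_cases f1) => ->; case: (sgn_cases f0) => ->.
Qed.

(* If [f] touched a letter left of the end of [e], this letter would be copied to
   a place where the sliding of [e] makes it independent of that input. *)
Lemma left_of_disj Q e f : src e = ev Q -> src f = ev Q ->
  left_of (hyp Q e) (hyp Q f) -> disj e f.
Proof.
move=> he hf /(left_of_sgn e f) [R [e0 [f0 [he0 [m [hm hm']] ke kf [se sf]]]]].
have hf0 : src f0 = ev R by rewrite -he0; apply/esym/disj_src; exists m.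
have [p [q [hp hq ee eR]]] := hyp_sgn_par he he0 ke (esym se).
have [p' [q' [hp' hq' ef eR']]] := hyp_sgn_par hf hf0 kf (esym sf).
have v := valid_slide hp hq; have v' := valid_slide hp' hq'.
rewrite he in v; rewrite hf in v'.
have H : hom (ev Q) (slide_path e p q) (slide_path f p' q').
  by apply: walk_inj => //; rewrite -eR.
have lt_size : size (se_left e) + size (se_from e) <= size (se_left f).
  rewrite leqNgt; apply/negP => hlt.
  have i_lt : size (se_left f) < size (ev Q).
    by rewrite -hf /squier_src !size_cat; have := size_from_gt0 f; lia.
  have c := copies_sump hp' hq' (size_from_gt0 f).
  rewrite !addn0 -/(squier_src f) hf in c.
  have g := @ignores_sump_right _ _ (se_from e) _ _ _ (size (se_left f))
              (size (endw (se_left f) p')) hp hq.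
  rewrite -/(squier_src e) he in g.
  apply: (copies_ignores i_lt c); apply: (ignores_hom H) => //; apply: g => //.
  by move: hm'; rewrite ef ee /= => ->; rewrite !size_cat; lia.
have := he; rewrite -hf /squier_src catA => /cat_eq_prefix.
rewrite size_cat => /(_ lt_size) [m' [h1 h2]].
by exists m'; rewrite h1 -catA.
Qed.

Lemma left_of_irr h : ~ left_of h h.
Proof.
move=> H; have [Q [e [f [he _ eh _]]]] := H; rewrite eh in H.
have [m [_ /(congr1 size)]] := left_of_disj he he H.
by rewrite !size_cat; have := size_from_gt0 e; lia.
Qed.

(** Each edge of [p] spans a square with the translate of [e] reached so far, and lies on its
    left. *)
Lemma hyps_slide_left Q e p k : src e = ev Q -> valid (se_left e) p ->
  k \in hyps Q (slide_path e p [::]) -> left_of k (hyp Q e).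
Proof.
elim: p Q e => [//|g p IH] Q e he /= [hg hp]; rewrite inE => /orP [/eqP ->|].
  exists Q, (lift [::] (se_from e ++ se_right e) g), e; split=> //.
    by rewrite src_lift /= hg.
  by exists (se_right g); rewrite /= -hg /squier_src -?catA.
have hpar : par Q e (walk Q [:: lift [::] (se_from e ++ se_right e) g]) (slide e [:: g] [::]).
  by exists [:: g], [::]; split=> //.
rewrite (hyp_par he hpar) => H; apply: IH => //; exact: (par_src he hpar).
Qed.

Lemma hyps_slide_right Q e q k : src e = ev Q -> valid (se_right e) q ->
  k \in hyps Q (slide_path e [::] q) -> left_of (hyp Q e) k.
Proof.
elim: q Q e => [//|g q IH] Q e he /= [hg hq]; rewrite inE => /orP [/eqP ->|].
  exists Q, e, (lift (se_left e ++ se_from e) [::] g); split=> //.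
  by exists (se_left g); rewrite /= -hg /squier_src ?cats0 -?catA.
have hp : par Q e (walk Q [:: lift (se_left e ++ se_from e) [::] g]) (slide e [::] [:: g]).
  by exists [::], [:: g]; split.
rewrite (hyp_par he hp) => H; apply: IH => //; exact: (par_src he hp).
Qed.

Lemma slide_path_cat e p q :
  slide_path e p q = slide_path e p [::] ++ slide_path (slide e p [::]) [::] q.
Proof. by rewrite /slide_path /sump /= cats0. Qed.

Lemma par_slide Q e p q : valid (se_left e) p -> valid (se_right e) q ->
  par Q e (walk Q (slide_path e p q)) (slide e p q).
Proof. by exists p, q. Qed.

Lemma hyps_slide Q e p q k : src e = ev Q -> valid (se_left e) p -> valid (se_right e) q ->
  k \in hyps Q (slide_path e p q) -> left_of k (hyp Q e) \/ left_of (hyp Q e) k.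
Proof.
move=> he hp hq; rewrite slide_path_cat hyps_cat; last first.
  by rewrite -slide_path_cat -he; apply: valid_slide.
have pe := @par_slide Q e p [::] hp I.
rewrite mem_cat => /orP [/hyps_slide_left|]; first by left; auto.
move/hyps_slide_right; rewrite -(hyp_par he pe) => H; right; apply: H => //.
exact: par_src pe.
Qed.

(** The strip closes up, so its long side is homotopic to the empty path and copies every letter to
    its own place. It also copies the first letter of [e] to the position where [f] begins, so both
    edges start at the same letter. *)
Lemma par_self Q e f : src e = ev Q -> par Q e Q f -> f = e.
Proof.
move=> he hp; have hf := par_src he hp.
case: hp => p [q [hp hq ef /esym eQ]].
have v := valid_slide hp hq; rewrite he in v.
have H : hom (ev Q) (slide_path e p q) [::] by apply: walk_inj; rewrite ?walk0.
have lt_i : size (se_left e) < size (ev Q).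
  by rewrite -he /squier_src !size_cat; have := size_from_gt0 e; lia.
have c := copies_sump hp hq (size_from_gt0 e).
rewrite !addn0 -/(squier_src e) he in c.
have c' := copies_hom H v c.
have es : size (se_left e) = size (se_left f).
  by apply: (copies_inj lt_i c'); move=> t _; rewrite ef.
have := he; rewrite -hf /squier_src => /cat_eq_prefix; rewrite es => /(_ (leqnn _)) [m [h1 h2]].
have m0 : m = [::] by move/(congr1 size): h1; rewrite size_cat es; case: (m) => //= *; lia.
move: h2; rewrite m0 ef /= => h2; apply: edge_ext => //=.
  by move: h1; rewrite m0 cats0 ef /= => ->.
exact/esym/(cat_eq_right h2).
Qed.

Lemma disj_swap Q e f : src e = ev Q -> src f = ev Q -> disj e f \/ disj f e ->
  exists e' f', [/\ hom (ev Q) [:: e; f'] [:: f; e'],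
     valid (ev Q) [:: e; f'] /\ valid (ev Q) [:: f; e'],
      par Q f (walk Q [:: e]) f' & par Q e (walk Q [:: f]) e'].
Proof.
move=> he hf [d|d].
  by have [e' [f' [h1 h2 h3 h4 _]]] := disj_square he d; exists e', f'.
have [e' [f' [h1 [h2 h2'] h3 h4 _]]] := disj_square hf d; exists f', e'; split=> //.
exact: hom_sym.
Qed.

Lemma square_par Q e1 e2 f1 f2 : squier_square e1 e2 f1 f2 -> src e1 = ev Q ->
  [/\ src f1 = ev Q, par Q f1 (walk Q [:: e1]) e2 & par Q e1 (walk Q [:: f1]) f2].
Proof.
case=> a u1 v1 b u2 v2 c h1 h2 he; split.
- by rewrite -he /squier_src /= -!catA.
- exists [:: SquierEdge a b h1], [::]; split; [by split|by []|by apply: edge_ext|].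
  by congr walk; rewrite /slide_path /sump /=; congr [:: _]; apply: edge_ext.
- exists [::], [:: SquierEdge b c h2]; split; [by []|by split|by apply: edge_ext|].
  by congr walk; rewrite /slide_path /sump /=; congr [:: _]; apply: edge_ext;
    rewrite //= ?cats0 -?catA.
Qed.

(** A backtrack contributes two opposite signs, and a square move only permutes two terms, opposite
    sides of a square being parallel and of equal sign. *)
Lemma cnt_hom h Q p q : valid (ev Q) p -> hom (ev Q) p q -> cnt h Q p = cnt h Q q.
Proof.
move=> hv H; elim: H hv => {p q} [p q [hp hq m]|p|p q H IH|p q r H IH H' IH'] hv //.
- case: m hp hq => [l e r|l e1 e2 f1 f2 r s] hp hq.
    have [hl /= [he _]] := proj1 (valid_cat _ _ _) hp.
    rewrite -ev_walk // in he.
    by rewrite !cnt_cat //= hyp_rev // walk_backtrack // sgn_rev; case: ifP => _; lia.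
  have [hl /= [he1 [he2 hr]]] := proj1 (valid_cat _ _ _) hp.
  have [_ /= [hf1 [hf2 hr']]] := proj1 (valid_cat _ _ _) hq.
  rewrite -ev_walk // in he1; rewrite -ev_walk // in hf1.
  have [_ p1 p2] := square_par s he1.
  rewrite !cnt_cat //= (hyp_par hf1 p1) (hyp_par he1 p2) (sgn_par p1) (sgn_par p2).
  have -> : walk (walk (walk Q l) [:: e1]) [:: e2] = walk (walk (walk Q l) [:: f1]) [:: f2].
    rewrite -(walk_cons he1) // -(walk_cons hf1) //; apply: walk_hom; first by rewrite /= -he1.
    rewrite -he1; apply: rst_step; split=> //=.
      by rewrite he1 -hf1.
    exact: (@path_square (squier_complex P) [::] _ _ _ _ [::] s).
  by congr (_ + _)%R; rewrite GRing.addrCA.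
- by rewrite IH //; apply/(hom_validE H).
- by rewrite IH // IH' //; apply: hom_valid H hv.
Qed.

(** A path carrying [g] to a parallel edge is homotopic to a slide of [g], which meets only
    hyperplanes crossing that of [g]; the count being a homotopy invariant, the hyperplane of [f] is
    one of them. *)
Lemma push Q f g p g' : src f = ev Q -> src g = ev Q -> valid (ev Q) p ->
  par Q g (walk Q p) g' -> cnt (hyp Q f) Q p <> 0%R -> disj f g \/ disj g f.
Proof.
move=> hf hg hp [al [be [ha hb eg' eR]]] hc.
have H : hom (ev Q) p (slide_path g al be).
  by apply: walk_inj => //; rewrite -hg; apply: valid_slide.
have : hyp Q f \in hyps Q (slide_path g al be).
  by apply/negPn/negP => /cnt_notin; rewrite -(cnt_hom _ hp H).
by case/(hyps_slide hg ha hb) => /left_of_disj; [left|right]; auto.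
Qed.

End Hyperplanes.

(** * Geodesics and separation by hyperplanes *)

Section Geodesics.
Variables (P : semigroup_presentation) (w0 : seq (alphabet P)).
Local Notation word := (seq (alphabet P)).
Local Notation edge := (squier_edge P).
Local Notation src := (@squier_src P).
Local Notation tgt := (@squier_tgt P).
Local Notation redge := (@squier_rev P).
Local Notation rpath := (@rev_path (squier_complex P)).
Local Notation G := (@diagram_group P w0).
Local Notation cover := (@cover P w0).
Local Notation hyperplane := (@hyperplane P w0).
Implicit Types (a b c u v w x y z m : word) (e f g : edge) (p q r l : seq edge).
Implicit Types (Q R S Z : cover) (h k : hyperplane).

Lemma cnt_uniq Q p1 e p2 : valid (ev Q) (p1 ++ e :: p2) ->
  uniq (hyps Q (p1 ++ e :: p2)) ->
  cnt (hyp (walk Q p1) e) Q (p1 ++ e :: p2) = sgn e.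
Proof.
move=> hv; rewrite hyps_cat // cat_uniq /= => /and3P [_ H /andP [n2 _]].
have n1 : hyp (walk Q p1) e \notin hyps Q p1.
  by apply: contra H => H; apply/orP; left.
by rewrite cnt_cat //= eqxx (cnt_notin n1) (cnt_notin n2); lia.
Qed.

(** An innermost bigon is emptied one edge at a time. If [q] meets no hyperplane twice and misses
    that of [e], then [f] must traverse this hyperplane backwards, [q] carries the inverse of [e] to
    [f], and the first edge of [q] spans a square with that inverse. Exchanging the two leaves a
    shorter bigon, and an empty one is a backtrack. *)
Lemma shorten_bigon n q Q e f : size q < n -> valid (ev Q) (e :: q ++ [:: f]) ->
  hyp Q e = hyp (walk Q (e :: q)) f ->
  exists p, hom (ev Q) (e :: q ++ [:: f]) p /\ size p < size q + 2.
Proof.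
elim: n q Q e f => // n IH q Q e f hn hv hef.
have [he /valid_cat [hq /= [hf _]]] := hv.
have vq : valid (ev Q) (e :: q) by [].
have hf' : src f = ev (walk Q (e :: q)) by rewrite ev_walk.
have vq1 : valid (ev (walk Q [:: e])) q by rewrite ev_walk1.
case: (boolP (hyp Q e \in hyps (walk Q [:: e]) q)) => [/(in_hyps vq1)|hnin].
  move=> [q1 [g [q2 [eq hg]]]]; subst q; rewrite -/(_ ++ _) in hv *.
  have [hq1 /= [hsg hq2]] := proj1 (valid_cat _ _ _) hq.
  have [|||p [hp sp]] := IH q1 Q e g.
  - by move: hn; rewrite size_cat /=; lia.
  - by split=> //; apply/valid_cat; split.
  - by rewrite hg (walk_cons he hq1).
  exists (p ++ q2 ++ [:: f]); split.
    rewrite (_ : e :: _ = (e :: q1 ++ [:: g]) ++ q2 ++ [:: f]); last by rewrite /= -!catA.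
    apply: hom_catr => //; rewrite /= endw_cat /=; apply/valid_cat; split=> //=.
    by move: hf; rewrite endw_cat.
  by rewrite !size_cat /=; lia.
case: (boolP (uniq (hyps (walk Q [:: e]) q))) => [hu|/(not_uniq_hyps vq1)]; last first.
  move=> [q1 [g [q2 [g' [q3 [eq hg]]]]]]; subst q.
  have [hq1 /= [hsg /valid_cat [hq2 /= [hsg' hq3]]]] := proj1 (valid_cat _ _ _) hq.
  have vq1' : valid (ev (walk Q [:: e])) q1 by rewrite ev_walk1.
  have eQ1 : ev (walk Q (e :: q1)) = endw (tgt e) q1 by rewrite ev_walk.
  have [|||p [hp sp]] := IH q2 (walk Q (e :: q1)) g g'.
  - by move: hn; rewrite !size_cat /= size_cat /=; lia.
  - by rewrite eQ1; split=> //; apply/valid_cat; split.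
  - by rewrite (walk_cons he hq1) hg (walk_cat vq1') //= hsg ev_walk1.
  exists (e :: q1 ++ p ++ q3 ++ [:: f]); split.
    rewrite (_ : e :: _ = (e :: q1) ++ (g :: q2 ++ [:: g']) ++ q3 ++ [:: f]); last first.
      by rewrite /= -!catA /= -!catA.
    apply: (@hom_catl _ _ (e :: q1) _ (p ++ q3 ++ [:: f])) => //.
    rewrite [endw _ _]/= -eQ1; apply: (@hom_catr _ _ (q3 ++ [:: f]) _ p) => //.
    rewrite /= endw_cat /=; apply/valid_cat; split=> //=.
    by move: hf; rewrite !endw_cat /= endw_cat.
  by rewrite /= !size_cat /= !size_cat /=; move: sp; lia.
have cq : cnt (hyp Q e) Q (e :: q) = sgn e by rewrite /= eqxx (cnt_notin hnin); lia.
(* With equal signs [e] would slide to [f], and a slide never crosses the hyperplane of [e], while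
   [e :: q] crosses it exactly once. *)
case: (eqVneq (sgn e) (sgn f)) => [s|/eqP s].
  have [al [be [ha hb _ eR]]] := hyp_sgn_par he hf' hef s.
  have H : hom (ev Q) (e :: q) (slide_path e al be).
    by apply: walk_inj => //; rewrite -he; apply: valid_slide.
  case: (@sgn_neq0 _ e); rewrite -cq (cnt_hom _ vq H); apply: cnt_notin; apply/negP.
  by move/(hyps_slide he ha hb) => [] /left_of_irr.
have s' : sgn (redge e) = sgn f.
  by rewrite sgn_rev; move: s; case: (sgn_cases e) => ->; case: (sgn_cases f) => ->.
have er : src (redge e) = ev (walk Q [:: e]) by rewrite ev_walk1.
have hef' := hef; rewrite -(hyp_rev he) in hef'.
have pr := hyp_sgn_par er hf' hef' s'.
case: q => [|g q] in hn hv hef hq hf vq hf' vq1 hnin hu cq hef' pr *.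
  exists [::]; split=> //; rewrite (par_self er pr) /= -he.
  by apply: (@hom_backtrack _ _ [::] e [::]).
have sg : src g = ev (walk Q [:: e]) by case: vq1.
have [|e' [g' [H [v1 v2] p1 p2]]] := @disj_swap _ _ (walk Q [:: e]) (redge e) g er sg.
  have : disj g (redge e) \/ disj (redge e) g.
    rewrite (walk_cons he hq) in pr.
    apply: (push sg er vq1 pr); move: hu; rewrite /= => /andP [nn _].
    by rewrite eqxx (cnt_notin nn); have := @sgn_neq0 _ g; lia.
  by case; [right|left].
have wQ : walk (walk Q [:: e]) [:: redge e] = Q by rewrite walk_backtrack.
have sg' : src g' = ev Q.
  by case: v1 => _ [-> _]; rewrite /squier_tgt /=.
have se' : src e' = tgt g by case: v2 => _ [].
have te' : tgt e' = tgt g' by have := hom_end H.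
have H2 : hom (ev Q) [:: e; g] [:: g'; redge e'].
  have h1 : hom (ev Q) ([:: e] ++ [:: redge e] ++ [:: g'; redge e']) [:: g'; redge e'].
    rewrite -he; apply: (@hom_backtrack _ _ [::] e [:: g'; redge e']) => //=.
    by rewrite he.
  apply: hom_trans h1; rewrite -he.
  have h2 : hom (tgt e) [:: redge e; g'; redge e'] [:: g; e'; redge e'].
    rewrite -(ev_walk1 he).
    apply: (@hom_catr _ _ [:: redge e'] [:: redge e; g'] [:: g; e'] H) => /=.
    by split=> //; rewrite -te'.
  apply: hom_cons; apply: hom_trans (hom_sym h2).
  apply: hom_sym; apply: (@hom_backtrack _ (tgt e) [:: g] e' [::]) => //=.
  by split=> //; rewrite sg ev_walk1.
have ee' : src (redge e') = ev (walk Q [:: g']) by rewrite ev_walk1.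
have wW : walk (walk Q [:: g']) [:: redge e'] = walk Q [:: e; g].
  rewrite -(walk_cons sg') /=; last by split=> //; rewrite -te'.
  by apply/esym/walk_hom => //=; split=> //; split=> //; rewrite sg ev_walk1.
have sgt : src g = tgt e by rewrite sg ev_walk1.
have hre' : hyp (walk Q [:: g']) (redge e') = hyp Q e.
  have se2 : src e' = ev (walk (walk Q [:: e]) [:: g]) by rewrite ev_walk1.
  have -> : walk Q [:: g'] = walk (walk (walk Q [:: e]) [:: g]) [:: e'].
    have wH := walk_hom v1 H.
    have v3 : valid (tgt g) [:: e'] by split.
    have v4 : valid (tgt (redge e)) [:: g'] by case: v1.
    by rewrite -(walk_cons sg v3) -wH (walk_cons er v4) wQ.
  by rewrite hyp_rev // -(hyp_par er p2) hyp_rev.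
have [|||p [hp sp]] := IH q (walk Q [:: g']) (redge e') f.
- by move: hn => /=; lia.
- rewrite ev_walk1 //; split; first by rewrite -te'.
  apply/valid_cat; split; last by split=> //; move: hf => /=; rewrite -[tgt (redge e')]/(src e') se'.
  by rewrite -[tgt (redge e')]/(src e') se'; case: hq.
- rewrite hre' hef (walk_cons ee'); last first.
    by rewrite -[tgt (redge e')]/(src e') se'; case: hq.
  have v5 : valid (ev Q) [:: e; g] by split.
  have v6 : valid (tgt g) q by case: hq.
  by rewrite wW (walk_cat v5 v6).
exists (g' :: p); split; last by move: sp => /=; lia.
apply: hom_trans (_ : hom _ ([:: g'; redge e'] ++ q ++ [:: f]) _).
  apply: (@hom_catr _ _ (q ++ [:: f]) [:: e; g] _ H2) => /=.
  by apply/valid_cat; split=> //=; case: hq.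
by rewrite -sg'; apply: hom_cons; rewrite -(ev_walk1 sg').
Qed.

Lemma geodesic_ex Q p : valid (ev Q) p -> exists p', hom (ev Q) p p' /\ uniq (hyps Q p').
Proof.
elim: {p}(size p).+1 {-2}p (ltnSn (size p)) => // n IH p hn hp.
case: (boolP (uniq (hyps Q p))) => [u|]; first by exists p.
move=> /(not_uniq_hyps hp) [p1 [e [p2 [f [p3 [ep eh]]]]]]; subst p.
have [hp1 /= [he /valid_cat [hp2 /= [hf hp3]]]] := proj1 (valid_cat _ _ _) hp.
rewrite -(ev_walk hp1) in he.
have [|||p [H sp]] := @shorten_bigon (size p2).+1 p2 (walk Q p1) e f => //.
- by split=> //; apply/valid_cat; split.
- by rewrite eh walk_cat //=; split=> //; rewrite -(ev_walk hp1).
have H' : hom (ev Q) (p1 ++ e :: p2 ++ f :: p3) (p1 ++ p ++ p3).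
  apply: hom_catl => //.
  rewrite (_ : e :: _ = (e :: p2 ++ [:: f]) ++ p3); last by rewrite /= -catA.
  by rewrite -(ev_walk hp1); apply: hom_catr => //; rewrite /= endw_cat.
have [||p' [H2 u]] := IH (p1 ++ p ++ p3).
- by move: hn sp; rewrite !size_cat /= !size_cat /=; lia.
- exact: (hom_valid H').
by exists p'; split=> //; apply: hom_trans H2.
Qed.

(** The signed number of crossings of [h] between two vertices, measured through the base vertex so
    that additivity is immediate; along any path it is the count [cnt]. *)
Definition delta h Q R : int := (cnt h (base w0) (vrep R) - cnt h (base w0) (vrep Q))%R.

Lemma delta_walk h Q p : valid (ev Q) p -> delta h Q (walk Q p) = cnt h Q p.
Proof.
move=> hp; rewrite /delta.
have v : valid (ev (base w0)) (vrep Q ++ p).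
  by rewrite ev_base; apply/valid_cat; split; [exact: vrepP|].
have H : hom (ev (base w0)) (vrep (walk Q p)) (vrep Q ++ p).
  by rewrite ev_base; apply: vrep_walk.
by rewrite -(cnt_hom _ v (hom_sym H)) cnt_cat // base_walk; lia.
Qed.

Lemma delta_add h Q R S : delta h Q S = (delta h Q R + delta h R S)%R.
Proof. by rewrite /delta; lia. Qed.

Lemma delta_sym h Q R : delta h Q R = (- delta h R Q)%R.
Proof. by rewrite /delta; lia. Qed.

Lemma delta_refl h Q : delta h Q Q = 0%R.
Proof. by rewrite /delta; lia. Qed.

Lemma delta_edge h Q e : src e = ev Q ->
  delta h Q (walk Q [:: e]) = (if h == hyp Q e then sgn e else 0)%R.
Proof. by move=> he; rewrite delta_walk //= GRing.addr0. Qed.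

Lemma geodesic Q R : exists p, [/\ valid (ev Q) p, walk Q p = R & uniq (hyps Q p)].
Proof.
have [p [hp hw]] := walk_ex Q R; have [p' [H u]] := geodesic_ex hp.
exists p'; split=> //; first exact: (hom_valid H).
by rewrite -(walk_hom hp H).
Qed.

Lemma delta_uniq Q p1 e p2 : valid (ev Q) (p1 ++ e :: p2) ->
  uniq (hyps Q (p1 ++ e :: p2)) ->
  delta (hyp (walk Q p1) e) Q (walk Q (p1 ++ e :: p2)) = sgn e.
Proof. by move=> hv u; rewrite delta_walk // cnt_uniq. Qed.

Lemma delta_notin h Q p : valid (ev Q) p -> h \notin hyps Q p -> delta h Q (walk Q p) = 0%R.
Proof. by move=> hv /cnt_notin; rewrite -delta_walk. Qed.

Lemma delta_hyps h Q p : valid (ev Q) p -> uniq (hyps Q p) ->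
  (delta h Q (walk Q p) != 0%R) = (h \in hyps Q p).
Proof.
move=> hv u; case: (boolP (h \in _)) => hin; last by rewrite delta_notin.
have [p1 [e [p2 [ep ->]]]] := in_hyps hv hin.
by move: hv u; rewrite ep => hv u; rewrite delta_uniq //; apply/eqP/sgn_neq0.
Qed.

Lemma delta_cases h Q R : [\/ delta h Q R = 0%R, delta h Q R = 1%R | delta h Q R = (-1)%R].
Proof.
have [p [hp <- u]] := geodesic Q R.
case: (boolP (h \in hyps Q p)) => hin; last by constructor 1; rewrite delta_notin.
have [p1 [e [p2 [ep ->]]]] := in_hyps hp hin.
move: hp u; rewrite ep => hp u; rewrite delta_uniq //.
by case: (sgn_cases e) => ->; [constructor 2|constructor 3].
Qed.

Lemma delta0_eq Q R : (forall h, delta h Q R = 0%R) -> Q = R.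
Proof.
have [p [hp <- u]] := geodesic Q R => H.
case: p hp u H => [|e p] hp u H; first by rewrite walk0.
by case: (@sgn_neq0 _ e); rewrite -(@delta_uniq Q [::] e p) // walk0.
Qed.

(** A geodesic from the end of [f] to [Z] crosses the hyperplane of [g], by an edge parallel to [g],
    and not that of [f]. The path from [Q] through [f] to this edge thus carries [g] along and
    crosses the hyperplane of [f] once, so [push] applies. *)
Lemma quadrant Q f g Z : src f = ev Q -> src g = ev Q -> hyp Q f <> hyp Q g ->
  delta (hyp Q f) Q Z = sgn f -> delta (hyp Q g) Q Z = sgn g -> disj f g \/ disj g f.
Proof.
move=> hf hg ne df dg.
have [q [hq hw u]] := geodesic (walk Q [:: f]) Z.
have d1 : delta (hyp Q f) (walk Q [:: f]) Z = 0%R.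
  by have := delta_add (hyp Q f) Q (walk Q [:: f]) Z; rewrite df delta_edge // eqxx; lia.
have d2 : delta (hyp Q g) (walk Q [:: f]) Z = sgn g.
  have := delta_add (hyp Q g) Q (walk Q [:: f]) Z; rewrite dg delta_edge //.
  by case: eqVneq => [e|_]; [case: ne|lia].
have nin : hyp Q f \notin hyps (walk Q [:: f]) q.
  by rewrite -delta_hyps // hw d1.
have : hyp Q g \in hyps (walk Q [:: f]) q.
  by rewrite -delta_hyps // hw d2; apply/eqP/sgn_neq0.
move/(in_hyps hq) => [q1 [g' [q2 [eq eg]]]]; subst q.
have [hq1 [hg' hq2]] := proj1 (valid_cat _ _ _) hq.
have tq1 : valid (tgt f) q1 by rewrite -(ev_walk1 hf).
have hv : valid (ev Q) (f :: q1) by [].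
have wq : walk Q (f :: q1) = walk (walk Q [:: f]) q1 by rewrite (walk_cons hf).
have hg2 : src g' = ev (walk Q (f :: q1)) by rewrite wq ev_walk.
have pg : par Q g (walk Q (f :: q1)) g'.
  apply: hyp_sgn_par => //; first by rewrite wq.
  by rewrite -d2 eg -hw delta_uniq.
apply: (push hf hg hv pg); rewrite /= eqxx cnt_notin; first by have := @sgn_neq0 _ f; lia.
by apply: contra nin; rewrite hyps_cat // mem_cat => ->.
Qed.

(** The number of hyperplanes separating the two vertices; all geodesics cross the same ones, so the
    choice made here is harmless. *)
Definition dist Q R : nat := size (hyps Q (projT1 (cid (geodesic Q R)))).

Lemma dist_geodesic Q p : valid (ev Q) p -> uniq (hyps Q p) -> dist Q (walk Q p) = size p.
Proof.
move=> hp u; rewrite /dist; case: cid => q /= [hq hw u'].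
rewrite -(size_hyps Q p); apply: perm_size; apply: uniq_perm => // h.
by rewrite -!delta_hyps // hw.
Qed.

Lemma dist_le Q p : valid (ev Q) p -> dist Q (walk Q p) <= size p.
Proof.
move=> hp; rewrite /dist; case: cid => q /= [hq hw u].
rewrite -(size_hyps Q p); apply: uniq_leq_size => // h.
by rewrite -delta_hyps // hw; apply: contraR => /(delta_notin hp) ->.
Qed.

Lemma dist_geo_ex Q R : exists p, [/\ valid (ev Q) p, walk Q p = R, uniq (hyps Q p) & size p = dist Q R].
Proof. by have [p [hp hw u]] := geodesic Q R; exists p; split=> //; rewrite -hw dist_geodesic. Qed.

Lemma delta_sep_ex Q R : exists s : seq hyperplane, forall h, delta h Q R <> 0%R <-> h \in s.
Proof.
have [p [hp <- u]] := geodesic Q R; exists (hyps Q p) => h.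
by rewrite -delta_hyps //; split=> /eqP.
Qed.

End Geodesics.

(** * Cuts of a word and stabilizers of hyperplanes *)

Section Cuts.
Variables (P : semigroup_presentation) (w0 : seq (alphabet P)).
Local Notation word := (seq (alphabet P)).
Local Notation edge := (squier_edge P).
Local Notation src := (@squier_src P).
Local Notation tgt := (@squier_tgt P).
Local Notation redge := (@squier_rev P).
Local Notation rpath := (@rev_path (squier_complex P)).
Local Notation G := (@diagram_group P w0).
Local Notation cover := (@cover P w0).
Local Notation hyperplane := (@hyperplane P w0).
Implicit Types (a b c u v w x y z m s t : word) (e f : edge) (p q r l : seq edge).
Implicit Types (Q R S Z : cover) (h k : hyperplane) (g : G).

Definition act_hyp g h : hyperplane := fun R f => h (act g^-1%g R) f.

Lemma act_hypM g g' h : act_hyp (g * g')%g h = act_hyp g (act_hyp g' h).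
Proof. by apply/funext => R; apply/funext => f; rewrite /act_hyp invgM actM. Qed.

Lemma act_hyp1 h : act_hyp 1%g h = h.
Proof. by apply/funext => R; apply/funext => f; rewrite /act_hyp invg1 act1. Qed.

Lemma act_hypK g : cancel (act_hyp g) (act_hyp g^-1%g).
Proof. by move=> h; rewrite -act_hypM mulVg act_hyp1. Qed.

Lemma act_hypKV g : cancel (act_hyp g^-1%g) (act_hyp g).
Proof. by move=> h; rewrite -act_hypM mulgV act_hyp1. Qed.

Lemma par_act g Q e R f : src e = ev Q -> par Q e R f -> par (act g Q) e (act g R) f.
Proof.
move=> he [p [q [hp hq -> ->]]]; exists p, q; split=> //.
by rewrite act_walk // -he; apply: valid_slide.
Qed.

Lemma act_hyp_hyp g Q e : src e = ev Q -> act_hyp g (hyp Q e) = hyp (act g Q) e.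
Proof.
move=> he; apply/funext => R; apply/funext => f; apply/propext; rewrite /act_hyp /hyp /=.
have er : src (redge e) = ev (walk Q [:: e]) by rewrite ev_walk1.
have w1 : walk (act g Q) [:: e] = act g (walk Q [:: e]) by rewrite act_walk //=.
rewrite ev_act w1; split=> -[hf [h|h]]; split=> //.
- by left; rewrite -[R](actKV g); apply: par_act.
- by right; rewrite -[R](actKV g); apply: par_act.
- by left; rewrite -[Q](actK g); apply: par_act; rewrite ?ev_act.
- by right; rewrite -[walk Q _](actK g); apply: par_act; rewrite ?ev_act.
Qed.

Lemma cnt_act g h Q p : valid (ev Q) p -> cnt (act_hyp g h) (act g Q) p = cnt h Q p.
Proof.
elim: p Q => //= e p IH Q [he hp].
rewrite -act_hyp_hyp // (inj_eq (can_inj (act_hypK g))).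
by rewrite -act_walk //= IH // ev_walk1.
Qed.

Lemma delta_act g h Q R : delta (act_hyp g h) (act g Q) (act g R) = delta h Q R.
Proof.
have [p [hp <-]] := walk_ex Q R.
by rewrite act_walk // !delta_walk ?ev_act // cnt_act.
Qed.

(** At [Q] a dual edge of [k] has [h] on its left; at [R] a parallel one has [h2] on its right.
    Sliding from [Q] along the right half of the strip only reaches a vertex whose word has the left
    part of the first and the right part of the second, and there [h] and [h2] are both visible. *)
Lemma left_of_trans k h h2 : left_of h k -> left_of k h2 -> left_of h h2.
Proof.
move=> [Q [e [f [he [m [em fm]] -> ek]]]] H.
have hf : src f = ev Q by rewrite -he; apply/esym/disj_src; exists m.
have [R [e' [f' [he' [m' [em' fm']] ek' -> [se _]]]]] := left_of_sgn f f H.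
have [|p [q [hp hq ee eR]]] := @hyp_sgn_par _ _ Q f R e' hf he' _ (esym se).
  by rewrite -ek.
pose Q1 := walk Q (slide_path f [::] q).
have v1 : valid (ev Q) (slide_path f [::] q) by rewrite -hf; apply: valid_slide.
have eQ1 : ev Q1 = src (slide f [::] q) by rewrite ev_walk // -hf endw_slide.
pose e1 := SquierEdge (se_left e) (m ++ se_from f ++ endw (se_right f) q) (se_applicable e).
pose f1 := SquierEdge (se_left f ++ se_from f ++ m') (se_right f') (se_applicable f').
have p1 : par Q e Q1 e1.
  exists [::], (map (lift (m ++ se_from f) [::]) q); split=> //.
  - have := @valid_lift _ (m ++ se_from f) [::] _ _ hq.
    by rewrite cats0 -catA em.
  - apply: edge_ext => //=; rewrite em.
    by have := @endw_lift _ (m ++ se_from f) [::] (se_right f) q; rewrite !cats0 -!catA.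
  congr walk; rewrite /slide_path /sump /= maplift_lift fm.
  by congr map; rewrite -!catA.
have hf1 : src f1 = ev Q1.
  rewrite eQ1 /squier_src /= -!catA; congr (_ ++ (_ ++ _)).
  by move: em'; rewrite ee /= => ->.
have p2 : par Q1 f1 R f'.
  exists (map (lift [::] (se_from f ++ m')) p), [::]; split=> //=.
  - exact: (@valid_lift _ [::]).
  - apply: edge_ext => //=; rewrite (@endw_lift _ [::]) /= fm' ee /=.
    by [].
  have es : slide_path f1 (map (lift [::] (se_from f ++ m')) p) [::] =
     slide_path (slide f [::] q) p [::].
    rewrite /slide_path /sump /= !cats0 maplift_lift /=; congr map.
    by move: em'; rewrite ee /= => ->; rewrite -!catA.
  rewrite es eR walk_cat //; last first.
    by rewrite -hf endw_slide; apply: valid_slide.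
  apply: walk_hom; first by rewrite -hf; apply: valid_slide.
  apply: hom_trans (_ : hom _ (sump (se_left f) (se_from f) (se_right f) ([::] ++ p) (q ++ [::])) _).
    by rewrite cats0.
  apply/hom_sym; rewrite -hf; apply: sump_sump => //.
  by rewrite cats0.
have eh := hyp_par he p1; have el := hyp_par hf1 p2.
exists Q1, e1, f1; split=> //; first by apply: par_src p1.
exists (m ++ se_from f ++ m'); split=> /=.
  by rewrite -!catA; move: em'; rewrite ee /= => ->.
by rewrite fm -!catA.
Qed.

(* [lfix Q a c g] (resp. [rfix]): at the vertex [Q] with word [a ++ c], [g]
   is a loop of the left (resp. right) part. *)
Definition lfix Q a c g := ev Q = a ++ c /\ exists p,
  [/\ valid a p, endw a p = a & act g Q = walk Q (map (lift [::] c) p)].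
Definition rfix Q a c g := ev Q = a ++ c /\ exists q,
  [/\ valid c q, endw c q = c & act g Q = walk Q (map (lift a [::]) q)].

Lemma sump_l a c p : sump a [::] c p [::] = map (lift [::] c) p.
Proof. by rewrite /sump /= cats0. Qed.
Lemma sump_r a c q : sump a [::] c [::] q = map (lift a [::]) q.
Proof. by rewrite /sump /= cats0. Qed.

Lemma sump_mid a m b p q : sump a m b p q = sump a [::] (m ++ b) p (map (lift m [::]) q).
Proof. by rewrite /sump maplift_lift cats0. Qed.
Lemma sump_mid' a m b p q : sump a m b p q = sump (a ++ m) [::] b (map (lift [::] m) p) q.
Proof. by rewrite /sump maplift_lift /= (@endw_lift _ [::]) /= cats0. Qed.

Lemma valid_cut Q a c p q : ev Q = a ++ c -> valid a p -> valid c q ->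
  valid (ev Q) (sump a [::] c p q).
Proof. by move=> -> hp hq; apply: (@valid_sump _ a [::] c). Qed.

Lemma ev_cut Q a c p q : ev Q = a ++ c -> valid a p -> valid c q ->
  ev (walk Q (sump a [::] c p q)) = endw a p ++ endw c q.
Proof.
move=> h hp hq; rewrite ev_walk; last exact: valid_cut.
by rewrite h (@endw_sump _ a [::] c).
Qed.

Lemma walk_cut Q a c p q p' q' : ev Q = a ++ c -> valid a (p ++ p') -> valid c (q ++ q') ->
  walk (walk Q (sump a [::] c p q)) (sump (endw a p) [::] (endw c q) p' q') =
  walk Q (sump a [::] c (p ++ p') (q ++ q')).
Proof.
move=> h hp hq; have [hp1 hp2] := proj1 (valid_cat _ _ _) hp.
have [hq1 hq2] := proj1 (valid_cat _ _ _) hq.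
rewrite walk_cat; first last.
- by rewrite h (@endw_sump _ a [::] c); apply: (@valid_sump _ _ [::]).
- exact: valid_cut.
apply: walk_hom; last by rewrite h; apply: (@sump_sump _ a [::] c).
apply/valid_cat; split; first exact: valid_cut.
by rewrite h (@endw_sump _ a [::] c); apply: (@valid_sump _ _ [::]).
Qed.

Lemma walk_cut_hom Q a c p q p' q' : ev Q = a ++ c -> valid a p -> valid c q ->
  hom a p p' -> hom c q q' ->
  walk Q (sump a [::] c p q) = walk Q (sump a [::] c p' q').
Proof.
move=> h hp hq H H'; apply: walk_hom; first exact: valid_cut.
by rewrite h; apply: (@hom_sump _ a [::] c).
Qed.

Lemma lfix1 Q a c : ev Q = a ++ c -> lfix Q a c 1%g.
Proof. by move=> h; split=> //; exists [::]; split; rewrite /= ?act1 ?walk0. Qed.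
Lemma rfix1 Q a c : ev Q = a ++ c -> rfix Q a c 1%g.
Proof. by move=> h; split=> //; exists [::]; split; rewrite /= ?act1 ?walk0. Qed.

Lemma lfixM Q a c g g' : lfix Q a c g -> lfix Q a c g' -> lfix Q a c (g * g')%g.
Proof.
move=> [h [p [hp ep eg]]] [_ [p' [hp' ep' eg']]]; split=> //; exists (p ++ p').
have v : valid a (p ++ p') by apply/valid_cat; rewrite ep.
split=> //; first by rewrite endw_cat ep.
rewrite actM eg' -!(sump_l a) act_walk; last by apply: valid_cut.
by rewrite eg -(sump_l a) -[a in sump a _ _ p']ep (@walk_cut _ a c p [::] p' [::]).
Qed.

Lemma rfixM Q a c g g' : rfix Q a c g -> rfix Q a c g' -> rfix Q a c (g * g')%g.
Proof.
move=> [h [p [hp ep eg]]] [_ [p' [hp' ep' eg']]]; split=> //; exists (p ++ p').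
have v : valid c (p ++ p') by apply/valid_cat; rewrite ep.
split=> //; first by rewrite endw_cat ep.
rewrite actM eg' -!(sump_r a c) act_walk; last by apply: valid_cut.
by rewrite eg -(sump_r a c) -[c in sump _ _ c _ p']ep (@walk_cut _ a c [::] p [::] p').
Qed.

Lemma lfixV Q a c g : lfix Q a c g -> lfix Q a c g^-1%g.
Proof.
move=> [h [p [hp ep eg]]]; split=> //; exists (rpath p); split.
- by rewrite -{1}ep; apply: valid_rpath.
- by rewrite -{1}ep endw_rpath.
have v : valid (ev Q) (map (lift [::] c) p) by rewrite -(sump_l a); apply: valid_cut.
have eQ : ev (walk Q (map (lift [::] c) p)) = ev Q by rewrite -eg ev_act.
have vr := valid_rpath v; rewrite -ev_walk // eQ rpath_lift in vr.
by rewrite -{1}(walk_rpath v) -eg rpath_lift -act_walk // actK.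
Qed.

Lemma rfixV Q a c g : rfix Q a c g -> rfix Q a c g^-1%g.
Proof.
move=> [h [p [hp ep eg]]]; split=> //; exists (rpath p); split.
- by rewrite -{1}ep; apply: valid_rpath.
- by rewrite -{1}ep endw_rpath.
have v : valid (ev Q) (map (lift a [::]) p) by rewrite -(sump_r a c); apply: valid_cut.
have eQ : ev (walk Q (map (lift a [::]) p)) = ev Q by rewrite -eg ev_act.
have vr := valid_rpath v; rewrite -ev_walk // eQ rpath_lift in vr.
by rewrite -{1}(walk_rpath v) -eg rpath_lift -act_walk // actK.
Qed.

Lemma lfixJ Q a c g (k : G) : lfix Q a c g -> lfix (act k Q) a c (k * g * k^-1)%g.
Proof.
move=> [h [p [hp ep eg]]]; split; first by rewrite ev_act.
exists p; split=> //; rewrite !actM actK eg act_walk //.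
by rewrite -(sump_l a); apply: valid_cut.
Qed.

Lemma rfixJ Q a c g (k : G) : rfix Q a c g -> rfix (act k Q) a c (k * g * k^-1)%g.
Proof.
move=> [h [p [hp ep eg]]]; split; first by rewrite ev_act.
exists p; split=> //; rewrite !actM actK eg act_walk //.
by rewrite -(sump_r a c); apply: valid_cut.
Qed.

Lemma lfix_rfix_mul Q a c g g' p q : ev Q = a ++ c -> valid a p -> valid c q -> endw a p = a ->
  act g Q = walk Q (map (lift [::] c) p) -> act g' Q = walk Q (map (lift a [::]) q) ->
  act (g * g')%g Q = walk Q (sump a [::] c p q).
Proof.
move=> h hp hq ep eg eg'; rewrite actM eg' -(sump_r a c) act_walk; last exact: valid_cut.
rewrite eg -(sump_l a) -[a in sump a _ _ [::] q]ep (@walk_cut _ a c p [::] [::] q) // cats0 //.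
Qed.

Lemma lfix_rfix_comm Q a c g g' : lfix Q a c g -> rfix Q a c g' -> (g * g' = g' * g)%g.
Proof.
move=> [h [p [hp ep eg]]] [_ [q [hq eq eg']]]; apply: (@act_inj _ _ _ _ Q).
rewrite (lfix_rfix_mul h hp hq ep eg eg') actM eg -(sump_l a) act_walk; last exact: valid_cut.
by rewrite eg' -(sump_r a c); have := @walk_cut Q a c [::] q p [::] h hp; rewrite cats0 /= eq => ->.
Qed.

Lemma lfix_move Q a c g p q : lfix Q a c g -> valid a p -> valid c q ->
  lfix (walk Q (sump a [::] c p q)) (endw a p) (endw c q) g.
Proof.
move=> [h [p0 [hp0 ep0 eg]]] hp hq; split; first exact: ev_cut.
have hr := valid_rpath hp; have er := endw_rpath hp.
have v1 : valid (endw a p) (rpath p ++ p0 ++ p).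
  by apply/valid_cat; split=> //; rewrite er; apply/valid_cat; rewrite ep0.
exists (rpath p ++ p0 ++ p); split=> //.
  by rewrite !endw_cat er ep0.
have v2 : valid a (p ++ rpath p ++ p0 ++ p) by apply/valid_cat.
have v3 : valid a (p0 ++ p) by apply/valid_cat; rewrite ep0.
rewrite act_walk; last exact: valid_cut.
rewrite eg -(sump_l a) -{2}ep0 (@walk_cut _ a c p0 [::] p q) //.
rewrite -(sump_l (endw a p)) walk_cut ?cats0 //.
apply: walk_cut_hom => //; rewrite [X in hom _ _ X]catA.
apply: hom_trans (_ : hom _ ([::] ++ (p0 ++ p)) _) => //.
by apply/hom_sym/hom_catr; [exact: hom_rpathr|rewrite endw_cat er].
Qed.

Lemma rfix_move Q a c g p q : rfix Q a c g -> valid a p -> valid c q ->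
  rfix (walk Q (sump a [::] c p q)) (endw a p) (endw c q) g.
Proof.
move=> [h [p0 [hp0 ep0 eg]]] hp hq; split; first exact: ev_cut.
have hr := valid_rpath hq; have er := endw_rpath hq.
have v1 : valid (endw c q) (rpath q ++ p0 ++ q).
  by apply/valid_cat; split=> //; rewrite er; apply/valid_cat; rewrite ep0.
exists (rpath q ++ p0 ++ q); split=> //.
  by rewrite !endw_cat er ep0.
have v2 : valid c (q ++ rpath q ++ p0 ++ q) by apply/valid_cat.
have v3 : valid c (p0 ++ q) by apply/valid_cat; rewrite ep0.
rewrite act_walk; last exact: valid_cut.
rewrite eg -(sump_r a c) -{2}ep0 (@walk_cut _ a c [::] p0 p q) //.
rewrite -(sump_r (endw a p) (endw c q)) walk_cut ?cats0 //.
apply: walk_cut_hom => //; rewrite [X in hom _ _ X]catA.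
apply: hom_trans (_ : hom _ ([::] ++ (p0 ++ q)) _) => //.
by apply/hom_sym/hom_catr; [exact: hom_rpathr|rewrite endw_cat er].
Qed.

Lemma lfix_widen Q a s c g : lfix Q a (s ++ c) g -> lfix Q (a ++ s) c g.
Proof.
move=> [h [p [hp ep eg]]]; split; first by rewrite h catA.
exists (map (lift [::] s) p); split; first exact: (@valid_lift _ [::]).
  by rewrite (@endw_lift _ [::]) ep.
by rewrite maplift_lift.
Qed.

Lemma rfix_widen Q a s c g : rfix Q (a ++ s) c g -> rfix Q a (s ++ c) g.
Proof.
move=> [h [p [hp ep eg]]]; split; first by rewrite h catA.
exists (map (lift s [::]) p); split.
- by have := @valid_lift _ s [::] c p hp; rewrite cats0.
- by have := @endw_lift _ s [::] c p; rewrite !cats0 ep.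
by rewrite maplift_lift.
Qed.

Definition lstab h g := exists Q e,
  [/\ src e = ev Q, hyp Q e = h & lfix Q (se_left e) (se_from e ++ se_right e) g].
Definition rstab h g := exists Q e,
  [/\ src e = ev Q, hyp Q e = h & rfix Q (se_left e ++ se_from e) (se_right e) g].

Let cross e : edge := SquierEdge [::] (se_right e) (se_applicable e).
Let cross' e : edge := SquierEdge (se_left e) [::] (se_applicable e).

(** Sliding conjugates the loop of the left part, and crossing the edge changes only what is to the
    right of the cut, so every dual edge gives the same elements. *)
Lemma lstabE Q e g : src e = ev Q ->
  lstab (hyp Q e) g <-> lfix Q (se_left e) (se_from e ++ se_right e) g.
Proof.
move=> he; split=> [[R [f [hf eh H]]]|]; last by exists Q, e.
have slideL S f' : src f' = ev S -> lfix S (se_left f') (se_from f' ++ se_right f') g ->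
    par S f' Q e -> lfix Q (se_left e) (se_from e ++ se_right e) g.
  move=> hf' H' [p [q [hp hq -> ->]]].
  have vq := @valid_lift _ (se_from f') [::] _ _ hq; rewrite cats0 in vq.
  have := lfix_move H' hp vq; rewrite -sump_mid -/(slide_path _ _ _).
  by have := @endw_lift _ (se_from f') [::] (se_right f') q; rewrite !cats0 => ->.
case: (hyp_eq_par hf he eh) => [|hp]; first exact: slideL.
apply: slideL hp; first by rewrite ev_walk1.
have := @lfix_move R _ _ _ [::] [:: cross f] H I (conj erefl I).
by rewrite sump_r /= (_ : lift _ _ _ = f) //; apply: edge_ext; rewrite /= ?cats0.
Qed.

Lemma rstabE Q e g : src e = ev Q ->
  rstab (hyp Q e) g <-> rfix Q (se_left e ++ se_from e) (se_right e) g.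
Proof.
move=> he; split=> [[R [f [hf eh H]]]|]; last by exists Q, e.
have slideR S f' : src f' = ev S -> rfix S (se_left f' ++ se_from f') (se_right f') g ->
    par S f' Q e -> rfix Q (se_left e ++ se_from e) (se_right e) g.
  move=> hf' H' [p [q [hp hq -> ->]]].
  have vp := @valid_lift _ [::] (se_from f') _ _ hp.
  have := rfix_move H' vp hq; rewrite -sump_mid' -/(slide_path _ _ _).
  by rewrite (@endw_lift _ [::] (se_from f')).
case: (hyp_eq_par hf he eh) => [|hp]; first exact: slideR.
apply: slideR hp; first by rewrite ev_walk1.
have v : valid (se_left f ++ se_from f) [:: cross' f].
  by split=> //; rewrite /squier_src /= cats0.
have := @rfix_move R _ _ _ [:: cross' f] [::] H v I.
rewrite sump_l /= (_ : lift _ _ _ = f); last exact: edge_ext.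
by rewrite /squier_tgt /= cats0.
Qed.

Lemma lstab_rstab_comm Q e g g' : src e = ev Q ->
  lstab (hyp Q e) g -> rstab (hyp Q e) g' -> (g * g' = g' * g)%g.
Proof.
move=> he /(lstabE _ he) H /(rstabE _ he) H'.
exact: lfix_rfix_comm H (rfix_widen H').
Qed.

Lemma lstab_act h g : lstab h g -> act_hyp g h = h.
Proof.
move=> [Q [e [he <- [_ [p [hp ep eg]]]]]]; rewrite act_hyp_hyp // eg.
have pe := @par_slide _ _ Q e p [::] hp I.
rewrite (hyp_par he pe) (_ : slide e p [::] = e); last exact: edge_ext.
by rewrite /slide_path sump_mid sump_l.
Qed.

Lemma rstab_act h g : rstab h g -> act_hyp g h = h.
Proof.
move=> [Q [e [he <- [_ [p [hp ep eg]]]]]]; rewrite act_hyp_hyp // eg.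
have pe := @par_slide _ _ Q e [::] p I hp.
rewrite (hyp_par he pe) (_ : slide e [::] p = e); last exact: edge_ext.
by rewrite /slide_path sump_mid' sump_r.
Qed.

Lemma lstab_conj h g (k : G) : lstab h g -> lstab (act_hyp k h) (k * g * k^-1)%g.
Proof.
move=> [Q [e [he <- H]]]; exists (act k Q), e.
by rewrite ev_act act_hyp_hyp //; split=> //; apply: lfixJ.
Qed.

Lemma rstab_conj h g (k : G) : rstab h g -> rstab (act_hyp k h) (k * g * k^-1)%g.
Proof.
move=> [Q [e [he <- H]]]; exists (act k Q), e.
by rewrite ev_act act_hyp_hyp //; split=> //; apply: rfixJ.
Qed.

(** Orientation is preserved, so [g] carries [e] to a parallel edge with the same projection. The
    halves [p] and [q] of the strip are then loops of the left and of the right part of the word,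
    and each comes from an element of the group. *)
Lemma stab_split Q e g : src e = ev Q -> act_hyp g (hyp Q e) = hyp Q e ->
  exists g1 g2, [/\ lstab (hyp Q e) g1, rstab (hyp Q e) g2 & g = (g1 * g2)%g].
Proof.
move=> he; rewrite act_hyp_hyp // => /esym eh.
have he' : src e = ev (act g Q) by rewrite ev_act.
have [p [q [hp hq ee eg]]] := hyp_sgn_par he he' eh erefl.
have ep : endw (se_left e) p = se_left e by rewrite {2}ee.
have eq : endw (se_right e) q = se_right e by rewrite {2}ee.
have eQ : ev Q = se_left e ++ (se_from e ++ se_right e) by rewrite -he.
have eQ' : ev Q = (se_left e ++ se_from e) ++ se_right e by rewrite eQ catA.
have vq := @valid_lift _ (se_from e) [::] _ _ hq; rewrite cats0 in vq.
have [g1 hg1] : exists g1, act g1 Q = walk Q (map (lift [::] (se_from e ++ se_right e)) p).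
  by apply: act_trans; rewrite -(sump_l (se_left e)) ev_cut //= ep eQ.
exists g1, (g1^-1 * g)%g; rewrite mulVKg; split=> //.
  by apply/lstabE => //; split=> //; exists p.
apply/rstabE => //; split=> //; exists q; split=> //.
rewrite actM -[RHS](actK g1); congr act.
have es : map (lift (se_left e ++ se_from e) [::]) q =
    sump (se_left e) [::] (se_from e ++ se_right e) [::] (map (lift (se_from e) [::]) q).
  by rewrite sump_r maplift_lift.
rewrite es act_walk; last exact: valid_cut.
have := @walk_cut Q _ _ p [::] [::] (map (lift (se_from e) [::]) q) eQ.
rewrite cats0 ep hg1 /= => /(_ hp vq); rewrite sump_l => ->.
by rewrite eg /slide_path sump_mid.
Qed.

(** The letters left of [k] are among the letters left of [h], so the same loop may be read at the
    wider cut. *)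
Lemma lstab_left_of h k g : left_of k h -> lstab k g -> lstab h g.
Proof.
move=> [Q [e [f [he [m [em fm]] -> ->]]]] /(lstabE _ he) H.
have hf : src f = ev Q by rewrite -he; apply/esym/disj_src; exists m.
apply/lstabE => //; rewrite fm; apply: lfix_widen.
by move: H; rewrite em -!catA.
Qed.

Lemma rstab_left_of h k g : left_of k h -> rstab h g -> rstab k g.
Proof.
move=> [Q [e [f [he [m [em fm]] -> ->]]]].
have hf : src f = ev Q by rewrite -he; apply/esym/disj_src; exists m.
move=> /(rstabE _ hf) H; apply/rstabE => //; rewrite em catA; apply: rfix_widen.
by move: H; rewrite fm -!catA.
Qed.

(* The hyperplanes crossing the left (resp. right) factor of the product
   subcomplex attached to a cut. *)
Definition crossl Q a c k := exists p q e,
  [/\ valid a p, valid c q, src e = endw a p &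
      k = hyp (walk Q (sump a [::] c p q)) (lift [::] (endw c q) e)].
Definition crossr Q a c k := exists p q e,
  [/\ valid a p, valid c q, src e = endw c q &
      k = hyp (walk Q (sump a [::] c p q)) (lift (endw a p) [::] e)].

Lemma crossl_sgn Q a c k (z : edge) : ev Q = a ++ c -> crossl Q a c k -> exists p q e,
  [/\ valid a p, valid c q, src e = endw a p,
      k = hyp (walk Q (sump a [::] c p q)) (lift [::] (endw c q) e) & sgn e = sgn z].
Proof.
move=> h [p [q [e [hp hq he ->]]]].
case: (eqVneq (sgn e) (sgn z)) => [s|/eqP s]; first by exists p, q, e.
have v : valid a (p ++ [:: e]) by apply/valid_cat.
have hle : src (lift [::] (endw c q) e) = ev (walk Q (sump a [::] c p q)).
  by rewrite ev_cut // src_lift he.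
exists (p ++ [:: e]), q, (redge e); split.
- by [].
- by [].
- by rewrite endw_cat.
- have := @walk_cut Q a c p q [:: e] [::] h v; rewrite cats0 sump_l => /(_ hq) <-.
  by rewrite lift_rev hyp_rev.
- by rewrite sgn_rev; move: s; case: (sgn_cases e) => ->; case: (sgn_cases z) => ->.
Qed.

Lemma crossr_sgn Q a c k (z : edge) : ev Q = a ++ c -> crossr Q a c k -> exists p q e,
  [/\ valid a p, valid c q, src e = endw c q,
      k = hyp (walk Q (sump a [::] c p q)) (lift (endw a p) [::] e) & sgn e = sgn z].
Proof.
move=> h [p [q [e [hp hq he ->]]]].
case: (eqVneq (sgn e) (sgn z)) => [s|/eqP s]; first by exists p, q, e.
have v : valid c (q ++ [:: e]) by apply/valid_cat.
have hle : src (lift (endw a p) [::] e) = ev (walk Q (sump a [::] c p q)).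
  by rewrite ev_cut // src_lift he cats0.
exists p, (q ++ [:: e]), (redge e); split.
- by [].
- by [].
- by rewrite endw_cat.
- have := @walk_cut Q a c p q [::] [:: e] h; rewrite cats0 sump_r => /(_ hp v) <-.
  by rewrite lift_rev hyp_rev.
- by rewrite sgn_rev; move: s; case: (sgn_cases e) => ->; case: (sgn_cases z) => ->.
Qed.

(** If [f] reached beyond [a], its last letter would be copied by a slide of [f] into the left
    factor, whose outputs are computed from the letters of [a] alone. *)
Lemma crossl_inside Q a c f : ev Q = a ++ c -> src f = ev Q -> crossl Q a c (hyp Q f) ->
  exists2 e, src e = a & f = lift [::] c e.
Proof.
move=> h hf /(crossl_sgn f h) [p [q [e [hp hq he eh se]]]].
have hle : src (lift [::] (endw c q) e) = ev (walk Q (sump a [::] c p q)).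
  by rewrite ev_cut // src_lift he.
have [al [be [ha hb ee eR]]] := hyp_sgn_par hf hle eh (esym se).
have v1 : valid (ev Q) (slide_path f al be) by rewrite -hf; apply: valid_slide.
have H : hom (ev Q) (slide_path f al be) (sump a [::] c p q).
  by apply: walk_inj => //; exact: valid_cut.
have sf := size_from_gt0 f.
have lt_size : size (se_left f) + size (se_from f) <= size a.
  rewrite leqNgt; apply/negP => hlt.
  have k_lt : (size (se_from f)).-1 < size (se_from f) by lia.
  have c1 := copies_sump ha hb k_lt.
  rewrite -/(squier_src f) hf in c1.
  have i_lt : size (se_left f) + (size (se_from f)).-1 < size (ev Q).
    by rewrite -hf /squier_src !size_cat; lia.
  have g1 := @ignores_sump_left _ a [::] c p q (size (se_left f) + (size (se_from f)).-1)
     (size (endw (se_left f) al) + (size (se_from f)).-1) hp hq.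
  rewrite /= -h in g1.
  apply: (copies_ignores i_lt (copies_hom H v1 c1)); apply: g1; last by lia.
  have el : se_left e = endw (se_left f) al by move/(congr1 (@se_left P)): (ee).
  have ef : se_from e = se_from f by move/(congr1 (@se_from P)): (ee).
  by rewrite -he /squier_src !size_cat el ef; lia.
have := hf; rewrite h /squier_src catA => /cat_eq_prefix.
rewrite size_cat => /(_ lt_size) [m [h1 h2]].
exists (SquierEdge (se_left f) m (se_applicable f)).
  by rewrite h1 /squier_src -catA.
by apply: edge_ext.
Qed.

Lemma crossr_inside Q a c f : ev Q = a ++ c -> src f = ev Q -> crossr Q a c (hyp Q f) ->
  exists2 e, src e = c & f = lift a [::] e.
Proof.
move=> h hf /(crossr_sgn f h) [p [q [e [hp hq he eh se]]]].
have hle : src (lift (endw a p) [::] e) = ev (walk Q (sump a [::] c p q)).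
  by rewrite ev_cut // src_lift he cats0.
have [al [be [ha hb ee eR]]] := hyp_sgn_par hf hle eh (esym se).
have v1 : valid (ev Q) (slide_path f al be) by rewrite -hf; apply: valid_slide.
have H : hom (ev Q) (slide_path f al be) (sump a [::] c p q).
  by apply: walk_inj => //; exact: valid_cut.
have sf := size_from_gt0 f.
have lt_size : size a <= size (se_left f).
  rewrite leqNgt; apply/negP => hlt.
  have c1 := copies_sump ha hb sf.
  rewrite -/(squier_src f) hf !addn0 in c1.
  have i_lt : size (se_left f) < size (ev Q).
    by rewrite -hf /squier_src !size_cat; lia.
  have g1 := @ignores_sump_right _ a [::] c p q (size (se_left f))
     (size (endw (se_left f) al)) hp hq.
  rewrite /= -h !addn0 in g1.
  apply: (copies_ignores i_lt (copies_hom H v1 c1)); apply: g1 => //.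
  by move/(congr1 (@se_left P)): ee => /= <-; rewrite size_cat; lia.
have := esym hf; rewrite h /squier_src => /cat_eq_prefix /(_ lt_size) [m [h1 h2]].
exists (SquierEdge m (se_right f) (se_applicable f)); first by rewrite h2.
by apply: edge_ext; rewrite //= cats0.
Qed.

Lemma crossl_move Q a c k p q : ev Q = a ++ c -> valid a p -> valid c q ->
  crossl Q a c k -> crossl (walk Q (sump a [::] c p q)) (endw a p) (endw c q) k.
Proof.
move=> h hp hq [p' [q' [e' [hp' hq' he' ->]]]].
have v1 : valid a (p ++ rpath p ++ p').
  apply/valid_cat; split=> //; apply/valid_cat; split; first exact: valid_rpath.
  by rewrite endw_rpath.
have v2 : valid c (q ++ rpath q ++ q').
  apply/valid_cat; split=> //; apply/valid_cat; split; first exact: valid_rpath.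
  by rewrite endw_rpath.
have [_ w1] := proj1 (valid_cat _ _ _) v1; have [_ w2] := proj1 (valid_cat _ _ _) v2.
have z1 : endw (endw a p) (rpath p ++ p') = endw a p' by rewrite endw_cat endw_rpath.
have z2 : endw (endw c q) (rpath q ++ q') = endw c q' by rewrite endw_cat endw_rpath.
exists (rpath p ++ p'), (rpath q ++ q'), e'; rewrite z1 z2; split=> //.
rewrite walk_cut //; congr hyp; apply: walk_cut_hom => //; rewrite catA.
  by apply: (@hom_catr _ _ p' [::]); rewrite //; apply/hom_sym/hom_rpathr.
by apply: (@hom_catr _ _ q' [::]); rewrite //; apply/hom_sym/hom_rpathr.
Qed.

Lemma crossr_move Q a c k p q : ev Q = a ++ c -> valid a p -> valid c q ->
  crossr Q a c k -> crossr (walk Q (sump a [::] c p q)) (endw a p) (endw c q) k.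
Proof.
move=> h hp hq [p' [q' [e' [hp' hq' he' ->]]]].
have v1 : valid a (p ++ rpath p ++ p').
  apply/valid_cat; split=> //; apply/valid_cat; split; first exact: valid_rpath.
  by rewrite endw_rpath.
have v2 : valid c (q ++ rpath q ++ q').
  apply/valid_cat; split=> //; apply/valid_cat; split; first exact: valid_rpath.
  by rewrite endw_rpath.
have [_ w1] := proj1 (valid_cat _ _ _) v1; have [_ w2] := proj1 (valid_cat _ _ _) v2.
have z1 : endw (endw a p) (rpath p ++ p') = endw a p' by rewrite endw_cat endw_rpath.
have z2 : endw (endw c q) (rpath q ++ q') = endw c q' by rewrite endw_cat endw_rpath.
exists (rpath p ++ p'), (rpath q ++ q'), e'; rewrite z1 z2; split=> //.
rewrite walk_cut //; congr hyp; apply: walk_cut_hom => //; rewrite catA.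
  by apply: (@hom_catr _ _ p' [::]); rewrite //; apply/hom_sym/hom_rpathr.
by apply: (@hom_catr _ _ q' [::]); rewrite //; apply/hom_sym/hom_rpathr.
Qed.

Lemma crosslr_disj Q a c k : ev Q = a ++ c -> crossl Q a c k -> crossr Q a c k -> False.
Proof.
move=> h hl [p [q [e [hp hq he ek]]]].
have e1 : ev (walk Q (sump a [::] c p q)) = endw a p ++ endw c q by rewrite ev_cut.
have hle : src (lift (endw a p) [::] e) = ev (walk Q (sump a [::] c p q)).
  by rewrite e1 src_lift he cats0.
have [|f hf ef] := @crossl_inside _ _ _ (lift (endw a p) [::] e) e1 hle.
  by rewrite -ek; apply: crossl_move.
have := congr1 (fun x0 : edge => size (se_left x0)) ef.
rewrite /= size_cat => es; move: (congr1 size hf); rewrite /squier_src !size_cat.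
have := size_from_gt0 f; lia.
Qed.

End Cuts.

(** * Axes from minimal displacement *)

Section Axes.
Variables (P : semigroup_presentation) (w0 : seq (alphabet P)).
Local Notation word := (seq (alphabet P)).
Local Notation edge := (squier_edge P).
Local Notation src := (@squier_src P).
Local Notation tgt := (@squier_tgt P).
Local Notation redge := (@squier_rev P).
Local Notation rpath := (@rev_path (squier_complex P)).
Local Notation G := (@diagram_group P w0).
Local Notation cover := (@cover P w0).
Local Notation hyperplane := (@hyperplane P w0).
Implicit Types (a b c u v w x y z m s t : word) (e f : edge) (p q r l : seq edge).
Implicit Types (Q R S Z : cover) (h k : hyperplane) (g : G).

Lemma delta_actr g h Q R : delta h (act g Q) (act g R) = delta (act_hyp g^-1%g h) Q R.
Proof. by rewrite -{1}[h](act_hypKV g) delta_act. Qed.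

Lemma delta_zexp_succ g h Q (i : int) :
  delta h (act (zexp g i) Q) (act (zexp g (i + 1)%R) Q) = delta (act_hyp (zexp g (- i)%R) h) Q (act g Q).
Proof. by rewrite zexpS actM delta_actr -zexpN. Qed.

Lemma uniq_hyps_dist Q p : valid (ev Q) p -> size p <= dist Q (walk Q p) -> uniq (hyps Q p).
Proof.
move=> hp; have [q [hq eq u <-]] := dist_geo_ex Q (walk Q p) => hs.
apply: (leq_size_uniq u); last by rewrite !size_hyps.
by move=> h; rewrite -(delta_hyps _ hq) // eq; apply: contraR => /(delta_notin hp) ->.
Qed.

Definition mindisp g Q := forall R, dist Q (act g Q) <= dist R (act g R).

Lemma mindisp_ex g : exists Q, mindisp g Q.
Proof.
have [n [Q hQ] hmin] : exists2 n, (exists Q, dist Q (act g Q) = n) &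
    forall R, n <= dist R (act g R).
  have [n] : exists n, exists Q, dist Q (act g Q) <= n.
    by exists (dist (base w0) (act g (base w0))), (base w0).
  elim: n => [|n IH] [Q hQ].
    by exists 0 => //; exists Q; apply/eqP; rewrite -leqn0.
  case: (pselect (exists R, dist R (act g R) <= n)) => [/IH //|H].
  exists n.+1; last first.
    by move=> R; rewrite leqNgt ltnS; apply/negP => hR; apply: H; exists R.
  exists Q; apply/eqP; rewrite eqn_leq hQ /= ltnNge; apply/negP => hR.
  by apply: H; exists Q.
by exists Q => R; rewrite hQ.
Qed.

Lemma delta_zexp_run g h Q (n : nat) (i : int) :
  (forall j : nat, j < n -> delta (act_hyp (zexp g (- (i + j%:Z))%R) h) Q (act g Q) = 0%R) ->
  delta h (act (zexp g i) Q) (act (zexp g (i + n%:Z)%R) Q) = 0%R.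
Proof.
elim: n => [|n IH] H; first by rewrite GRing.addr0 delta_refl.
rewrite (delta_add _ _ (act (zexp g (i + n%:Z)%R) Q)) IH; last first.
  by move=> j hj; apply: H; lia.
by rewrite (_ : (i + n.+1%:Z)%R = (i + n%:Z + 1)%R); [rewrite delta_zexp_succ H|lia].
Qed.

(* If [g^m h] also separated [Q] from [g Q], then the edge dual to [h] could be
   moved to the front of the geodesic (the vertex [g^-m Q] witnesses the needed
   squares), and then past [Q], which lowers [m]. *)
Lemma mindisp_sep g (m j : nat) : forall Q p1 e p2, mindisp g Q -> valid (ev Q) (p1 ++ e :: p2) ->
  walk Q (p1 ++ e :: p2) = act g Q -> uniq (hyps Q (p1 ++ e :: p2)) -> size p1 = j ->
  delta (act_hyp (zexp g m.+1) (hyp (walk Q p1) e)) Q (act g Q) = 0%R.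
Proof.
elim/ltn_ind: m j => m IHm; elim=> [|j IHj] Q p1 e p2 hmin hv hw u hj.
- case: p1 hj hv hw u => // _ /= hv hw u; rewrite walk0.
  have [he hp2] := hv; set h := hyp Q e.
  apply/eqP; apply/negPn/negP; rewrite -hw delta_hyps // inE => /orP [/eqP|hin].
    (* The case where [g^(m+1)] fixes [h]: on the way from [Q] through [g Q] and [g^(m+1) Q] to the
       translate of the end of [e], the crossings of [h] would be [sgn e], 0 and [sgn e], adding up
       to 2 or -2. *)
    rewrite -/h => hh.
    have dQ := @delta_uniq _ _ Q [::] e p2 hv u; rewrite walk0 /= -/h hw in dQ.
    have d1 := @delta_edge _ _ h Q e he; rewrite /h eqxx -/h in d1.
    have dr : delta h (act (zexp g 1) Q) (act (zexp g (1 + m%:Z)%R) Q) = 0%R.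
      apply: delta_zexp_run => i hi.
      have -> : act_hyp (zexp g (- (1 + i%:Z))%R) h = act_hyp (zexp g (m - i.+1).+1) h.
        rewrite -{1}hh -act_hypM -zexpD; congr (act_hyp (zexp g _) h); lia.
      have := IHm (m - i.+1) _ 0 Q [::] e p2 hmin hv hw u erefl.
      by rewrite walk0; apply; lia.
    have dl : delta h (act (zexp g m.+1) Q) (act (zexp g m.+1) (walk Q [:: e])) = sgn e.
      by rewrite delta_actr -{1}hh act_hypK.
    have := delta_cases h Q (act (zexp g m.+1) (walk Q [:: e])).
    rewrite (delta_add _ _ (act (zexp g m.+1) Q)) dl (delta_add _ _ (act g Q)) dQ.
    rewrite -[in act g Q](zexp1 g) (_ : Posz m.+1 = (1 + m%:Z)%R) ?dr; last by lia.
    by case: (sgn_cases e) => ->; case; lia.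
  (* Moving the start past [e] puts [e] at the end of a path that again realizes the minimal
     displacement; there its hyperplane is [g h], for which the exponent is one less. *)
  set Q1 := walk Q [:: e].
  have e1 : ev Q1 = tgt e by rewrite ev_walk1.
  have ee : endw (tgt e) p2 = ev Q.
    by have := congr1 (@ev _ _) hw; rewrite ev_act ev_walk.
  have v1 : valid (ev Q1) (p2 ++ [:: e]) by rewrite e1; apply/valid_cat; rewrite ee.
  have w1 : walk Q1 p2 = act g Q by rewrite -hw (walk_cons he hp2).
  have w2 : walk Q1 (p2 ++ [:: e]) = act g Q1.
    rewrite -walk_cat ?e1 //= ?ee // w1 act_walk //=.
  have sz : size (p2 ++ [:: e]) = dist Q (act g Q).
    by rewrite -hw dist_geodesic // size_cat /= addn1.
  have d1 : dist Q1 (act g Q1) = dist Q (act g Q).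
    by apply/eqP; rewrite eqn_leq hmin andbT -{1}w2 -sz; apply: dist_le.
  have min1 : mindisp g Q1 by move=> R; rewrite d1.
  have u1 : uniq (hyps Q1 (p2 ++ [:: e])).
    by apply: uniq_hyps_dist => //; rewrite w2 d1 sz.
  have hl : hyp (walk Q1 p2) e = act_hyp g h by rewrite w1 act_hyp_hyp.
  case: m IHm hin => [|m] IHm hin.
    move: u1; rewrite hyps_cat // cat_uniq /= orbF => /and3P [_ /negP H _].
    by apply: H; rewrite hl; move: hin; rewrite zexp1.
  have := IHm m (ltnSn m) _ Q1 p2 e [::] min1 v1 w2 u1 erefl.
  rewrite hl -act_hypM -zexpS (_ : (m.+1%:Z + 1)%R = m.+2); last by lia.
  move/eqP; rewrite -w2; apply/negP; rewrite delta_hyps // hyps_cat // mem_cat.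
  by rewrite hin.
case/lastP: p1 hj hv hw u => // p1 e'; rewrite size_rcons => -[hj] hv hw u.
rewrite -cats1 -catA /= in hv hw u.
have [hp1 [he' [he hp2]]] := proj1 (valid_cat _ _ _) hv.
set S := walk Q p1; have eS : ev S = endw (ev Q) p1 by rewrite ev_walk.
rewrite -eS in he'.
set T := walk S [:: e'].
have eT : ev T = tgt e' by rewrite ev_walk1.
have vT : valid (ev Q) (p1 ++ [:: e']) by apply/valid_cat; rewrite -eS.
have TE : walk Q (rcons p1 e') = T by rewrite -cats1 -walk_cat //= -eS.
rewrite TE; set h := hyp T e; set h' := hyp S e'.
apply: contrapT => K.
have heT : src e = ev T by rewrite eT.
have hreT : src (redge e') = ev T by rewrite eT.
have hu : hyps Q (p1 ++ e' :: e :: p2) = hyps Q p1 ++ h' :: h :: hyps (walk T [:: e]) p2.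
  by rewrite hyps_cat.
have dh : delta h Q (act g Q) = sgn e.
  have := @delta_uniq _ _ Q (rcons p1 e') e p2; rewrite -cats1 -catA /= hw cats1 TE.
  by apply.
have dh' : delta h' Q T = sgn e'.
  rewrite /T /S walk_cat //= -?eS //; apply: (@delta_uniq _ _ Q p1 e' [::]) => //.
  move: u; rewrite hu hyps_cat // !cat_uniq /= !orbF andbT.
  by case/and4P => -> /norP [-> _].
have dT : delta h Q T = 0%R.
  rewrite -TE -cats1; apply: delta_notin => //; rewrite hyps_cat // mem_cat /= inE -/S -/h'.
  move: u; rewrite hu cat_uniq /= inE (eq_sym h) !negb_or => /and3P [_ /and3P [_ -> _]].
  by move=> /andP [/andP [-> _] _].
(* Seen from [T], this vertex lies beyond [h], by the assumption [K], and beyond [h'], which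
   separates [Q] from [T] but not [Z] from [Q]. *)
set Z := act (zexp g (- m.+1%:Z)%R) Q.
have runZ k : (forall i, i < m -> delta (act_hyp (zexp g i.+1) k) Q (act g Q) = 0%R) ->
    delta k Z Q = delta (act_hyp (zexp g m.+1) k) Q (act g Q).
  move=> H; rewrite (delta_add _ _ (act (zexp g (- m.+1%:Z + 1)%R) Q)) delta_zexp_succ.
  rewrite GRing.opprK; have := @delta_zexp_run g k Q m (- m.+1%:Z + 1)%R.
  rewrite (_ : (- m.+1%:Z + 1 + m%:Z)%R = 0%R) ?zexp0 ?act1; last by lia.
  move=> ->; first by rewrite GRing.addr0.
  by move=> i hi; rewrite (_ : (- (_ + _))%R = Posz (m - i.+1).+1); [apply: H|]; lia.
have uT := u; rewrite hu in uT.
have vc : valid (ev Q) (rcons p1 e' ++ e :: p2) by rewrite cat_rcons.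
have hZ : delta h T Z = sgn e.
  have : delta h Z Q = delta (act_hyp (zexp g m.+1) h) Q (act g Q).
    apply: runZ => i hi; have := IHm i hi j.+1 Q (rcons p1 e') e p2 hmin vc.
    by rewrite cat_rcons TE size_rcons hj; apply.
  have := delta_cases h Z (act g Q); rewrite (delta_add _ Z Q) dh.
  rewrite (delta_add _ T Q Z) (delta_sym _ T) dT.
  move=> c1 E; have {}K : delta h Z Q <> 0%R by rewrite E.
  have := delta_cases h Z Q; move: c1 K; rewrite (delta_sym _ Q Z).
  by case: (sgn_cases e) => ->; case=> ?; move=> ?; case; lia.
have hZ' : delta h' T Z = sgn (redge e').
  have : delta h' Z Q = 0%R.
    rewrite runZ; first exact: (IHj Q p1 e' (e :: p2)).
    by move=> i hi; apply: (IHm i hi j Q p1 e' (e :: p2)).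
  rewrite sgn_rev (delta_add _ T Q Z) (delta_sym _ T) dh' (delta_sym _ Q Z) => ->.
  lia.
have hr : hyp T (redge e') = h' by rewrite hyp_rev.
have ne : hyp T (redge e') <> h.
  rewrite hr => eh; move: uT; rewrite eh cat_uniq /= inE eqxx.
  by rewrite /= !andbF.
rewrite -hr in hZ'.
have D := quadrant hreT heT ne hZ' hZ.
have [e2' [e1 [H [[v1 v2] [v3 v4]] par1 _]]] := disj_swap hreT heT D.
have {}par1 : par T e S e1 by move: par1; rewrite walk_backtrack.
have es1 : src e1 = ev S by apply: par_src par1.
have es2 : src (redge e2') = tgt e1.
  exact: esym (hom_end H).
have et2 : tgt (redge e2') = tgt e by case: v4.
have wS : walk (walk S [:: e1]) [:: redge e2'] = walk T [:: e].
  have := @walk_hom _ _ T [:: redge e'; e1] _ (conj v1 v2) H; rewrite (@walk_cons _ _ T (redge e') [:: e1] v1 v2).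
  rewrite walk_backtrack // => ->.
  by rewrite (@walk_cons _ _ T e [:: e2'] heT v4) walk_backtrack // ev_walk1 //; case: v4.
have vn : valid (ev Q) (p1 ++ e1 :: redge e2' :: p2).
  by apply/valid_cat; rewrite -eS; split=> //; split=> //; split=> //; rewrite et2.
have wn : walk Q (p1 ++ e1 :: redge e2' :: p2) = act g Q.
  have [_ vn'] := proj1 (valid_cat _ _ _) vn; have [_ hv'] := proj1 (valid_cat _ _ _) hv.
  rewrite -hw -(walk_cat hp1 vn') -(walk_cat hp1 hv') -/S.
  have vr : valid (tgt (redge e2')) p2 by rewrite et2.
  rewrite (@walk_cons _ _ S e1 (redge e2' :: p2) es1 (conj es2 vr)).
  rewrite (@walk_cons _ _ _ (redge e2') p2 _ vr) ?ev_walk1 // wS.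
  by rewrite (@walk_cons _ _ S e' (e :: p2) he' (conj he hp2)) (@walk_cons _ _ T e p2 heT hp2).
have un : uniq (hyps Q (p1 ++ e1 :: redge e2' :: p2)).
  apply: uniq_hyps_dist => //; rewrite wn -{1}hw dist_geodesic //.
  by rewrite !size_cat.
apply: K; rewrite /h (hyp_par heT par1).
exact: (IHj Q p1 e1 (redge e2' :: p2)).
Qed.

(** Equivalently, the translates by the powers of [g] of a geodesic from [Q] to [g Q] form a line
    that crosses no hyperplane twice. *)
Definition axis g Q := forall h (m : nat), delta h Q (act g Q) <> 0%R ->
  delta (act_hyp (zexp g m.+1) h) Q (act g Q) = 0%R.

Lemma axis_ex g : exists Q, axis g Q.
Proof.
have [Q hQ] := mindisp_ex g; exists Q => h m.
have [p [hp hw u]] := geodesic Q (act g Q) => /eqP.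
rewrite -hw delta_hyps // => /(in_hyps hp) [p1 [e [p2 [ep ->]]]].
rewrite hw; rewrite ep in hp hw u.
exact: (@mindisp_sep g m _ Q p1 e p2).
Qed.

End Axes.

(** * Hyperplanes transverse to the axes of an element *)

Section Transverse.
Variables (P : semigroup_presentation) (w0 : seq (alphabet P)).
Local Notation word := (seq (alphabet P)).
Local Notation edge := (squier_edge P).
Local Notation src := (@squier_src P).
Local Notation tgt := (@squier_tgt P).
Local Notation redge := (@squier_rev P).
Local Notation rpath := (@rev_path (squier_complex P)).
Local Notation G := (@diagram_group P w0).
Local Notation cover := (@cover P w0).
Local Notation hyperplane := (@hyperplane P w0).
Implicit Types (a b c : word) (e f : edge) (p q r l : seq edge).
Implicit Types (Q R S Z : cover) (h : hyperplane) (g : G).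

Lemma injective_int_escape (T : eqType) (f : int -> T) (s : seq T) : injective f ->
  exists M0 : nat, forall i : int, M0 <= `|i|%N -> f i \notin s.
Proof.
move=> fi; elim: s => [|t s [M IH]]; first by exists 0.
case: (pselect (exists i, f i = t)) => [[i <-]|H].
  exists (maxn M `|i|.+1) => j; rewrite geq_max inE negb_or => /andP [h1 h2].
  by rewrite IH // andbT; apply/eqP => /fi e; move: h2; rewrite e ltnn.
exists M => j hj; rewrite inE negb_or IH // andbT.
by apply/eqP => e; apply: H; exists j.
Qed.

Lemma pigeonhole_seq (T : eqType) (s : seq T) (A : nat -> T -> Prop) :
  (forall i, exists2 t, t \in s & A i t) -> exists i j t, [/\ i < j, j <= size s, A i t & A j t].
Proof.
move=> H; have H' i : exists t, t \in s /\ A i t by have [t] := H i; exists t.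
have [f hf] := choice H'.
have : ~~ uniq (map f (iota 0 (size s).+1)).
  apply/negP => u; have := uniq_leq_size u (_ : {subset _ <= s}).
  rewrite size_map size_iota ltnn; case/(_ _)/notF.
  by move=> _ /mapP [i _ ->]; case: (hf i).
move/(uniqPn (f 0)) => [i [j [hij]]]; rewrite size_map size_iota => hj.
rewrite !(nth_map 0) ?size_iota // ?nth_iota //; try lia.
rewrite !add0n => e; exists i, j, (f i); split=> //; first by case: (hf i).
by rewrite e; case: (hf j).
Qed.

Definition fixes g h := act_hyp g h = h.

Lemma fixes1 h : fixes 1%g h. Proof. exact: act_hyp1. Qed.
Lemma fixesM g (g' : G) h : fixes g h -> fixes g' h -> fixes (g * g')%g h.
Proof. by rewrite /fixes act_hypM => e ->. Qed.
Lemma fixesV g h : fixes g h -> fixes g^-1%g h.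
Proof. by rewrite /fixes => e; rewrite -{1}e act_hypK. Qed.
Lemma fixesMl g (g' : G) h : fixes g h -> fixes (g * g')%g h -> fixes g' h.
Proof. by move=> /fixesV f1 f2; rewrite -(mulKg g g'); apply: fixesM. Qed.
Lemma fixes_zexp g h i : fixes g h -> fixes (zexp g i) h.
Proof.
move=> f; elim/zexp_ind: i => [|i IH|i IH]; first exact: fixes1.
- by rewrite zexpS; apply: fixesM.
- by rewrite zexpB1; apply: fixesM => //; apply: fixesV.
Qed.
Lemma fixes_act g (k : G) h : commute g k -> fixes g h -> fixes g (act_hyp k h).
Proof. by rewrite /fixes => c e; rewrite -act_hypM c act_hypM e. Qed.

Lemma fixes_eq g (g' : G) h : act_hyp g h = act_hyp g' h <-> fixes (g'^-1 * g)%g h.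
Proof.
rewrite /fixes act_hypM; split=> [->|e]; first by rewrite act_hypK.
by rewrite -{2}e act_hypKV.
Qed.

(** An element fixing a hyperplane preserves its orientation, so it moves a dual edge by a slide,
    which does not cross the hyperplane. A set that is no hyperplane separates nothing. *)
Lemma fixes_delta g h R : fixes g h -> delta h R (act g R) = 0%R.
Proof.
case: (pselect (exists Q e, src e = ev Q /\ hyp Q e = h)); last first.
  move=> H _; have [p [hp <-]] := walk_ex R (act g R).
  apply: delta_notin => //; apply/negP => /(in_hyps hp) [p1 [e [p2 [ep eh]]]].
  apply: H; exists (walk R p1), e; split=> //; move: hp; rewrite ep.
  by case/valid_cat => h1 [-> _]; rewrite ev_walk.
move=> [Q [e [he <-]]] hf.
suff dQ : delta (hyp Q e) Q (act g Q) = 0%R.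
  have dR : delta (hyp Q e) (act g Q) (act g R) = delta (hyp Q e) Q R by rewrite -{1}hf delta_act.
  by rewrite (delta_add _ _ Q) (delta_add _ Q (act g Q)) dQ dR (delta_sym _ R); lia.
move: hf; rewrite /fixes act_hyp_hyp // => /esym eh.
have he' : src e = ev (act g Q) by rewrite ev_act.
have [p [q [hp hq ee ->]]] := hyp_sgn_par he he' eh erefl.
apply: delta_notin; first by rewrite -he; apply: valid_slide.
by apply/negP => /(hyps_slide he hp hq); case=> /left_of_irr.
Qed.

Definition nofix g h := forall m : nat, ~ fixes (zexp g m.+1) h.

Lemma nofix_zexp0 g h i : nofix g h -> fixes (zexp g i) h -> i = 0%R.
Proof.
case: i => [[|m]|m] // nf; first by move/nf.
by move/fixesV; rewrite -zexpN => /nf.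
Qed.

Lemma nofix_inj g h : nofix g h -> injective (fun i => act_hyp (zexp g i) h).
Proof.
move=> nf i j /fixes_eq; rewrite -zexpN -zexpD => /(nofix_zexp0 nf).
lia.
Qed.

Lemma nofix_escape g h Q R : nofix g h ->
  exists M0 : nat, forall i : int, M0 <= `|i|%N -> delta (act_hyp (zexp g i) h) Q R = 0%R.
Proof.
move=> nf; have [s hs] := delta_sep_ex Q R.
have [M0 H] := injective_int_escape s (nofix_inj nf); exists M0 => i /H /negP H'.
by apply: contrapT => /hs.
Qed.

Lemma nofix_stable g h Q : nofix g h -> exists M0 : nat, forall M : nat, M0 <= M ->
  delta h (act (zexp g M0) Q) (act (zexp g M) Q) = 0%R /\
  delta h (act (zexp g (- M%:Z)%R) Q) (act (zexp g (- M0%:Z)%R) Q) = 0%R.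
Proof.
move=> nf; have [M0 H] := nofix_escape Q (act g Q) nf; exists M0 => M hM; split.
  rewrite -(subnKC hM) PoszD; apply: delta_zexp_run => j _; apply: H; lia.
have -> : (- M0%:Z = - M%:Z + (M - M0)%N%:Z)%R by lia.
by apply: delta_zexp_run => j hj; apply: H; lia.
Qed.

(* The hyperplanes transverse to every axis of [g]. *)
Definition inH g h := nofix g h /\ forall Q, exists M0 : nat, forall M M' : nat,
  M0 <= M -> M0 <= M' ->
  delta h (act (zexp g (- M%:Z)%R) Q) (act (zexp g M') Q) <> 0%R.

Lemma inH_intro g h Q : nofix g h ->
  (forall M0 : nat, exists M M' : nat, [/\ M0 <= M, M0 <= M' &
    delta h (act (zexp g (- M%:Z)%R) Q) (act (zexp g M') Q) <> 0%R]) -> inH g h.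
Proof.
move=> nf H; split=> // R.
have [M1 h1] := nofix_escape Q R nf; have [M2 h2] := nofix_stable Q nf.
have hR i : M1 <= `|i|%N -> delta h (act (zexp g i) Q) (act (zexp g i) R) = 0%R.
  by move=> hi; rewrite delta_actr -zexpN; apply: h1; rewrite abszN.
have hQ M M' : M2 <= M -> M2 <= M' ->
   delta h (act (zexp g (- M%:Z)%R) Q) (act (zexp g M') Q) =
   delta h (act (zexp g (- M2%:Z)%R) Q) (act (zexp g M2) Q).
  move=> hM hM'; rewrite (delta_add _ _ (act (zexp g (- M2%:Z)%R) Q)) (h2 M hM).2.
  by rewrite (delta_add _ _ (act (zexp g M2) Q)) (h2 M' hM').1; lia.
exists (maxn M1 M2) => M M'; rewrite !geq_max => /andP [a1 a2] /andP [b1 b2].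
rewrite (delta_add _ _ (act (zexp g (- M%:Z)%R) Q)) (delta_sym h _ (act _ Q)) hR; last by lia.
rewrite (delta_add _ _ (act (zexp g M') Q)) hR ?hQ //.
have [N [N' [hN hN']]] := H M2; rewrite hQ // => ne.
by rewrite GRing.addr0 GRing.oppr0 GRing.add0r.
Qed.

Lemma axis_delta0 g Q h i : axis g Q -> delta h Q (act g Q) <> 0%R -> i <> 0%R ->
  delta (act_hyp (zexp g i) h) Q (act g Q) = 0%R.
Proof.
move=> ax dh; case: i => [[|m]|m] // _; first exact: ax.
apply: contrapT => K; have := ax _ m K; rewrite -act_hypM -zexpD.
by rewrite (_ : (_ + _)%R = 0%R) ?zexp0 ?act_hyp1; last lia.
Qed.

Lemma axis_delta g Q h (M M' : nat) : axis g Q -> delta h Q (act g Q) <> 0%R ->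
  delta h (act (zexp g (- M%:Z)%R) Q) (act (zexp g M'.+1) Q) = delta h Q (act g Q).
Proof.
move=> ax dh; have r1 := @delta_zexp_run _ _ g h Q M (- M%:Z)%R.
rewrite (_ : (- M%:Z + M%:Z)%R = 0%R) ?zexp0 ?act1 in r1; last by lia.
have r2 := @delta_zexp_run _ _ g h Q M' 1%R.
rewrite (_ : (1 + M'%:Z)%R = M'.+1) ?zexp1 in r2; last by lia.
rewrite (delta_add _ _ Q) r1; last by move=> j hj; apply: axis_delta0 => //; lia.
rewrite (delta_add _ _ (act g Q)) r2; first by rewrite GRing.addr0 GRing.add0r.
by move=> j hj; apply: axis_delta0 => //; lia.
Qed.

Lemma axis_inH g Q h : axis g Q -> delta h Q (act g Q) <> 0%R -> inH g h.
Proof.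
move=> ax dh; apply: (@inH_intro g h Q); last first.
  by move=> M; exists M, M.+1; split=> //; rewrite axis_delta.
by move=> m f; have := ax h m dh; rewrite (f : act_hyp _ h = h).
Qed.

Lemma inH_ex g : g <> 1%g -> exists h, inH g h.
Proof.
move=> ng; have [Q hQ] := axis_ex g.
apply: contrapT => H; apply: ng; apply: (@act_free _ _ _ Q); apply/esym/delta0_eq => h.
by apply: contrapT => /(axis_inH hQ) hh; apply: H; exists h.
Qed.

Lemma inH_cross g h Q : inH g h -> exists i, delta (act_hyp (zexp g i) h) Q (act g Q) <> 0%R.
Proof.
move=> [nf /(_ Q) [M H]]; apply: contrapT => K; apply: (H M M) => //.
have := @delta_zexp_run _ _ g h Q (M + M) (- M%:Z)%R.
rewrite (_ : (- M%:Z + (M + M)%N%:Z)%R = M); last by lia.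
apply=> j _; apply: contrapT => N; apply: K.
by exists (- (- M%:Z + j%:Z))%R.
Qed.

(** The orbits of [g * u] and of [g] differ by powers of [u], which do not cross [h]. *)
Lemma inH_fixes_mul g (u : G) h : commute u g -> fixes u h -> inH g h -> inH (g * u)%g h.
Proof.
move=> c fu [nf H]; have e i : zexp (g * u)%g i = (zexp u i * zexp g i)%g.
  by rewrite zexpMg; [apply/commute_zexp2/commute_sym|apply/commute_sym].
split=> [m|Q].
  by rewrite e => /(fixesMl (fixes_zexp _ fu)); apply: nf.
have [M0 HM] := H Q; exists M0 => M M' hM hM'; rewrite !e !actM.
rewrite (delta_add _ _ (act (zexp g (- M%:Z)%R) Q)) delta_sym fixes_delta; last exact: fixes_zexp.
rewrite (delta_add _ _ (act (zexp g M') Q)) (fixes_delta _ (fixes_zexp _ fu)).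
by rewrite GRing.oppr0 GRing.add0r GRing.addr0; apply: HM.
Qed.

Lemma inH_zexp g h i : i <> 0%R -> inH g h -> inH (zexp g i) h.
Proof.
move=> i0 [nf H]; split=> [m|Q].
  rewrite -zexpM => /(nofix_zexp0 nf); lia.
have [M0 HM] := H Q; exists M0 => M M' hM hM'; rewrite -!zexpM.
case: i i0 => [[|n] i0|n _] //.
  have -> : (n.+1%:Z * - M%:Z = - (n.+1 * M)%N%:Z)%R by lia.
  rewrite -PoszM; apply: HM; nia.
have -> : (Negz n * - M%:Z = (n.+1 * M)%N%:Z)%R by lia.
have -> : (Negz n * M'%:Z = - (n.+1 * M')%N%:Z)%R by lia.
rewrite delta_sym => K; apply: (HM (n.+1 * M') (n.+1 * M)); [nia|nia|lia].
Qed.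

Lemma inH_zexp_inv g h i : inH (zexp g i) h -> inH g h.
Proof.
move=> [nf H]; apply: (@inH_intro g h (base w0)).
  by move=> m f; apply: (nf m); rewrite -zexpM GRing.mulrC zexpM; apply: fixes_zexp.
move=> M0; have [M1 HM] := H (base w0); pose M := maxn M0 M1.
have hM : delta h (act (zexp g (i * - M%:Z)%R) (base w0)) (act (zexp g (i * M%:Z)%R) (base w0)) <> 0%R.
  by rewrite !zexpM; apply: HM; lia.
case: i nf H HM hM => [[|n]|n] nf H HM hM.
- by case: (nf 0); rewrite -zexpM; apply: fixes1.
- exists (n.+1 * M), (n.+1 * M); split; [nia|nia|].
  by move: hM; rewrite -PoszM GRing.mulrN -PoszM.
exists (n.+1 * M), (n.+1 * M); split; [nia|nia|] => K; apply: hM.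
have -> : (Negz n * - M%:Z = (n.+1 * M)%N%:Z)%R by lia.
have -> : (Negz n * M%:Z = - (n.+1 * M)%N%:Z)%R by lia.
by rewrite delta_sym K.
Qed.

Lemma inH_conj g h (k : G) : inH g h -> inH (k * g * k^-1)%g (act_hyp k h).
Proof.
move=> [nf H]; split=> [m|Q].
  rewrite zexpJ /fixes -act_hypM mulgVK act_hypM => /(can_inj (act_hypK k)).
  exact: nf.
have [M0 HM] := H (act k^-1%g Q); exists M0 => M M' hM hM'.
by rewrite !zexpJ !actM delta_act; apply: HM.
Qed.

Lemma inH_act g h (k : G) : commute k g -> inH g h -> inH g (act_hyp k h).
Proof. by move=> c /(inH_conj k); rewrite c mulgK. Qed.

(* [inH g] is finite modulo [g], so [k] permutes its [g]-orbits with finite order. *)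
Lemma inH_orbit g (k : G) h : commute k g -> inH g h ->
  exists2 n : nat, 0 < n & exists i, fixes (zexp k n * zexp g i)%g h.
Proof.
move=> c hh; have [s hs] := delta_sep_ex (base w0) (act g (base w0)).
have H (m : nat) : exists2 t, t \in s & exists i, act_hyp (zexp g i * zexp k m)%g h = t.
  have [|i hi] := @inH_cross g (act_hyp (zexp k m) h) (base w0).
    by apply: inH_act => //; apply/commute_sym/commute_zexp/commute_sym.
  exists (act_hyp (zexp g i) (act_hyp (zexp k m) h)); first exact/hs.
  by exists i; rewrite act_hypM.
have [m [m' [t [lt _ [i <-] [j /fixes_eq]]]]] := pigeonhole_seq H.
rewrite invgM -mulgA (mulgA _ (zexp g j)) -!zexpN -zexpD => f.
exists (m' - m); first by lia.
exists (- i + j)%R; move: f.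
have -> : ((m' - m)%N%:Z = - m%:Z + m'%:Z)%R by lia.
have cc := commute_zexp2 m' (- i + j)%R c.
by move=> f; rewrite (zexpD k) -mulgA cc.
Qed.

(** Every member of [inH g] has a translate by a power of [g] in the finite set [s]; the product of
    the exponents found for the members of [s] serves for all. *)
Lemma inH_common_power g (k : G) : commute k g ->
  exists2 n : nat, 0 < n & forall h, inH g h -> exists i, fixes (zexp k n * zexp g i)%g h.
Proof.
move=> c; have [s hs] := delta_sep_ex (base w0) (act g (base w0)).
have cz i j : commute (zexp k i) (zexp g j) by apply: commute_zexp2.
suff [n n0 H] : exists2 n : nat, 0 < n & forall h, h \in s -> inH g h ->
    exists i, fixes (zexp k n * zexp g i)%g h.
  exists n => // h hh; have [j /hs hj] := inH_cross (base w0) hh.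
  have [|i f] := H _ hj; first by apply: inH_act => //; apply/commute_sym/commute_zexp.
  exists i; rewrite -[h](act_hypK (zexp g j)); apply: fixes_act => //.
  apply/commuteV/commute_sym/commuteM; first exact/commute_sym.
  exact/commute_zexp2.
elim: {hs} s => [|t s [n n0 IH]]; first by exists 1.
case: (pselect (inH g t)) => [ht|nt]; last first.
  by exists n => // h; rewrite inE => /orP [/eqP -> //|]; apply: IH.
have [n' n0' [i' f']] := inH_orbit c ht; exists (n * n'); first by rewrite muln_gt0 n0.
move=> h; rewrite inE => /orP [/eqP -> _|hs hh].
  exists (i' * n%:Z)%R; rewrite mulnC PoszM !zexpM -zexpMg //; exact: fixes_zexp.
have [i f] := IH h hs hh; exists (i * n'%:Z)%R.
by rewrite PoszM !zexpM -zexpMg //; exact: fixes_zexp.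
Qed.

End Transverse.

(** * Centralizers of elements split at a cut *)

Section Splittings.
Variables (P : semigroup_presentation) (w0 : seq (alphabet P)).
Local Notation word := (seq (alphabet P)).
Local Notation edge := (squier_edge P).
Local Notation src := (@squier_src P).
Local Notation tgt := (@squier_tgt P).
Local Notation redge := (@squier_rev P).
Local Notation rpath := (@rev_path (squier_complex P)).
Local Notation G := (@diagram_group P w0).
Local Notation cover := (@cover P w0).
Local Notation hyperplane := (@hyperplane P w0).
Implicit Types (a b c : word) (e f : edge) (p q r l : seq edge).
Implicit Types (Q R S Z : cover) (h : hyperplane) (g : G).

Lemma cat_eq_left (T : Type) (x y z : seq T) : x ++ z = y ++ z -> x = y.
Proof.
move=> e; have es : size x = size y by have := congr1 size e; rewrite !size_cat; lia.
by have := congr1 (take (size x)) e; rewrite take_size_cat // es take_size_cat.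
Qed.

Lemma hyps_src Q p h : valid (ev Q) p -> h \in hyps Q p ->
  exists p1 e p2, [/\ p = p1 ++ e :: p2, valid (ev Q) p1, src e = ev (walk Q p1) & h = hyp (walk Q p1) e].
Proof.
move=> hp /(in_hyps hp) [p1 [e [p2 [ep eh]]]]; exists p1, e, p2.
by move: hp; rewrite ep => /valid_cat [h1 [he _]]; rewrite ev_walk.
Qed.

Lemma lfix_zexp Q a c g i : lfix Q a c g -> lfix Q a c (zexp g i).
Proof.
move=> f; elim/zexp_ind: i => [|i IH|i IH]; first by apply: lfix1; case: f.
- by rewrite zexpS; apply: lfixM.
- by rewrite zexpB1; apply: lfixM => //; apply: lfixV.
Qed.

Lemma rfix_zexp Q a c g i : rfix Q a c g -> rfix Q a c (zexp g i).
Proof.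
move=> f; elim/zexp_ind: i => [|i IH|i IH]; first by apply: rfix1; case: f.
- by rewrite zexpS; apply: rfixM.
- by rewrite zexpB1; apply: rfixM => //; apply: rfixV.
Qed.

Lemma rstabM h g (g' : G) : rstab h g -> rstab h g' -> rstab h (g * g')%g.
Proof.
move=> [Q [e [he <- f]]] /(rstabE _ he) f'.
by apply/(rstabE _ he); apply: rfixM.
Qed.
Lemma rstabV h g : rstab h g -> rstab h g^-1%g.
Proof. by move=> [Q [e [he <- f]]]; apply/(rstabE _ he); apply: rfixV. Qed.

(** The right part of the word at the cut lies entirely to the right of any edge in the left
    factor. *)
Lemma crossl_rstab Q a c h g : rfix Q a c g -> crossl Q a c h -> rstab h g.
Proof.
move=> f [p [q [e [hp hq he ->]]]]; have [eQ _] := f.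
apply/rstabE; first by rewrite ev_cut // src_lift he.
have := rfix_move f hp hq; rewrite -he /squier_src catA.
exact: rfix_widen.
Qed.

Lemma crossr_lstab Q a c h g : lfix Q a c g -> crossr Q a c h -> lstab h g.
Proof.
move=> f [p [q [e [hp hq he ->]]]]; have [eQ _] := f.
apply/lstabE; first by rewrite ev_cut // src_lift he cats0.
have := lfix_move f hp hq; rewrite -he /squier_src /= cats0.
exact: lfix_widen.
Qed.

Lemma hyps_cutl Q a c p h : ev Q = a ++ c -> valid a p ->
  h \in hyps Q (map (lift [::] c) p) -> crossl Q a c h.
Proof.
move=> eQ; elim/last_ind: p => // p e IH /valid_rcons [hp he].
have v : valid (ev Q) (map (lift [::] c) (rcons p e)).
  by rewrite -(sump_l a); apply: valid_cut => //; apply/valid_rcons.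
rewrite map_rcons -cats1 in v *; rewrite hyps_cat // mem_cat => /orP [/(IH hp) //|].
rewrite /= inE => /eqP ->; exists p, [::], e; split=> //.
by rewrite sump_l.
Qed.

Lemma hyps_cutr Q a c q h : ev Q = a ++ c -> valid c q ->
  h \in hyps Q (map (lift a [::]) q) -> crossr Q a c h.
Proof.
move=> eQ; elim/last_ind: q => // q e IH /valid_rcons [hq he].
have v : valid (ev Q) (map (lift a [::]) (rcons q e)).
  by rewrite -(sump_r a c); apply: valid_cut => //; apply/valid_rcons.
rewrite map_rcons -cats1 in v *; rewrite hyps_cat // mem_cat => /orP [/(IH hq) //|].
rewrite /= inE => /eqP ->; exists [::], q, e; split=> //.
by rewrite sump_r.
Qed.

Lemma lfix_crossl Q a c h g : lfix Q a c g -> delta h Q (act g Q) <> 0%R -> crossl Q a c h.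
Proof.
move=> [eQ [p [hp ep ->]]] /eqP dh; apply: (hyps_cutl eQ hp).
apply: contraR dh => /delta_notin -> //.
by rewrite -(sump_l a); apply: valid_cut.
Qed.

Lemma rfix_crossr Q a c h g : rfix Q a c g -> delta h Q (act g Q) <> 0%R -> crossr Q a c h.
Proof.
move=> [eQ [p [hp ep ->]]] /eqP dh; apply: (hyps_cutr eQ hp).
apply: contraR dh => /delta_notin -> //.
by rewrite -(sump_r a c); apply: valid_cut.
Qed.

Lemma inH_delta g h Q : inH g h -> exists i, delta h Q (act (zexp g i) Q) <> 0%R.
Proof.
move=> [_ /(_ Q) [M /(_ M M (leqnn M) (leqnn M))]] d; apply: contrapT => H; apply: d.
rewrite (delta_add _ _ Q) delta_sym.
have z i : delta h Q (act (zexp g i) Q) = 0%R by apply: contrapT => K; apply: H; exists i.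
by rewrite !z.
Qed.

Lemma lfix_inH Q a c g h : lfix Q a c g -> inH g h -> crossl Q a c h.
Proof. by move=> f /(inH_delta Q) [i]; apply/lfix_crossl/lfix_zexp. Qed.
Lemma rfix_inH Q a c g h : rfix Q a c g -> inH g h -> crossr Q a c h.
Proof. by move=> f /(inH_delta Q) [i]; apply/rfix_crossr/rfix_zexp. Qed.

(* The cut can be taken at the right end of the rightmost edge of the path. *)
Lemma rstab_carrier g Q p : valid (ev Q) p -> (forall h, h \in hyps Q p -> rstab h g) ->
  exists a c r, [/\ ev Q = a ++ c, valid a r, p = map (lift [::] c) r & rfix Q a c g].
Proof.
elim: p Q => [|e p IH] Q.
  move=> _ _; exists [::], (ev Q), [::]; split=> //; split=> //.
  have [q [hq eq]] := walk_ex Q (act g Q); exists q; split=> //.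
    by rewrite -ev_walk // eq ev_act.
  by rewrite maplift0 eq.
move=> [he hp] H; set Q1 := walk Q [:: e].
have e1 : ev Q1 = tgt e by rewrite ev_walk1.
have [a [c [r [ea hr er fr]]]] : exists a c r,
    [/\ ev Q1 = a ++ c, valid a r, p = map (lift [::] c) r & rfix Q1 a c g].
  by apply: IH; rewrite ?e1 // => h hh; apply: H; rewrite /= inE hh orbT.
have /(rstabE _ he) fe : rstab (hyp Q e) g by apply: H; rewrite /= inE eqxx.
have := ea; rewrite e1 /squier_tgt catA; set b := se_left e ++ se_to e => eb.
case: (leqP (size b) (size a)) => hs.
  have [m [em ec]] := cat_eq_prefix eb hs.
  pose e0 := SquierEdge (se_left e) m (se_applicable e).
  have el : e = lift [::] c e0 by apply: edge_ext.
  have te : tgt e0 = a by rewrite em /b -catA.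
  have es : ev Q = src e0 ++ c by rewrite -he /squier_src /= ec -!catA.
  exists (src e0), c, (e0 :: r); split=> //.
  - by rewrite /= te.
  - by rewrite er /= -el.
  have := @rfix_move _ _ Q1 a c g [:: redge e0] [::] fr (conj (te : src (redge e0) = a) I) I.
  rewrite sump_l /= lift_rev -el walk_backtrack //.
have [m [em ec]] := cat_eq_prefix (esym eb) (ltnW hs).
pose e0 := SquierEdge (se_left e) [::] (se_applicable e).
have el : e = lift [::] (se_right e) e0 by apply: edge_ext.
have te : tgt e0 = a ++ m by rewrite -em /squier_tgt /= cats0.
exists (src e0), (se_right e), (e0 :: map (lift [::] m) r); split.
- by rewrite -he /squier_src /= cats0 catA.
- by split=> //; rewrite te; apply: (@valid_lift _ [::]).
- by rewrite er /= -el maplift_lift /= -ec.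
by rewrite /squier_src /= cats0.
Qed.

(* With [Y = y ^ n], [g1^-1 (Y g1 Y^-1)] stabilizes every hyperplane of [g1] from the right
   side; carried along an axis of [g1], it sits beside [g1] at one cut, so that
   the hyperplanes of its product with [g1] are a disjoint union: it is [1]. *)
Theorem split_commute Q a c (g1 g2 y : G) : lfix Q a c g1 -> rfix Q a c g2 ->
  commute y (g1 * g2)%g -> exists2 n : nat, 0 < n & commute (zexp y n) g1.
Proof.
move=> f1 f2 cy; have c12 : commute g1 g2 := lfix_rfix_comm f1 f2.
have [n n0 Hn] := inH_common_power cy; exists n => //.
set Y := zexp y n; set x := (g1 * g2)%g in cy Hn.
have cx : commute Y x by apply/commute_sym/commute_zexp/commute_sym.
have fixH h : inH g1 h -> rstab h g2 by move=> /(lfix_inH f1); apply: crossl_rstab.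
have subH h : inH g1 h -> inH x h.
  move=> hh; apply: (inH_fixes_mul (commute_sym c12)) => //.
  exact/rstab_act/fixH.
have c1x i : commute (zexp x i) g1.
  by apply/commute_sym/commute_zexp/commuteM => //.
(* On such an [h] the element [Y] acts like a power of [x], and [x] commutes with [g1]. *)
have YH h : inH g1 h -> inH g1 (act_hyp Y h) /\ inH g1 (act_hyp Y^-1%g h).
  move=> hh; have [i f] := Hn h (subH h hh); have cYx : commute Y (zexp x i) by apply: commute_zexp.
  have -> : act_hyp Y h = act_hyp (zexp x (- i)%R) h.
    by apply/fixes_eq; rewrite zexpN invgK -cYx.
  have -> : act_hyp Y^-1%g h = act_hyp (zexp x i) h.
    by apply/esym/fixes_eq; rewrite invgK.
  by split; apply: inH_act.
set g1' := (Y * g1 * Y^-1)%g; set g2' := (Y * g2 * Y^-1)%g.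
have ex : (g1' * g2')%g = x by rewrite /g1' /g2' !mulgA mulgVK -[X in (X * _)%g]mulgA -/x cx mulgK.
have H' h : inH g1' h <-> inH g1 h.
  split=> hh.
    have := inH_conj Y^-1%g hh; rewrite /g1' invgK !mulgA mulVg mul1g mulgVK.
    by move/YH => []; rewrite act_hypKV.
  by have [_ /(inH_conj Y)] := YH h hh; rewrite act_hypKV.
set d := (g1^-1 * g1')%g.
have ed : d = (g2 * g2'^-1)%g.
  by rewrite /d; apply: (mulgI g1); rewrite mulVKg mulgA -/x -ex mulgK.
have Hd h : inH g1 h -> rstab h d.
  move=> hh; rewrite ed; apply: rstabM; first exact: fixH.
  apply: rstabV; have [_ /fixH /(rstab_conj Y)] := YH h hh.
  by rewrite act_hypKV.
have [R hR] := axis_ex g1.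
have [p [hp ep u]] := geodesic R (act g1 R).
have [|a1 [c1 [r [eR hr er fd]]]] := @rstab_carrier d R p hp.
  by move=> h; rewrite -delta_hyps // ep => /eqP /(axis_inH hR) /Hd.
have f1' : lfix R a1 c1 g1.
  split=> //; exists r; split=> //; last by rewrite -er.
  apply: (@cat_eq_left _ _ _ c1); rewrite -eR.
  have := congr1 (@ev _ _) ep; rewrite ev_act ev_walk // er eR => <-.
  by rewrite (@endw_lift _ [::]).
have e' : g1' = (g1 * d)%g by rewrite /d mulVKg.
have cd : commute g1 d := lfix_rfix_comm f1' fd.
(* A hyperplane transverse to [d] would cross the right factor, hence be fixed by [g1] and
   transverse to the product [g1'] of [g1] and [d]; but [g1] and [g1'] have the same transverse
   hyperplanes. *)
have d1 : d = 1%g.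
  apply: contrapT => /inH_ex [k hk].
  have fk : fixes g1 k by apply/lstab_act/(crossr_lstab f1')/(rfix_inH fd).
  have := inH_fixes_mul cd fk hk; rewrite -cd -e' => /H' [/(_ 0)].
  by rewrite zexp1.
rewrite d1 mulg1 in e'.
by rewrite /commute -{2}e' /g1' mulgVK.
Qed.

End Splittings.

(** * Splitting an element whose hyperplanes form two ordered families *)

Section Mixed.
Variables (P : semigroup_presentation) (w0 : seq (alphabet P)).
Local Notation word := (seq (alphabet P)).
Local Notation edge := (squier_edge P).
Local Notation src := (@squier_src P).
Local Notation tgt := (@squier_tgt P).
Local Notation redge := (@squier_rev P).
Local Notation rpath := (@rev_path (squier_complex P)).
Local Notation G := (@diagram_group P w0).
Local Notation cover := (@cover P w0).
Local Notation hyperplane := (@hyperplane P w0).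
Implicit Types (a b c : word) (e f : edge) (p q r l : seq edge).
Implicit Types (Q R S Z : cover) (h : hyperplane) (g : G).

Lemma lift_inj_left c : injective (lift [::] c : edge -> edge).
Proof.
move=> e f H; apply: edge_ext.
- exact: (congr1 (@se_left P) H).
- exact: (congr1 (@se_from P) H).
- exact: (congr1 (@se_to P) H).
- by apply: (@cat_eq_left _ _ _ c); apply: (congr1 (@se_right P) H).
Qed.

(** Rewriting the right factor slides every edge of the left factor to a parallel one. *)
Lemma hyps_cut_shift Q a c r q : ev Q = a ++ c -> valid a r -> valid c q ->
  hyps (walk Q (map (lift a [::]) q)) (map (lift [::] (endw c q)) r) =
  hyps Q (map (lift [::] c) r).
Proof.
move=> eQ + hq; elim/last_ind: r => // r e IH /valid_rcons [hr he].
have v : valid (ev Q) (map (lift [::] c) (rcons r e)).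
  by rewrite -(sump_l a); apply: valid_cut => //; apply/valid_rcons.
have e1 : ev (walk Q (map (lift a [::]) q)) = a ++ endw c q.
  by rewrite -(sump_r a c) ev_cut.
have v1 : valid (ev (walk Q (map (lift a [::]) q))) (map (lift [::] (endw c q)) (rcons r e)).
  by rewrite -(sump_l a); apply: valid_cut => //; apply/valid_rcons.
rewrite !map_rcons -!cats1 in v v1 *; rewrite !hyps_cat // IH //=; congr (_ ++ [:: _]).
set Q' := walk Q (map (lift [::] c) r).
have he' : src (lift [::] c e) = ev Q' by rewrite /Q' -(sump_l a) ev_cut // src_lift he.
have vq : valid (se_right (lift [::] c e)) (map (lift (se_right e) [::]) q).
  by have := @valid_lift _ (se_right e) [::] _ _ hq; rewrite cats0.
apply/esym; apply: (hyp_par he').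
have := @par_slide _ _ Q' _ [::] _ I vq.
rewrite /slide_path sump_mid' sump_r maplift_lift /= -catA -/(src e) he.
rewrite (_ : walk Q' _ = walk (walk Q (map (lift a [::]) q)) [seq lift [::] (endw c q) i | i <- r]); last first.
  rewrite /Q' -(sump_l a) -(sump_r (endw a r) c) -(sump_r a c) -(sump_l a (endw c q)).
  have := @walk_cut _ _ Q a c r [::] [::] q eQ; rewrite cats0 => -> //.
  by have := @walk_cut _ _ Q a c [::] q r [::] eQ hr; rewrite cats0 => ->.
congr par; apply: edge_ext => //=.
by have := @endw_lift _ (se_right e) [::] c q; rewrite !cats0.
Qed.

(** Edge by edge: the next edge rewrites letters left of [f], and [f] slides along it. *)
Lemma lift_of_left_of Q p f : valid (ev Q) p -> src f = ev Q ->
  (forall h, h \in hyps Q p -> left_of h (hyp Q f)) ->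
  exists2 r, valid (se_left f) r & p = map (lift [::] (se_from f ++ se_right f)) r.
Proof.
elim: p Q f => [|e p IH] Q f; first by exists [::].
move=> [he hp] hf H.
have [m [em fm]] : disj e f by apply: (left_of_disj he hf); apply: H; rewrite /= inE eqxx.
pose e0 := SquierEdge (se_left e) m (se_applicable e).
have ee : e = lift [::] (se_from f ++ se_right f) e0 by apply: edge_ext.
have se0 : src e0 = se_left f by rewrite fm.
have he0 : valid (se_left f) [:: e0] by [].
have pf := @par_slide _ _ Q f [:: e0] [::] he0 I.
rewrite /slide_path sump_mid sump_l /= -ee in pf.
have hf1 := par_src hf pf.
have [|h hh|r hr er] := IH _ _ _ hf1.
- by rewrite ev_walk1.
- by rewrite -(hyp_par hf pf); apply: H; rewrite /= inE hh orbT.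
by exists (e0 :: r); rewrite //= er /= -ee.
Qed.

(** Induction on [p2], carrying [p1] across the first edge [f] of [p2]. If the cut found after [f]
    lies left of [f] it is kept; otherwise it is moved back to the left end of [f], where [p1] still
    fits. *)
Lemma split_cut_ex Q p1 p2 : valid (ev Q) p1 -> valid (ev Q) p2 ->
  (forall h k, h \in hyps Q p1 -> k \in hyps Q p2 -> left_of h k) ->
  exists a c r l, [/\ ev Q = a ++ c, valid a r, valid c l,
    p1 = map (lift [::] c) r & p2 = map (lift a [::]) l].
Proof.
elim: p2 Q p1 => [|f p2 IH] Q p1 v1.
  by move=> _ _; exists (ev Q), [::], p1, [::]; rewrite cats0 maplift0.
move=> [hf v2] H; have [|r0 hr0 e1] := lift_of_left_of v1 hf.
  by move=> h hh; apply: H => //; rewrite /= inE eqxx.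
set Q1 := walk Q [:: f]; have eQ1 : ev Q1 = tgt f by rewrite ev_walk1.
pose f0 := SquierEdge [::] (se_right f) (se_applicable f).
have ef : f = lift (se_left f) [::] f0 by apply: edge_ext; rewrite /= ?cats0.
have eQ : ev Q = se_left f ++ (se_from f ++ se_right f) by rewrite -hf.
have vf0 : valid (se_from f ++ se_right f) [:: f0] by [].
have sh := hyps_cut_shift eQ hr0 vf0; rewrite /= -ef in sh.
set p1' := map (lift [::] (se_to f ++ se_right f)) r0.
have vp1' : valid (ev Q1) p1' by rewrite eQ1; apply: (@valid_lift _ [::]).
have [||a [c [r [l [ea hr hl er el]]]]] := IH Q1 p1' vp1'.
- by rewrite eQ1.
- by move=> h k hh hk; apply: H; rewrite ?e1 -?sh // inE hk orbT.
rewrite eQ1 /squier_tgt in ea.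
case: (leqP (size a) (size (se_left f))) => hs.
  have [m [em ec]] := cat_eq_prefix (esym ea) hs.
  pose f1 := SquierEdge m (se_right f) (se_applicable f).
  exists a, (m ++ se_from f ++ se_right f), r, (f1 :: l); split=> //.
  - by rewrite eQ em -catA.
  - by split=> //; rewrite /squier_tgt /= -ec.
  - rewrite e1; move: er; rewrite /p1' ec.
    have -> : map (lift [::] (m ++ se_to f ++ se_right f)) r =
       map (lift [::] (se_to f ++ se_right f)) (map (lift [::] m) r) by rewrite maplift_lift.
    by move/(inj_map (@lift_inj_left _)) => ->; rewrite maplift_lift.
  by rewrite el /=; congr cons; apply: edge_ext; rewrite //= ?cats0.
have [m [em ec]] := cat_eq_prefix ea (ltnW hs).
exists (se_left f), (se_from f ++ se_right f), r0, (f0 :: map (lift m [::]) l); split=> //.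
- split=> //; rewrite /squier_tgt /= ec.
  by have := @valid_lift _ m [::] c l hl; rewrite cats0.
- by rewrite /= -ef maplift_lift el em.
Qed.

(** Bubble sort: a path crossing hyperplanes of [A] that follows an edge dual to one of [B] lies
    entirely on the left of this edge, so the two can be exchanged. *)
Lemma sort_path Q p (A B : hyperplane -> Prop) : valid (ev Q) p ->
  (forall h, h \in hyps Q p -> A h \/ B h) -> (forall h k, A h -> B k -> left_of h k) ->
  exists p1 p2, [/\ valid (ev Q) (p1 ++ p2), walk Q (p1 ++ p2) = walk Q p,
    forall h, h \in hyps Q p1 -> A h & forall h, h \in hyps (walk Q p1) p2 -> B h].
Proof.
move=> + + AB; elim: p Q => [|e p IH] Q; first by exists [::], [::].
move=> [he hp] H; set Q1 := walk Q [:: e]; have eQ1 : ev Q1 = tgt e by rewrite ev_walk1.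
have [||p1 [p2 [v w h1 h2]]] := IH Q1; first by rewrite eQ1.
  by move=> h hh; apply: H; rewrite /= inE hh orbT.
have wp : walk Q (e :: p) = walk Q1 p by rewrite (walk_cons he hp).
have [v1 v2] := proj1 (valid_cat _ _ _) v.
rewrite eQ1 in v v1 v2.
case: (H (hyp Q e)) => [|he'|he']; first by rewrite /= inE eqxx.
  exists (e :: p1), p2; split=> //.
  - by rewrite cat_cons (walk_cons he v) wp.
  - by move=> h /=; rewrite inE => /orP [/eqP ->|/h1].
  - by rewrite (walk_cons he v1).
have her : src (redge e) = ev Q1 by rewrite eQ1.
have [||r hr er] := @lift_of_left_of Q1 p1 (redge e) _ her; first by rewrite eQ1.
  by move=> h hh; rewrite hyp_rev //; apply: AB => //; apply: h1.
rewrite /= in er hr.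
pose e0 := SquierEdge [::] (se_right e) (se_applicable e).
have ee : e = lift (se_left e) [::] e0 by apply: edge_ext; rewrite /= ?cats0.
have eQ : ev Q = se_left e ++ (se_from e ++ se_right e) by rewrite -he.
have ve0 : valid (se_from e ++ se_right e) [:: e0] by [].
have sh := hyps_cut_shift eQ hr ve0; rewrite /= -ee in sh.
pose e1 := lift (endw (se_left e) r) [::] e0.
set p1' := map (lift [::] (se_from e ++ se_right e)) r.
have es : sump (se_left e) [::] (se_from e ++ se_right e) r [:: e0] = p1' ++ [:: e1].
  by rewrite /sump /= cats0.
have vs : valid (ev Q) (p1' ++ [:: e1]) by rewrite -es; apply: valid_cut.
have ws : walk Q (p1' ++ [:: e1]) = walk Q1 p1.
  rewrite -es er -(sump_l (se_left e)).
  have -> : Q1 = walk Q (sump (se_left e) [::] (se_from e ++ se_right e) [::] [:: e0]).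
    by rewrite sump_r /= -ee.
  by have := @walk_cut _ _ Q _ _ [::] [:: e0] r [::] eQ hr; rewrite cats0 => ->.
have vp2 : valid (endw (ev Q) (p1' ++ [:: e1])) p2.
  by rewrite -ev_walk // ws ev_walk eQ1.
have vv : valid (ev Q) ((p1' ++ [:: e1]) ++ p2) by apply/valid_cat.
have vp1' : valid (ev Q) p1' by move/valid_cat: vs => [].
exists p1', (e1 :: p2); rewrite -cat_rcons -cats1; split=> //.
- by rewrite -walk_cat // ws wp -w walk_cat ?eQ1.
- by move=> h; rewrite -sh -er; apply: h1.
have vl : valid (ev (walk Q p1')) [:: e1].
  by rewrite ev_walk //; move/valid_cat: vs => [].
have eh : hyp (walk Q p1') e1 = hyp Q e.
  have hp1 := @par_slide _ _ Q e r [::] hr I.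
  rewrite (hyp_par he hp1) /slide_path sump_mid sump_l; congr hyp.
  by apply: edge_ext; rewrite //= ?cats0.
move=> h; rewrite /= inE => /orP [/eqP ->|]; first by rewrite eh.
rewrite walk_cat //; first by rewrite ws; apply: h2.
by move: vl; rewrite ev_walk.
Qed.

(** The product of the two factors is convex in this sense: an edge at one of its vertices whose
    hyperplane crosses a factor belongs to that factor. *)
Lemma cut_follow Q a c p : ev Q = a ++ c -> valid (ev Q) p ->
  (forall h, h \in hyps Q p -> crossl Q a c h \/ crossr Q a c h) ->
  exists r l, [/\ valid a r, valid c l & walk Q p = walk Q (sump a [::] c r l)].
Proof.
move=> eQ; elim/last_ind: p => [|p e IH].
  by move=> _ _; exists [::], [::]; rewrite walk0.
move=> vpe H; have [vp he] := proj1 (valid_rcons _ _ _) vpe.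
rewrite -cats1 in vpe H *; rewrite hyps_cat // in H.
have [|r [l [hr hl ew]]] := IH vp; first by move=> h hh; apply: H; rewrite mem_cat hh.
rewrite -walk_cat //= ew; set R := walk Q _.
have eR : ev R = endw a r ++ endw c l by rewrite ev_cut.
have heR : src e = ev R by rewrite he -ev_walk // ew.
case: (H (hyp R e)); first by rewrite mem_cat /= inE ew eqxx orbT.
  move/(crossl_move eQ hr hl) => /(crossl_inside eR heR) [e0 he0 ->].
  exists (r ++ [:: e0]), l; split=> //; first by apply/valid_cat.
  have vr : valid a (r ++ [:: e0]) by apply/valid_cat.
  rewrite -{2}[l]cats0 -(@walk_cut _ _ Q a c r l [:: e0] [::]) ?cats0 //.
move/(crossr_move eQ hr hl) => /(crossr_inside eR heR) [e0 he0 ->].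
exists r, (l ++ [:: e0]); split=> //; first by apply/valid_cat.
have vr : valid c (l ++ [:: e0]) by apply/valid_cat.
rewrite -{2}[r]cats0 -(@walk_cut _ _ Q a c r l [::] [:: e0]) ?cats0 //.
by rewrite sump_r.
Qed.

Lemma hyps_rpath Q p h : valid (ev Q) p -> h \in hyps (walk Q p) (rpath p) -> h \in hyps Q p.
Proof.
elim/last_ind: p => // p e IH v; have [vp he] := proj1 (valid_rcons _ _ _) v.
rewrite -cats1 in v *; rewrite rpath_cat hyps_cat // mem_cat /=.
have he' : src e = ev (walk Q p) by rewrite ev_walk.
rewrite -walk_cat //= ?he' ?ev_walk // hyp_rev // walk_backtrack // !inE.
by case/orP => [->|/(IH vp) ->] //; rewrite orbT.
Qed.

(** At the turning point of the sorted path, the reversed first half and the second half satisfy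
    [split_cut_ex]. The cut obtained there is carried back to [Q] along the first half, which
    changes only the left part of the word. *)
Lemma part_cut Q p (A B : hyperplane -> Prop) : valid (ev Q) p ->
  (forall h, h \in hyps Q p -> A h \/ B h) -> (forall h k, A h -> B k -> left_of h k) ->
  exists a c, ev Q = a ++ c /\ forall h, delta h Q (walk Q p) <> 0%R ->
    (A h /\ crossl Q a c h) \/ (B h /\ crossr Q a c h).
Proof.
move=> hp H AB; have [p1 [p2 [v w h1 h2]]] := sort_path hp H AB.
have [v1 v2] := proj1 (valid_cat _ _ _) v; set R := walk Q p1.
have eR : ev R = endw (ev Q) p1 by rewrite ev_walk.
have vr : valid (ev R) (rpath p1) by rewrite eR; apply: valid_rpath.
have vp2 : valid (ev R) p2 by rewrite eR.
have [|a [c [r [l [ea hr hl er el]]]]] := split_cut_ex vr vp2.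
  by move=> h k /(hyps_rpath v1) /h1 Ah /h2; apply: AB.
have wr : walk R (rpath p1) = Q by rewrite walk_rpath.
rewrite er -(sump_l a) in wr.
have eQ : ev Q = endw a r ++ c by rewrite -[in LHS]wr ev_cut.
exists (endw a r), c; split=> // h /eqP; rewrite -w => dh.
have : h \in hyps Q (p1 ++ p2) by apply: contraR dh => /delta_notin -> //.
rewrite hyps_cat // mem_cat => /orP [hh|hh]; [left|right]; split; auto.
  have vrr := valid_rpath hr; have := endw_rpath hr => err.
  have e1 : p1 = map (lift [::] c) (rpath r) by rewrite -rpath_lift -er rpathK.
  by move: hh; rewrite e1; apply: hyps_cutl.
have := @crossr_move _ _ R a c h r [::] ea hr I; rewrite wr; apply.
by move: hh; rewrite el; apply: hyps_cutr.
Qed.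

Lemma sep_run g Q h (n : nat) : delta h Q (act (zexp g n) Q) <> 0%R ->
  exists2 j : nat, j < n & delta (act_hyp (zexp g (- j%:Z)%R) h) Q (act g Q) <> 0%R.
Proof.
move=> dh; apply: contrapT => H; apply: dh.
have := @delta_zexp_run _ _ g h Q n 0%R; rewrite zexp0 act1 GRing.add0r; apply=> j hj.
rewrite GRing.add0r; apply: contrapT => K; apply: H; by exists j.
Qed.

(** A word of length [l] has [l + 1] cuts, so two of the powers from 0 to [l + 1] end at the same
    cut; the power joining them preserves this cut and therefore splits. *)
Lemma cut_period g Q a c : ev Q = a ++ c ->
  (forall i : nat, i <= (size (ev Q)).+1 -> exists r l,
     [/\ valid a r, valid c l & act (zexp g i) Q = walk Q (sump a [::] c r l)]) ->
  exists2 n : nat, 0 < n & exists r l (g1 g2 : G), [/\ valid a r, valid c l,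
    lfix (walk Q (sump a [::] c r l)) (endw a r) (endw c l) g1,
    rfix (walk Q (sump a [::] c r l)) (endw a r) (endw c l) g2 & zexp g n = (g1 * g2)%g].
Proof.
move=> eQ H; set N := (size (ev Q)).+1 in H.
pose A (i : nat) (t : nat) := i <= N -> exists r l, [/\ valid a r, valid c l,
  act (zexp g i) Q = walk Q (sump a [::] c r l) & size (endw a r) = t].
have [i|i [j [t [ij]]]] := @pigeonhole_seq _ (iota 0 N) A.
  case: (leqP i N) => hi; last first.
    by exists 0; [rewrite mem_iota|move=> hi'; lia].
  have [r [l [hr hl ew]]] := H i hi; exists (size (endw a r)); last by exists r, l.
  have := congr1 (fun S => size (ev S)) ew; rewrite mem_iota /N /= ev_act ev_cut // size_cat.
  lia.
rewrite size_iota => jN /(_ (ltnW (leq_trans ij jN))) [r [l [hr hl ei ti]]].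
move=> /(_ jN) [r' [l' [hr' hl' ej tj]]].
exists (j - i); first by lia.
set Q' := walk Q (sump a [::] c r l) in ei *.
have eQ' : ev Q' = endw a r ++ endw c l by rewrite ev_cut.
have vr : valid (endw a r) (rpath r ++ r').
  by apply/valid_cat; rewrite endw_rpath //; split=> //; apply: valid_rpath.
have vl : valid (endw c l) (rpath l ++ l').
  by apply/valid_cat; rewrite endw_rpath //; split=> //; apply: valid_rpath.
have es : endw a r' ++ endw c l' = endw a r ++ endw c l.
  by rewrite -eQ' -(ev_cut eQ hr' hl') -ej -ei !ev_act.
have [m [em ec]] := cat_eq_prefix es (eq_leq (etrans tj (esym ti))).
have m0 : m = [::].
  by case: m em ec => // x m em _; move: (congr1 size em); rewrite size_cat /= ti tj; lia.
rewrite m0 cats0 in em; rewrite m0 /= in ec.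
have er : endw (endw a r) (rpath r ++ r') = endw a r by rewrite endw_cat endw_rpath.
have el : endw (endw c l) (rpath l ++ l') = endw c l by rewrite endw_cat endw_rpath.
have [g1 hg1] : exists g1, act g1 Q' = walk Q' (map (lift [::] (endw c l)) (rpath r ++ r')).
  by apply: act_trans; rewrite -(sump_l (endw a r)) ev_cut //= er.
have [g2 hg2] : exists g2, act g2 Q' = walk Q' (map (lift (endw a r) [::]) (rpath l ++ l')).
  by apply: act_trans; rewrite -(sump_r _ (endw c l)) ev_cut //= el.
exists r, l, g1, g2; split=> //.
- by split=> //; exists (rpath r ++ r').
- by split=> //; exists (rpath l ++ l').
apply: (@act_inj _ _ _ _ Q').
have v1 : valid a (r ++ rpath r ++ r') by apply/valid_cat.
have v2 : valid c (l ++ rpath l ++ l') by apply/valid_cat.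
rewrite (lfix_rfix_mul eQ' vr vl er hg1 hg2) /Q' (walk_cut eQ v1 v2) -/Q'.
have -> : act (zexp g (j - i)%N) Q' = act (zexp g j) Q.
  by rewrite -ei -actM -zexpD -PoszD subnK // ltnW.
rewrite ej; apply: (walk_cut_hom eQ) => //; rewrite catA.
  apply: hom_sym; apply: (@hom_catr _ _ r' _ [::]); first exact: hom_rpathr.
  by rewrite endw_cat endw_rpath.
apply: hom_sym; apply: (@hom_catr _ _ l' _ [::]); first exact: hom_rpathr.
by rewrite endw_cat endw_rpath.
Qed.

(** Since [Q] is on an axis, whatever separates [Q] from [g^i Q] with [i <= N] also separates it
    from [g^N Q]. One cut made for [N] thus serves all the powers that [cut_period] inspects. *)
Theorem mixed_split g (A B : hyperplane -> Prop) :
  (forall h, inH g h -> A h \/ B h) -> (forall h k, A h -> B k -> left_of h k) ->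
  (forall h i, A h -> A (act_hyp (zexp g i) h)) -> (forall h i, B h -> B (act_hyp (zexp g i) h)) ->
  exists2 n : nat, 0 < n & exists Q a c (g1 g2 : G),
    [/\ ev Q = a ++ c, lfix Q a c g1, rfix Q a c g2, zexp g n = (g1 * g2)%g &
      (forall h, inH g h -> A h -> exists i, crossl Q a c (act_hyp (zexp g i) h)) /\
      (forall h, inH g h -> B h -> exists i, crossr Q a c (act_hyp (zexp g i) h))].
Proof.
move=> H AB gA gB; have [Q ax] := axis_ex g; set N := (size (ev Q)).+1.
have long h (n : nat) : 0 < n -> n <= N -> delta h Q (act (zexp g n) Q) <> 0%R ->
    inH g h /\ delta h Q (act (zexp g N) Q) <> 0%R.
  move=> n0 nN /sep_run [j jn dj]; split.
    rewrite -[h](act_hypKV (zexp g j)) -zexpN; apply: inH_act; last exact: axis_inH dj.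
    exact/commute_sym/commute_zexp.
  have e : act (zexp g (N - j).-1.+1) Q = act (zexp g (- j%:Z)%R) (act (zexp g N) Q).
    by rewrite -actM -zexpD; congr (act (zexp g _) Q); lia.
  by have := @axis_delta _ _ g Q _ j (N - j).-1 ax dj; rewrite e delta_act => ->.
have [p [hp ep u]] := geodesic Q (act (zexp g N) Q).
have [|//|a [c [eQ Hc]]] := @part_cut Q p A B hp.
  move=> h; rewrite -delta_hyps // ep => /eqP /(long _ N isT (leqnn N)) [hh _].
  exact: H.
rewrite ep in Hc.
have [|n n0 [r [l [g1 [g2 [hr hl f1 f2 eg]]]]]] := @cut_period g Q a c eQ.
  move=> i hi; have [q [hq eq uq]] := geodesic Q (act (zexp g i) Q).
  have [|r [l]] := cut_follow eQ hq; last by rewrite eq; exists r, l.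
  move=> h; rewrite -delta_hyps // eq => /eqP dh.
  have i0 : 0 < i by case: i {hi eq} dh => //; rewrite zexp0 act1 delta_refl.
  by have [_ /Hc [[_ ?]|[_ ?]]] := long h i i0 hi dh; [left|right].
exists n => //; exists (walk Q (sump a [::] c r l)), (endw a r), (endw c l), g1, g2.
split=> //; first by rewrite ev_cut.
have cross h : inH g h -> exists i,
    (A (act_hyp (zexp g i) h) /\ crossl Q a c (act_hyp (zexp g i) h)) \/
    (B (act_hyp (zexp g i) h) /\ crossr Q a c (act_hyp (zexp g i) h)).
  move=> hh; have [i di] := inH_cross Q hh; exists i; apply: Hc.
  by apply: (long _ 1 _ _ _).2.
split=> h hh Sh; have [i [[Si ci]|[Si ci]]] := cross h hh; exists i.
- exact: crossl_move.
- by case: (@left_of_irr _ _ (act_hyp (zexp g i) h)); apply: AB => //; apply: gA.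
- by case: (@left_of_irr _ _ (act_hyp (zexp g i) h)); apply: AB => //; apply: gB.
- exact: crossr_move.
Qed.

End Mixed.

(** * Signs of hyperplanes *)

Definition cyclic_nb n (i u : 'I_n) : Prop := u = ordS i \/ i = ordS u.

Lemma cyclic_nb_sym n (i u : 'I_n) : cyclic_nb i u -> cyclic_nb u i.
Proof. by case; [right|left]. Qed.

(** All that the obstruction uses of the cycle group, stated for elements of an arbitrary group so
    that it passes through an isomorphism. [cg_cent] reflects the absence of triangles, [cg_cent2]
    that of squares, and [cg_indep] the fact that the two neighbours of a vertex are distinct and
    not adjacent. *)
Record cycle_generators (G : groupType) (n : nat) (X : 'I_n -> G) : Prop := {
  cg_comm : forall i u, cyclic_nb i u -> commute (X u) (X i);
  cg_free : forall i u k a, cyclic_nb i u ->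
    (zexp (X u) k * zexp (X i) a = 1)%g -> k = 0%R;
  cg_cent : forall i u k a g, cyclic_nb i u -> k <> 0%R -> a <> 0%R ->
    commute (zexp (X u) k) g -> commute (zexp (X i) a) g ->
    exists k' a', g = (zexp (X u) k' * zexp (X i) a')%g;
  cg_indep : forall v k a k' a', let i := ordS v in
    commute (zexp (X (ordS i)) k * zexp (X i) a)%g (zexp (X v) k' * zexp (X i) a')%g ->
    k = 0%R \/ k' = 0%R;
  cg_cent2 : forall v k a k' a' g, let i := ordS v in k <> 0%R -> k' <> 0%R ->
    commute g (zexp (X (ordS i)) k * zexp (X i) a)%g ->
    commute g (zexp (X v) k' * zexp (X i) a')%g -> exists b, g = zexp (X i) b }.

Section Signs.
Variables (P : semigroup_presentation) (w0 : seq (alphabet P)).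
Local Notation src := (@squier_src P).
Local Notation G := (@diagram_group P w0).
Local Notation cover := (@cover P w0).
Local Notation hyperplane := (@hyperplane P w0).
Implicit Types (Q R : cover) (h k : hyperplane) (g : G) (b : bool).

(** Some power of [g] crosses [k], and it moves a vertex next to [h] by a slide on the left of
    [h]. *)
Lemma lstab_inH h k g : lstab h g -> inH g k -> left_of k h.
Proof.
move=> [Q [e [he <- f]]] /(inH_delta Q) [i].
have [eQ [p [hp _ ->]]] := lfix_zexp i f => /eqP dk.
have es : map (lift [::] (se_from e ++ se_right e)) p = slide_path e p [::].
  by rewrite /slide_path sump_mid sump_l.
rewrite es in dk; apply: (hyps_slide_left he hp); apply: contraR dk => /delta_notin -> //.
by rewrite -he; apply: valid_slide.
Qed.

Lemma rstab_inH h k g : rstab h g -> inH g k -> left_of h k.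
Proof.
move=> [Q [e [he <- f]]] /(inH_delta Q) [i].
have [eQ [p [hp _ ->]]] := rfix_zexp i f => /eqP dk.
have es : map (lift (se_left e ++ se_from e) [::]) p = slide_path e [::] p.
  by rewrite /slide_path sump_mid' sump_r.
rewrite es in dk; apply: (hyps_slide_right he hp); apply: contraR dk => /delta_notin -> //.
by rewrite -he; apply: valid_slide.
Qed.

Definition sstab b h g := if b then lstab h g else rstab h g.
Definition side b k h := if b then left_of k h else left_of h k.

Lemma sstab_inH b h k g : sstab b h g -> inH g k -> side b k h.
Proof. by case: b; [apply: lstab_inH|apply: rstab_inH]. Qed.

Lemma sstab_side b h k g : side b k h -> sstab b k g -> sstab b h g.
Proof. by case: b; [apply: lstab_left_of|apply: rstab_left_of]. Qed.

Lemma sstab_fixes b h g : sstab b h g -> fixes g h.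
Proof. by case: b; [apply: lstab_act|apply: rstab_act]. Qed.

Lemma sstab_comm b h g (g' : G) : sstab b h g -> sstab (~~ b) h g' -> commute g g'.
Proof.
suff H (g1 g2 : G) : lstab h g1 -> rstab h g2 -> commute g1 g2.
  by case: b => h1 h2; [|apply/commute_sym]; apply: H.
by move=> [Q [e [he <- f]]]; apply: (lstab_rstab_comm he); apply/lstabE.
Qed.

Lemma sstab_zexp b h g i : sstab b h g -> sstab b h (zexp g i).
Proof.
case: b => -[Q [e [he eh f]]]; exists Q, e; split=> //.
  exact: lfix_zexp.
exact: rfix_zexp.
Qed.

Lemma sstab_conj b h g (k : G) : sstab b h g -> sstab b (act_hyp k h) (k * g * k^-1)%g.
Proof. by case: b; [apply: lstab_conj|apply: rstab_conj]. Qed.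

(** [true] means that only the left factor of the stabilizer can be nontrivial, [false] only the
    right one. *)
Definition signed b h := forall g, sstab (~~ b) h g -> g = 1%g.

Lemma signed_act b h (k : G) : signed b h -> signed b (act_hyp k h).
Proof.
move=> s g /(sstab_conj k^-1%g); rewrite act_hypK invgK => /s e.
by apply: (mulgI k^-1%g); apply: (mulIg k); rewrite e mulg1 mulVg.
Qed.

Lemma hyp_of_inH g h : inH g h -> exists Q e, src e = ev Q /\ hyp Q e = h.
Proof.
move=> /(inH_delta (base w0)) [i /eqP dh].
have [p [hp ep]] := walk_ex (base w0) (act (zexp g i) (base w0)).
have : h \in hyps (base w0) p by apply: contraR dh => /delta_notin; rewrite -ep => ->.
by case/(hyps_src hp) => p1 [e [p2 [_ _ he ->]]]; exists (walk (base w0) p1), e.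
Qed.

Lemma fixes_split g h : (exists Q e, src e = ev Q /\ hyp Q e = h) -> fixes g h ->
  exists g1 g2 : G, [/\ lstab h g1, rstab h g2, g = (g1 * g2)%g &
    forall y, commute y g -> exists2 m : nat, 0 < m & commute (zexp y m) g1].
Proof.
move=> [Q [e [he <-]]] /(stab_split he) [g1 [g2 [h1 h2 eg]]]; exists g1, g2; split=> //.
move=> z cz; apply: (@split_commute _ _ Q (se_left e) (se_from e ++ se_right e) g1 g2).
- exact/lstabE.
- by apply: rfix_widen; apply/rstabE.
- by rewrite -eg.
Qed.

Variables (n : nat) (X : 'I_n -> G).
Hypothesis hX : cycle_generators X.

Let E (u i : 'I_n) (k a : int) : G := (zexp (X u) k * zexp (X i) a)%g.

Lemma EM u i (k a k' a' : int) : cyclic_nb i u -> (E u i k a * E u i k' a')%g = E u i (k + k') (a + a').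
Proof.
move=> c; have cc := commute_zexp2 k' a (cg_comm hX c).
by rewrite /E !zexpD !mulgA -(mulgA _ _ (zexp (X u) k')) -cc !mulgA.
Qed.

Lemma E_zexp u i (k a m : int) : cyclic_nb i u -> zexp (E u i k a) m = E u i (k * m) (a * m).
Proof. by move=> c; rewrite /E zexpMg ?zexpM //; apply/commute_zexp2/(cg_comm hX). Qed.

Lemma E_comm u i (k a k' a' : int) : cyclic_nb i u -> commute (E u i k a) (E u i k' a').
Proof. by move=> c; rewrite /commute !EM // (GRing.addrC k) (GRing.addrC a). Qed.

Lemma E0 u i a : E u i 0 a = zexp (X i) a. Proof. by rewrite /E zexp0 mul1g. Qed.

Lemma EV u i (k a : int) : cyclic_nb i u -> (E u i k a)^-1%g = E u i (- k) (- a).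
Proof.
move=> c; apply: (mulgI (E u i k a)); rewrite mulgV EM // !GRing.subrr.
by rewrite /E !zexp0 mulg1.
Qed.

Lemma E_swap u i (k a : int) : cyclic_nb i u -> E u i k a = E i u a k.
Proof. by move=> c; apply/commute_zexp2/(cg_comm hX). Qed.

Definition based_signed b i h := forall u, cyclic_nb i u ->
  exists k a : int, k <> 0%R /\ sstab b h (E u i k a).

(** For each neighbour [u] of [i] some [X_u^k X_i^a] with [k] nonzero fixes [h], and its two factors
    are again of this form or trivial. Left factors commute with right factors while products over
    the two neighbours do not, so both elements lie on the same side. Whatever lies on the other
    side commutes with both, hence is a power of [X_i], and no nonzero power of [X_i] fixes [h]. *)
Lemma sign_ex v h : inH (X (ordS v)) h ->
  exists b, signed b h /\ based_signed b (ordS v) h.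
Proof.
set i := ordS v => hh; have [nf _] := hh.
have nbu : cyclic_nb i (ordS i) by left.
have nbv : cyclic_nb i v by right.
have he := hyp_of_inH hh.
have get u : cyclic_nb i u -> exists k a : int, [/\ k <> 0%R, E u i k a <> 1%g, fixes (E u i k a) h &
   exists g1 g2 : G, [/\ lstab h g1, rstab h g2, E u i k a = (g1 * g2)%g &
     (g1 = 1%g \/ exists k1 a1 : int, k1 <> 0%R /\ g1 = E u i k1 a1) /\
     (g2 = 1%g \/ exists k1 a1 : int, k1 <> 0%R /\ g2 = E u i k1 a1)]].
  move=> c; have [m m0 [a f]] := inH_orbit (cg_comm hX c) hh.
  exists (Posz m), a; split=> //; first by lia.
    by move=> /(cg_free hX c); lia.
  have [g1 [g2 [h1 h2 eg H]]] := fixes_split he f; exists g1, g2; split=> //.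
  have [m1 p1 c1] : exists2 m : nat, 0 < m & commute (zexp (X u) m) g1.
    by apply: H; have := @E_comm u i 1 0 (Posz m) a c; rewrite {1}/E zexp1 mulg1.
  have [m2 p2 c2] : exists2 m : nat, 0 < m & commute (zexp (X i) m) g1.
    by apply: H; have := @E_comm u i 0 1 (Posz m) a c; rewrite E0 zexp1.
  have [||k' [a' e1]] := cg_cent hX c _ _ c1 c2; try by lia.
  have e2 : g2 = E u i ((Posz m) - k')%R (a - a')%R.
    by rewrite -[g2](mulKg g1) -eg e1 -/(E u i k' a') EV // EM // !(GRing.addrC (- _)%R).
  have tr g (k1 a1 : int) : g = E u i k1 a1 -> fixes g h -> g = 1%g \/ exists k1 a1 : int, k1 <> 0%R /\ g = E u i k1 a1.
    case: (eqVneq k1 0%R) => [->|/eqP k0] eg1; last by right; exists k1, a1.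
    by rewrite eg1 E0 => /(nofix_zexp0 nf) ->; left.
  by split; [apply: (tr _ k' a' e1 (lstab_act h1))|apply: (tr _ _ _ e2 (rstab_act h2))].
have [k [a [k0 g0 _ [g1 [g2 [h1 h2 eg [t1 t2]]]]]]] := get _ nbu.
have [k' [a' [k0' g0' _ [g1' [g2' [h1' h2' eg' [t1' t2']]]]]]] := get _ nbv.
have excl (g : G) (g' : G) : (g = 1%g \/ exists k1 a1 : int, k1 <> 0%R /\ g = E (ordS i) i k1 a1) ->
  (g' = 1%g \/ exists k1 a1 : int, k1 <> 0%R /\ g' = E v i k1 a1) -> commute g g' -> g = 1%g \/ g' = 1%g.
  case=> [->|[k1 [a1 [n1 ->]]]]; first by left.
  case=> [->|[k2 [a2 [n2 ->]]]]; first by right.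
  by case/(cg_indep hX).
have c12 := @sstab_comm true h g1 g2' h1 h2'; have c21 := @sstab_comm false h g2 g1' h2 h1'.
have fin b : sstab b h (E (ordS i) i k a) -> sstab b h (E v i k' a') ->
    exists b, signed b h /\ based_signed b i h.
  move=> s s'; exists b; split.
    move=> g sg; have c1 := commute_sym (sstab_comm s sg); have c2 := commute_sym (sstab_comm s' sg).
    have [m em] := cg_cent2 hX k0 k0' c1 c2.
    by have := sstab_fixes sg; rewrite em => /(nofix_zexp0 nf) ->.
  move=> u; case=> [->|/(can_inj (@ordSK n)) <-]; first by exists k, a.
  by exists k', a'.
case: (pselect (g1 = 1%g)) => n1.
  have e2 : E (ordS i) i k a = g2 by rewrite eg n1 mul1g.
  case: (excl _ _ t2 t1' c21) => [z|e1']; first by case: g0; rewrite e2.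
  by apply: (fin false); rewrite /sstab ?e2 // eg' e1' mul1g.
case: (excl _ _ t1 t2' c12) => // e2'.
have e1' : E v i k' a' = g1' by rewrite eg' e2' mulg1.
case: (excl _ _ t2 t1' c21) => [e2|z]; last by case: g0'; rewrite e1'.
by apply: (fin true); rewrite /sstab ?e1' // eg e2 mulg1.
Qed.

Lemma E_inj0 u i (k a : int) : cyclic_nb i u -> E u i k a = 1%g -> k = 0%R.
Proof. by move=> c; apply: (cg_free hX). Qed.

Lemma signed_excl b u i h (k a : int) : cyclic_nb i u -> k <> 0%R ->
  signed (~~ b) h -> sstab b h (E u i k a) -> False.
Proof. by move=> c k0 s; rewrite -{1}[b]negbK => /s /(E_inj0 c). Qed.

(** Some [X_i^m g^j] with [m > 0] fixes the hyperplane. Up to factors fixing it, [X_i^m] is then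
    [g^-j], which settles the case of nonzero [j]; for [j = 0], [X_i^m] itself fixes it and
    [X_u^(k m)] is [g^m] up to such a factor. *)
Lemma inH_E u i h2 (k a : int) : cyclic_nb i u ->
  inH (E u i k a) h2 -> inH (X i) h2 \/ inH (X u) h2.
Proof.
move=> c hh; set g := E u i k a in hh.
have cg : commute (X i) g by have := @E_comm u i 0 1 k a c; rewrite E0 zexp1.
have [m m0 [j f]] := inH_orbit cg hh.
case: (eqVneq j 0%R) => [j0|/eqP j0].
  right; rewrite j0 zexp0 mulg1 in f.
  apply: (@inH_zexp_inv _ _ _ _ (k * (Posz m))%R).
  have -> : zexp (X u) (k * Posz m)%R = (zexp g (Posz m) * zexp (zexp (X i) (Posz m)) (- a)%R)%g.
    rewrite E_zexp // -zexpM -(E0 u i) // EM // GRing.addr0 (_ : (_ + _)%R = 0%R); last by lia.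
    by rewrite /E zexp0 mulg1.
  have cm : commute (zexp (X i) (Posz m)) g := commute_sym (commute_zexp _ (commute_sym cg)).
  apply: inH_fixes_mul; first exact: (commute_zexp2 (- a)%R (Posz m) cm).
    exact: fixes_zexp.
  by apply: inH_zexp => //; lia.
left; apply: (@inH_zexp_inv _ _ _ _ (Posz m)).
have -> : zexp (X i) (Posz m) = (zexp g (- j)%R * (zexp (X i) (Posz m) * zexp g j))%g.
  by rewrite (commute_zexp2 (Posz m) j cg) mulgA -zexpD GRing.addNr zexp0 mul1g.
have cm : commute (zexp g (- j)%R) (zexp (X i) (Posz m) * zexp g j)%g.
  apply: commuteM; first exact: (commute_zexp2 _ _ (commute_sym cg)).
  exact: (commute_zexp2 _ _ (commute_refl g)).
apply: (inH_fixes_mul (commute_sym cm)) => //.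
by apply: inH_zexp => //; lia.
Qed.

(** Let [g = X_u^k X_i^a] lie on the side [b] of [h], and let [h2] be transverse to [g], hence on
    that side of [h]. Were [h2] of sign [b] too, an element [X_u^k2 X_i^a2] on its side [b] would
    fix both [h2] and [h]. Eliminating [X_u] against [g] leaves a power of [X_i] fixing [h], which
    must be trivial; so the element shares a power with [g], and a power of [g] would fix [h2]. *)
Lemma based_opposite b v h : let i := ordS v in inH (X i) h -> signed b h ->
  exists h2, signed (~~ b) h2 /\ (inH (X i) h2 \/ inH (X (ordS i)) h2).
Proof.
move=> i hh s; set u := ordS i; have c : cyclic_nb i u by left.
have [b' [s' bs]] := sign_ex hh; have [k [a [k0 st]]] := bs _ c.
have eb : b' = b.
  apply/eqP; case: (eqVneq b' b) => // nb; exfalso.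
  by apply: (signed_excl c k0 _ st); move: s; case: b b' nb {bs st s'} => -[].
rewrite {}eb in st bs s'; set g := E u i k a in st.
have ng : g <> 1%g by move=> /(E_inj0 c).
have [h2 hg] := inH_ex ng; have sd := sstab_inH st hg.
exists h2; have loc := inH_E c hg; split=> //; have [nf _] := hh; have [nfg _] := hg.
have key (k2 a2 : int) : fixes (E u i k2 a2) h -> fixes (E u i k2 a2) h2 -> k2 = 0%R.
  move=> f f2; have : fixes (zexp (E u i k2 a2) k * zexp g (- k2)%R)%g h.
    by apply: fixesM; apply: fixes_zexp => //; apply: sstab_fixes st.
  rewrite !E_zexp // EM // (_ : (_ + _)%R = 0%R); last by lia.
  rewrite E0 => /(nofix_zexp0 nf) ez.
  have : fixes (zexp g k2) h2.
    have -> : zexp g k2 = zexp (E u i k2 a2) k by rewrite !E_zexp //; congr (E u i _ _); lia.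
    exact: fixes_zexp.
  by move/(nofix_zexp0 nfg).
case: loc => [hi|hu].
  have [b2 [s2 bs2]] := sign_ex hi; case: (eqVneq b2 b) => [eb|]; last by case: b b2 s2 {bs2 s s' bs st sd} => -[].
  rewrite eb in bs2; have [k2 [a2 [k20 st2]]] := bs2 _ c.
  case: k20; apply: (key k2 a2); last exact: sstab_fixes st2.
  exact/sstab_fixes/(sstab_side sd).
have [b2 [s2 bs2]] := sign_ex hu; case: (eqVneq b2 b) => [eb|]; last by case: b b2 s2 {bs2 s s' bs st sd} => -[].
rewrite eb in bs2; have [k2 [a2 [k20 st2]]] := bs2 _ (cyclic_nb_sym c).
have f2 := sstab_fixes st2; have f1 := sstab_fixes (sstab_side sd st2).
rewrite -E_swap // in f1 f2.
have a20 := key _ _ f1 f2; rewrite a20 E0 in f1.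
by case: k20; apply: nofix_zexp0 nf f1.
Qed.

(** Take [X_u^k X_i^a] on the left of [h] and [X_u^k2 X_i^a2] on the right of [h2]. If the exponents
    are proportional, a common power has a transverse hyperplane between [h2] and [h]. If not, a
    power of the first is, up to an element fixing [h2], a nonzero power of [X_i]; then [h2] is
    transverse to the first element and lies left of [h]. *)
Lemma signed_left_of v h h2 : let i := ordS v in inH (X i) h -> inH (X i) h2 ->
  signed true h -> signed false h2 -> left_of h2 h.
Proof.
move=> i hh hh2 s s2; set u := ordS i; have c : cyclic_nb i u by left.
have get b h3 : inH (X i) h3 -> signed b h3 -> exists k a : int, k <> 0%R /\ sstab b h3 (E u i k a).
  move=> h3h s3; have [b' [s' bs]] := sign_ex h3h; have [k [a [k0 st]]] := bs _ c.
  exists k, a; split=> //; case: (eqVneq b' b) => [<- //|nb]; exfalso.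
  by apply: (signed_excl c k0 _ st); move: s3; case: b b' nb {bs st s'} => -[].
have [k [a [k0 st]]] := get _ _ hh s; have [k2 [a2 [k20 st2]]] := get _ _ hh2 s2.
have f2 := sstab_fixes st2.
case: (eqVneq (a * k2 - a2 * k)%R 0%R) => [z|/eqP nz].
  have e : zexp (E u i k a) k2 = zexp (E u i k2 a2) k.
    by rewrite !E_zexp //; congr (E u i _ _); lia.
  have [h3 h3h] : exists h3, inH (zexp (E u i k a) k2) h3.
    by apply: inH_ex; rewrite E_zexp // => /(E_inj0 c); lia.
  have l1 := sstab_inH (sstab_zexp k2 st) h3h.
  rewrite e in h3h; have l2 := sstab_inH (sstab_zexp k st2) h3h.
  exact: left_of_trans l2 l1.
have : inH (E u i k a) h2; last exact: (sstab_inH st).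
apply: (@inH_zexp_inv _ _ _ _ k2).
have -> : zexp (E u i k a) k2 = (zexp (X i) (a * k2 - a2 * k)%R * zexp (E u i k2 a2) k)%g.
  by rewrite !E_zexp // -(E0 u i) // EM //; congr (E u i _ _); lia.
apply: inH_fixes_mul; [|exact: fixes_zexp|exact: inH_zexp].
by rewrite E_zexp // -(E0 u i) //; apply: E_comm.
Qed.

(** Otherwise some [X_i^m = g1 g2] splits at a cut, with sign [false] in the left factor and sign
    [true] in the right one. Powers of both neighbours commute with [g1], which makes [g1] a power
    of [X_i]; so [g1] or [g2] is a nonzero power of [X_i], and its hyperplanes all cross a single
    factor. *)
Lemma unmixed v h h2 : let i := ordS v in inH (X i) h -> inH (X i) h2 ->
  signed true h -> signed false h2 -> False.
Proof.
move=> i hh hh2 s s2; have c : cyclic_nb i (ordS i) by left.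
have c' : cyclic_nb i v by right.
pose A k := inH (X i) k /\ signed false k; pose B k := inH (X i) k /\ signed true k.
have gi k j : inH (X i) k -> inH (X i) (act_hyp (zexp (X i) j) k).
  by apply: inH_act; apply/commute_sym/commute_zexp.
have [||k j [hk sk]|k j [hk sk]|m m0 [Q [a [d [g1 [g2 [eQ f1 f2 eg [cA cB]]]]]]]] :=
  @mixed_split _ _ (X i) A B.
- by move=> k hk; have [[|] [sk _]] := sign_ex hk; [right|left].
- by move=> k k' [hk sk] [hk' sk']; apply: signed_left_of hk' hk sk' sk.
- by split; [apply: gi|apply: signed_act].
- by split; [apply: gi|apply: signed_act].
have com u : cyclic_nb i u -> exists2 j : nat, 0 < j & commute (zexp (X u) j) g1.
  by move=> cu; apply: (split_commute f1 f2); rewrite -eg; apply/commute_zexp/(cg_comm hX).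
have [j j0 cj] := com _ c; have [j' j0' cj'] := com _ c'.
have [||||p ep] := @cg_cent2 _ _ _ hX v (Posz j) 0%R (Posz j') 0%R g1; try by lia.
- by rewrite zexp0 mulg1; apply/commute_sym.
- by rewrite zexp0 mulg1; apply/commute_sym.
case: (eqVneq p 0%R) => [p0|/eqP p0].
  have [|t ct] := cA h2 hh2; first by split.
  apply: (crosslr_disj eQ ct); apply: (rfix_inH f2).
  have -> : g2 = zexp (X i) (Posz m) by rewrite eg ep p0 zexp0 mul1g.
  by apply: inH_zexp; [lia|apply: gi].
have [|t ct] := cB h hh; first by split.
apply: (crosslr_disj eQ _ ct); apply: (lfix_inH f1).
by rewrite ep; apply: inH_zexp => //; apply: gi.
Qed.

Theorem cycle_generators_even : 0 < n -> ~~ odd n.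
Proof.
move=> n0; pose S (v : 'I_n) := exists h, inH (X v) h /\ signed true h.
have ex v : exists h, inH (X v) h.
  apply: inH_ex => e1; have c : cyclic_nb (ordS v) v by right.
  by have := @E_inj0 v (ordS v) 1 0 c; rewrite /E zexp1 zexp0 mulg1 => /(_ e1).
have um v h h2 : inH (X v) h -> inH (X v) h2 -> signed true h -> signed false h2 -> False.
  by rewrite -[v](@ord_predK n); apply: unmixed.
have op b v h : inH (X v) h -> signed b h ->
    exists h2, signed (~~ b) h2 /\ (inH (X v) h2 \/ inH (X (ordS v)) h2).
  by rewrite -[v](@ord_predK n); apply: based_opposite.
(* By [op] both signs occur among the hyperplanes of [X v] and of its successor, and by [um] each of
   the two generators shows only one. *)
have step v : S (ordS v) <-> ~ S v.
  split.
    move=> [h [hh s]] [h' [hh' s']].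
    have [h2 [s2 [i2|i2]]] := op _ _ _ hh' s'; [exact: um hh' i2 s' s2|exact: um hh i2 s s2].
  move=> nS; have [h hh] := ex v.
  have s : signed false h.
    by move: (hh); rewrite -[v](@ord_predK n) => /sign_ex [[] [s _]] //; case: nS; exists h.
  have [h2 [s2 [i2|i2]]] := op _ _ _ hh s; last by exists h2.
  by case: nS; exists h2.
pose v0 := Ordinal n0.
have it (k : nat) : S (iter k (@ordS n) v0) <-> (if odd k then ~ S v0 else S v0).
  elim: k => // k IH; rewrite iterS /=; split.
    by move/step; case: (odd k) IH => /= IH H; [apply: contrapT => K|move=> K]; apply: H; apply/IH.
  by move=> H; apply/step => /IH; case: (odd k) H => /= H.
have vi (k : nat) : nat_of_ord (iter k (@ordS n) v0) = k %% n.
  elim: k => [|k IH]; first by rewrite mod0n.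
  by rewrite iterS /= IH -addn1 modnDml addn1.
have en : iter n (@ordS n) v0 = v0 by apply: val_inj; rewrite /= vi modnn.
apply/negP => on; have := it n; rewrite en on; tauto.
Qed.

End Signs.

Lemma fresh_nat (s : seq nat) : exists t, t \notin s.
Proof.
exists (sumn s).+1; apply/negP; suff H x : x \in s -> x <= sumn s by move/H; rewrite ltnn.
by elim: s => //= y s IH; rewrite inE => /orP [/eqP ->|/IH]; lia.
Qed.

Lemma filter0_in (S : eqType) (p : pred S) (K : seq S) :
  (forall z, z \in K -> ~ p z) -> filter p K = [::].
Proof.
move=> H; apply/eqP; rewrite -[_ == _]negbK -has_filter; apply/hasPn => z zK.
by apply/negP; apply: H.
Qed.

(** * Words in right-angled Artin groups *)

Section Matching.
Variables (X : eqType) (R : X -> X -> Prop).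
Hypothesis (Rsym : forall x y, R x y -> R y x) (Rirr : forall x, ~ R x x).
Local Notation letter := (X * bool)%type.
Local Notation tagged := ((X * bool) * nat)%type.
Implicit Types (s : letter) (t : nat) (x y z : tagged) (w : seq letter) (T L : seq tagged).

Definition bytag t x := x.2 == t.

Definition paired T := forall t, filter (bytag t) T = [::] \/
  exists s, filter (bytag t) T = [:: (s, t); (inv_letter s, t)].

Definition planar T := forall s s' s1 s1' t t', t <> t' ->
  subseq [:: (s, t); (s', t'); (s1, t); (s1', t')] T -> R s.1 s'.1.

(* The letters of a word representing [1] can be matched in inverse pairs (the
   two letters with the same tag) so that only commuting pairs cross. *)
Definition matched w := exists T, [/\ map fst T = w, paired T & planar T].

Lemma paired_gen T x y : paired T -> x \in T -> y \in T -> x.2 = y.2 -> x.1.1 = y.1.1.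
Proof.
move=> pT xT yT e.
have fx : x \in filter (bytag x.2) T by rewrite mem_filter /bytag eqxx.
have fy : y \in filter (bytag x.2) T by rewrite mem_filter /bytag e eqxx.
case: (pT x.2) fx fy => [->|[s ->]] //; rewrite !inE => /orP hx /orP hy.
by case: hx => /eqP ->; case: hy => /eqP ->.
Qed.

Lemma paired_size T t : paired T -> size (filter (bytag t) T) <= 2.
Proof. by move=> /(_ t) [->|[s ->]]. Qed.

Lemma matched_nil : matched [::].
Proof. by exists [::]; split=> //; left. Qed.

Lemma subseq_tbt (t b : nat) L L' : t \notin map snd L -> t \notin map snd L' -> b <> t ->
  subseq [:: t; b; t] (map snd L ++ [:: t; t] ++ map snd L') -> False.
Proof.
move=> + hL' bt; elim: L => [|x L IH] /=.
  move=> _; rewrite eqxx (_ : (b == t) = false); last exact/eqP.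
  move=> /mem_subseq /(_ t); rewrite !inE eqxx orbT => /(_ isT).
  by rewrite (negbTE hL').
by rewrite inE negb_or => /andP [/negbTE -> /IH].
Qed.

Lemma map_fst_cat T (w1 w2 : seq letter) : map fst T = w1 ++ w2 ->
  exists T1 T2, [/\ T = T1 ++ T2, map fst T1 = w1 & map fst T2 = w2].
Proof.
move=> e; exists (take (size w1) T), (drop (size w1) T); rewrite cat_take_drop.
by rewrite map_take map_drop e take_size_cat // drop_size_cat.
Qed.

Lemma map_fst_cons T s w : map fst T = s :: w ->
  exists t T', T = (s, t) :: T' /\ map fst T' = w.
Proof. by case: T => // [[s' t] T] /= [-> e]; exists t, T. Qed.

(** A fresh tag joins two neighbouring letters by an arc that crosses nothing. *)
Lemma matched_insert l s r : matched (l ++ r) -> matched (l ++ [:: s; inv_letter s] ++ r).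
Proof.
move=> [T [/map_fst_cat [L [L' [-> hl hr]]] pT plT]].
have [t] := fresh_nat (map snd (L ++ L')); rewrite map_cat mem_cat negb_or => /andP [tL tL'].
have fL K : t \notin map snd K -> filter (bytag t) K = [::].
  move=> tK; apply/eqP; rewrite -(negbK (_ == _)) -has_filter; apply/hasPn => x xK.
  by apply: contra tK => /eqP <-; apply: map_f.
exists (L ++ [:: (s, t); (inv_letter s, t)] ++ L'); split.
- by rewrite !map_cat hl hr.
- move=> u; rewrite !filter_cat /= /bytag /=; case: (eqVneq t u) => [<-|tu].
    by right; exists s; rewrite !fL.
  by rewrite /= -filter_cat; apply: pT.
move=> s1 s2 s3 s4 a b ab sub.
have tag : subseq [:: a; b; a; b] (map snd L ++ [:: t; t] ++ map snd L').
  by have := map_subseq snd sub; rewrite !map_cat.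
case: (eqVneq a t) => [ea|at'].
  exfalso; apply: (subseq_tbt tL tL' (_ : b <> t)); first by rewrite -ea; apply/nesym.
  by apply: subseq_trans tag; rewrite ea /= eqxx /= eqxx /= eqxx.
case: (eqVneq b t) => [eb|bt'].
  exfalso; apply: (subseq_tbt tL tL' (_ : a <> t)); first exact/eqP.
  by apply: subseq_trans tag; rewrite eb; apply: (@subseq_cons _ [:: t; a; t] a).
apply: plT ab _; have -> : L ++ L' = filter (predC (bytag t)) (L ++ [:: (s, t); (inv_letter s, t)] ++ L').
  rewrite !filter_cat /= /bytag /= eqxx /=; congr (_ ++ _); apply/esym/all_filterP/allP => x xL.
    by apply: contra tL => /eqP <-; apply: map_f.
  by apply: contra tL' => /eqP <-; apply: map_f.
by rewrite subseq_filter /= /bytag /= at' bt' /=; exact: sub.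
Qed.

(** The only crossing that can arise is between the arcs of the two exchanged letters, whose
    generators commute. *)
Lemma matched_swap l s s' r : R s.1 s'.1 -> matched (l ++ [:: s; s'] ++ r) ->
  matched (l ++ [:: s'; s] ++ r).
Proof.
move=> Rss [T [/map_fst_cat [L [L1 [eT hl]]] ]].
move=> /map_fst_cons [t [L2 [eL1]]] /map_fst_cons [t' [L' [eL2 hr]]] pT plT.
rewrite {}eL2 in eL1; rewrite {}eL1 in eT; set x := (s, t) in eT; set y := (s', t') in eT.
have xT : x \in T by rewrite eT mem_cat !inE eqxx orbT.
have yT : y \in T by rewrite eT mem_cat !inE eqxx !orbT.
have tt' : t <> t'.
  by move=> e; apply: (@Rirr s.1); rewrite {2}(paired_gen pT xT yT e).
have swapf q : ~~ (q x && q y) -> filter q (L ++ [:: y, x & L']) = filter q T.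
  by rewrite eT !filter_cat /=; case: (q x); case: (q y).
exists (L ++ [:: y, x & L']); split.
- by rewrite map_cat /= hl hr.
- move=> u; rewrite swapf //; apply/negP => /andP [/eqP e /eqP e'].
  by apply: tt'; rewrite -[t]/(x.2) e -e'.
move=> s1 s2 s3 s4 a b ab sub.
have inT K z : z \in K -> subseq K (L ++ [:: y, x & L']) -> z \in T.
  move=> zK /mem_subseq /(_ z zK); rewrite eT !mem_cat !inE.
  by case/orP => [->//|/or3P [] ->]; rewrite ?orbT.
have T1 : (s1, a) \in T by apply: (inT _ _ _ sub); rewrite inE eqxx.
have T2 : (s2, b) \in T by apply: (inT _ _ _ sub); rewrite !inE eqxx orbT.
pose q z := (z.2 == a) || (z.2 == b).
case: (boolP (q x && q y)) => [|/swapf ef]; last first.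
  apply: (plT s1 s2 s3 s4 a b ab); have : subseq [:: (s1, a); (s2, b); (s3, a); (s4, b)] (filter q T).
    by rewrite -ef subseq_filter sub /= /q /= !eqxx !orbT.
  by rewrite subseq_filter => /andP [].
rewrite /q /= => /andP [/orP [] /eqP ta /orP [] /eqP tb].
- by case: tt'; rewrite ta tb.
- by rewrite (paired_gen pT T1 xT (esym ta)) (paired_gen pT T2 yT (esym tb)).
- by rewrite (paired_gen pT T1 yT (esym tb)) (paired_gen pT T2 xT (esym ta)); apply: Rsym.
- by case: tt'; rewrite ta tb.
Qed.

Lemma subseq_map_inv (S S' : eqType) (f : S -> S') (K : seq S) (B : seq S') :
  subseq B (map f K) -> exists2 A, subseq A K & map f A = B.
Proof.
move=> /subseqP [m hm ->]; exists (mask m K); first exact: mask_subseq.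
by rewrite map_mask.
Qed.

Lemma planar_tags T a b x y : paired T -> planar T -> a <> b ->
  subseq [:: a; b; a; b] (map snd T) -> x \in T -> y \in T -> x.2 = a -> y.2 = b ->
  R x.1.1 y.1.1.
Proof.
move=> pT plT ab /subseq_map_inv [[|[s1 a1] [|[s2 b2] [|[s3 a3] [|[s4 b4] [|]]]]] sub //].
move=> [e1 e2 e3 e4] xT yT xa yb; rewrite {}e1 {}e2 {}e3 {}e4 in sub.
have H := plT _ _ _ _ _ _ ab sub.
have T1 : (s1, a) \in T by apply: (mem_subseq sub); rewrite inE eqxx.
have T2 : (s2, b) \in T by apply: (mem_subseq sub); rewrite !inE eqxx orbT.
by rewrite (paired_gen pT xT T1 xa) (paired_gen pT yT T2 yb).
Qed.

(** An arc [b] that crosses the arc obtained by joining the arcs [t] and [t0] at two adjacent ends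
    already crosses one of them. [A] is the order in which [b] and the two remaining ends occur; [W]
    puts the removed ends back. *)
Lemma cross_insert (t t0 b : nat) (A : seq nat) : t <> t0 -> b <> t -> b <> t0 ->
  A \in [:: [:: t; b; t0; b]; [:: t0; b; t; b]; [:: b; t; b; t0]; [:: b; t0; b; t]] ->
  forall A1 A2, A = A1 ++ A2 -> let W := A1 ++ [:: t; t0] ++ A2 in
  exists2 c, (c = t \/ c = t0) & subseq [:: c; b; c; b] W \/ subseq [:: b; c; b; c] W.
Proof.
move=> /eqP /negbTE n1 /eqP /negbTE n2 /eqP /negbTE n3.
have n4 : (t0 == t) = false by rewrite eq_sym.
have n5 : (t == b) = false by rewrite eq_sym.
have n6 : (t0 == b) = false by rewrite eq_sym.
pose N := (eqxx, n1, n2, n3, n4, n5, n6); rewrite !inE.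
have go (c1 c2 c3 c4 : nat) (Q : seq nat -> seq nat -> Prop) :
    Q [::] [:: c1; c2; c3; c4] -> Q [:: c1] [:: c2; c3; c4] -> Q [:: c1; c2] [:: c3; c4] ->
    Q [:: c1; c2; c3] [:: c4] -> Q [:: c1; c2; c3; c4] [::] ->
    forall A1 A2, [:: c1; c2; c3; c4] = A1 ++ A2 -> Q A1 A2.
  move=> q0 q1 q2 q3 q4 [|? [|? [|? [|? [|? A1]]]]] A2 //=.
  - by move=> <-.
  - by case=> <- <-.
  - by case=> <- <- <-.
  - by case=> <- <- <- <-.
  - by case=> <- <- <- <- <-.
by move=> /or4P [] /eqP -> /=; apply: go; rewrite /=;
  (by exists t; [left|left; rewrite !N]) || (by exists t; [left|right; rewrite !N]) ||
  (by exists t0; [right|left; rewrite !N]) || (by exists t0; [right|right; rewrite !N]).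
Qed.

Lemma subseq_cat_inv (S : eqType) (A L L' : seq S) : subseq A (L ++ L') ->
  exists A1 A2, [/\ A = A1 ++ A2, subseq A1 L & subseq A2 L'].
Proof.
move=> /subseqP [m hm ->]; exists (mask (take (size L) m) L), (mask (drop (size L) m) L').
rewrite -{1}[m](cat_take_drop (size L)) mask_cat; last first.
  by rewrite size_takel // hm size_cat leq_addr.
by rewrite !mask_subseq.
Qed.

Lemma two_tags t t0 (M : seq tagged) a b : t <> t0 -> all (fun z => bytag t z || bytag t0 z) M ->
  filter (bytag t) M = [:: a] -> filter (bytag t0) M = [:: b] -> M = [:: a; b] \/ M = [:: b; a].
Proof.
move=> /eqP n aM ft ft0.
have : size M = 2.
  rewrite -(count_predC (bytag t)) -size_filter ft /= -[1 in RHS]/(size [:: b]) -ft0 size_filter.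
  congr _.+1; apply: eq_in_count => z /(allP aM); rewrite /bytag /=.
  by case: (eqVneq z.2 t) => [->|] //=; rewrite (negbTE n).
case: M aM ft ft0 => [|x [|y [|]]] //= /and3P [hx hy _] + + _.
move: hx hy; rewrite /bytag; case: (eqVneq x.2 t) => [->|xt]; case: (eqVneq y.2 t) => [->|yt] //=.
- by rewrite (negbTE n) => _ /eqP -> [->]; rewrite eqxx => -[->]; left.
- by move=> /eqP -> _; rewrite eqxx (negbTE n) => -[->] [->]; right.
Qed.

(** Either the two letters are matched with each other and their arc disappears, or their partners,
    which are inverse to each other, are joined into one arc by renaming the tag [t0] to [t]. By
    [cross_insert] the new arc crosses only what one of the old ones crossed. *)
Lemma matched_delete l s r : matched (l ++ [:: s; inv_letter s] ++ r) -> matched (l ++ r).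
Proof.
move=> [T [/map_fst_cat [L [L1 [eT hl]] ]]].
move=> /map_fst_cons [t [L2 [eL1]]] /map_fst_cons [t0 [L' [eL2 hr]]] pT plT.
rewrite {}eL2 in eL1; rewrite {}eL1 in eT; set x := (s, t) in eT; set y := (_, t0) in eT.
have ft u : filter (bytag u) T = filter (bytag u) L ++
    (if t == u then [:: x] else [::]) ++ (if t0 == u then [:: y] else [::]) ++ filter (bytag u) L'.
  by rewrite eT filter_cat /= /bytag /=; case: (t == u); case: (t0 == u).
have sT K : subseq K (L ++ L') -> subseq K T.
  move=> h; apply: subseq_trans h _; rewrite eT; apply: cat_subseq => //.
  exact: (@suffix_subseq _ [:: x; y]).
case: (eqVneq t t0) => [e|n].
  exists (L ++ L'); split; first by rewrite map_cat hl hr.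
    move=> u; rewrite filter_cat; case: (pT u); rewrite ft -e; case: (t == u) => //=.
    - by case: filter.
    - by move=> ->; left.
    - by case=> v; case: (filter _ L) => [|? [|? K]] /=; [by case: filter => //; left|by []|by case: K].
    - by move=> ?; right.
  by move=> s1 s2 s3 s4 a b ab /sT; apply: plT.
have xT : x \in T by rewrite eT mem_cat !inE eqxx orbT.
have yT : y \in T by rewrite eT mem_cat !inE eqxx !orbT.
pose f (z : tagged) := if z.2 == t0 then (z.1, t) else z.
have fst_f K : map fst (map f K) = map fst K.
  by rewrite -map_comp; apply: eq_map => -[z u]; rewrite /f /=; case: (u == t0).
have n' : t <> t0 by apply/eqP.
have kt : filter (bytag t) (L ++ L') = [:: (inv_letter s, t)].
  have := pT t; rewrite ft eqxx eq_sym (negbTE n) /= filter_cat; case=> [|[s1]].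
    by case: filter.
  case: (filter _ L) => [|z [|z' K]] /=.
  - by case=> -> ->.
  - move=> H; have es := congr1 (fun K => (nth z K 0).1) H; have e1 := congr1 (fun K => (nth z K 1).1) H.
    have ez := congr1 (nth z ^~ 0) H; have eK := congr1 (drop 2) H.
    by rewrite /= ?drop0 in es e1 ez eK; rewrite eK ez e1 inv_letterK.
  - by case: K.
have kt0 : filter (bytag t0) (L ++ L') = [:: (s, t0)].
  have := pT t0; rewrite ft eqxx (negbTE n) /= filter_cat; case=> [|[s1]].
    by case: filter.
  case: (filter _ L) => [|z [|z' K]] /=.
  - by case=> <- ->; rewrite inv_letterK.
  - move=> H; have /(can_inj (@inv_letterK X)) e1 := congr1 (fun K => (nth z K 1).1) H.
    have ez := congr1 (nth z ^~ 0) H; have eK := congr1 (drop 2) H.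
    by rewrite /= ?drop0 in e1 ez eK; rewrite eK ez -e1.
  - by case: K.
exists (map f (L ++ L')); split; first by rewrite fst_f map_cat hl hr.
  move=> u; rewrite filter_map; case: (eqVneq u t) => [->|ut].
    right; set M := filter _ _.
    have aM : all (fun z => bytag t z || bytag t0 z) M.
      apply/allP => z; rewrite mem_filter /= /bytag /f => /andP [+ _].
      by case: (z.2 == t0); rewrite ?orbT ?orbF.
    have sub v : (v == t) || (v == t0) -> filter (bytag v) M = filter (bytag v) (L ++ L').
      move=> hv; rewrite -filter_predI; apply: eq_filter => z; rewrite /= /bytag /f.
      case: (eqVneq z.2 v) => [ez|] //=; case: ifP => /= [|e0]; rewrite ?eqxx //.
      by rewrite ez; case/orP: hv => // ev; rewrite ez ev in e0.
    have := two_tags n' aM; rewrite !sub ?eqxx ?orbT // kt kt0 => /(_ _ _ erefl erefl).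
    case=> ->; [exists (inv_letter s)|exists s]; rewrite /= /f /= !eqxx (negbTE n) //.
    by rewrite inv_letterK.
  case: (eqVneq u t0) => [->|ut0].
    left; apply/eqP; rewrite -[_ == _]negbK; apply/negP => H; move: H.
    rewrite -size_eq0 size_map size_filter -lt0n -has_count => /hasP [z _] /=.
    by rewrite /bytag /f; case: (eqVneq z.2 t0) => [_|/negbTE ->] //=; rewrite (negbTE n).
  have e1 : filter (preim f (bytag u)) (L ++ L') = filter (bytag u) (L ++ L').
    apply: eq_filter => z; rewrite /= /bytag /f; case: (eqVneq z.2 t0) => [->|] //=.
    by rewrite eq_sym (negbTE ut) eq_sym (negbTE ut0).
  have e2 : filter (bytag u) (L ++ L') = filter (bytag u) T.
    by rewrite ft !(eq_sym _ u) (negbTE ut) (negbTE ut0) filter_cat.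
  have e3 : map f (filter (bytag u) T) = filter (bytag u) T.
    apply: map_id_in => z; rewrite mem_filter /bytag /f => /andP [/eqP -> _].
    by rewrite (negbTE ut0).
  by rewrite e1 e2 e3; apply: pT.
move=> s1 s2 s3 s4 a b ab /subseq_map_inv [P sP eP].
have tagf (z : tagged) : (f z).2 = if z.2 == t0 then t else z.2 by rewrite /f; case: (z.2 == t0).
have inK z : z \in P -> z \in T by move=> /(mem_subseq (sT _ sP)).
have count1 v : v = t \/ v = t0 -> size (filter (bytag v) P) <= 1.
  move=> hv; have : subseq (filter (bytag v) P) (filter (bytag v) (L ++ L')).
    rewrite subseq_filter filter_all /=; apply: subseq_trans sP; exact: filter_subseq.
  by move=> /size_subseq; case: hv => ->; rewrite ?kt ?kt0.
have fin v z : v <> t -> v <> t0 -> z \in T -> z.2 = v ->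
    map snd P \in [:: [:: t; v; t0; v]; [:: t0; v; t; v]; [:: v; t; v; t0]; [:: v; t0; v; t]] ->
    R s.1 z.1.1.
  move=> v1 v2 zT zv hP; have [P1 [P2 [eq sP1 sP2]]] := subseq_cat_inv sP.
  have [|c hc sc] := @cross_insert t t0 v _ n' v1 v2 hP (map snd P1) (map snd P2).
    by rewrite eq map_cat.
  have sW : subseq (map snd P1 ++ [:: t; t0] ++ map snd P2) (map snd T).
    rewrite eT map_cat; apply: cat_subseq; first exact: map_subseq.
    by apply: (@cat_subseq _ [:: t; t0] _ [:: t; t0]) => //; apply: map_subseq.
  have [u uT [uc us]] : exists2 u, u \in T & u.2 = c /\ u.1.1 = s.1.
    by case: hc => ->; [exists x|exists y].
  have cv : c <> v by case: hc => ->; apply/nesym.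
  rewrite -us; case: sc => sc.
    by apply: (planar_tags pT plT cv (subseq_trans sc sW)).
  by apply/Rsym/(planar_tags pT plT (nesym cv) (subseq_trans sc sW)).
have gx z v : z \in T -> f z = (v, t) -> v.1 = s.1 /\ (z.2 = t \/ z.2 = t0).
  move=> zT; rewrite /f; case: (eqVneq z.2 t0) => [e|_].
    by case=> <-; split; [rewrite (paired_gen pT zT yT e)|right].
  by move=> e; rewrite e in zT *; split; [rewrite (paired_gen pT zT xT)|left].
have gz z v c : f z = (v, c) -> c <> t -> [/\ z.2 = c, z.1 = v & c <> t0].
  rewrite /f; case: (eqVneq z.2 t0) => [e [_ <-] //|/eqP e ez] _.
  by rewrite ez in e *.
case: P eP sP inK count1 fin => [|z1 [|z2 [|z3 [|z4 [|]]]]] //= [f1 f2 f3 f4] sP inK count1 fin.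
have [I1 I2 I3 I4] : [/\ z1 \in T, z2 \in T, z3 \in T & z4 \in T].
  by split; apply: inK; rewrite !inE eqxx ?orbT.
case: (eqVneq a t) => [ea|/eqP at'].
  rewrite ea in f1 f3 ab; have bt := nesym ab.
  have [g1 h1] := gx _ _ I1 f1; have [g3 h3] := gx _ _ I3 f3.
  have [e2 es2 b0] := gz _ _ _ f2 bt; have [e4 _ _] := gz _ _ _ f4 bt.
  rewrite g1 -es2; apply: (fin b z2) => //; rewrite e2 e4.
  case: h1 h3 => e1 [] e3; rewrite e1 e3 ?inE ?eqxx ?orbT //.
    by move: (count1 t (or_introl erefl)); rewrite /= /bytag e1 e3 !eqxx /=; case: ifP; case: ifP.
  by move: (count1 t0 (or_intror erefl)); rewrite /= /bytag e1 e3 !eqxx /=; case: ifP; case: ifP.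
have [e1 es1 a0] := gz _ _ _ f1 at'; have [e3 _ _] := gz _ _ _ f3 at'.
case: (eqVneq b t) => [eb|/eqP bt].
  rewrite eb in f2 f4.
  have [g2 h2] := gx _ _ I2 f2; have [g4 h4] := gx _ _ I4 f4.
  rewrite g2 -es1; apply/Rsym; apply: (fin a z1) => //; rewrite e1 e3.
  case: h2 h4 => e2 [] e4; rewrite e2 e4 ?inE ?eqxx ?orbT //.
    by move: (count1 t (or_introl erefl)); rewrite /= /bytag e2 e4 !eqxx /=; case: ifP; case: ifP.
  by move: (count1 t0 (or_intror erefl)); rewrite /= /bytag e2 e4 !eqxx /=; case: ifP; case: ifP.
have [e2 es2 _] := gz _ _ _ f2 bt; have [e4 _ _] := gz _ _ _ f4 bt.
rewrite -es1 -es2; apply: (planar_tags pT plT ab _ I1 I2 e1 e2).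
by have := map_subseq snd (sT _ sP); rewrite /= e1 e2 e3 e4.
Qed.

Lemma planar_split T T1 T2 T3 T4 T5 a b c d : paired T -> planar T ->
  T = T1 ++ a :: T2 ++ b :: T3 ++ c :: T4 ++ d :: T5 ->
  a.2 = c.2 -> b.2 = d.2 -> a.2 <> b.2 -> R a.1.1 b.1.1.
Proof.
move=> pT plT eT ac bd ab; apply: (planar_tags pT plT ab) => //.
- rewrite {2}ac {2}bd eT !map_cat /= !map_cat /= !map_cat /= !map_cat /=.
  apply: (@cat_subseq _ [::]); first exact: sub0seq.
  apply: (@cat_subseq _ [:: a.2] [:: b.2; c.2; d.2] [:: a.2]); first by rewrite /= eqxx.
  apply: (@cat_subseq _ [::]); first exact: sub0seq.
  apply: (@cat_subseq _ [:: b.2] [:: c.2; d.2] [:: b.2]); first by rewrite /= eqxx.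
  apply: (@cat_subseq _ [::]); first exact: sub0seq.
  apply: (@cat_subseq _ [:: c.2] [:: d.2] [:: c.2]); first by rewrite /= eqxx.
  apply: (@cat_subseq _ [::]); first exact: sub0seq.
  by rewrite /= eqxx sub0seq.
- by rewrite eT mem_cat !inE eqxx orbT.
- by rewrite eT mem_cat !inE mem_cat !inE eqxx !orbT.
Qed.

Lemma partner T U z V : paired T -> T = U ++ z :: V ->
  exists z', [/\ z'.2 = z.2, z'.1 = inv_letter z.1, z' \in U \/ z' \in V &
    forall y, y \in U \/ y \in V -> y.2 = z.2 -> y = z'].
Proof.
move=> pT eT; have fU K y : y \in filter (bytag z.2) K -> y \in K /\ y.2 = z.2.
  by rewrite mem_filter => /andP [/eqP].
have inK K y : y \in K -> y.2 = z.2 -> y \in filter (bytag z.2) K.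
  by rewrite mem_filter /bytag => -> ->; rewrite eqxx.
have := pT z.2; rewrite eT filter_cat /= /bytag eqxx -/(bytag _); case=> [|[s]].
  by case: filter.
case EU : (filter _ U) => [|x [|x' K]] /=.
- case=> ez EV; have z1 : z.1 = s by rewrite ez.
  have [|hV _] := fU V (inv_letter s, z.2); first by rewrite EV inE eqxx.
  exists (inv_letter s, z.2); rewrite z1; split=> //; first by right.
  move=> y [hy|hy] e; first by have := inK _ _ hy e; rewrite EU.
  by have := inK _ _ hy e; rewrite EV inE => /eqP.
- move=> H; have ex := congr1 (nth z ^~ 0) H; have ez := congr1 (fun K => (nth z K 1).1) H.
  have EV : filter (bytag z.2) V = [::] by have := congr1 (drop 2) H; rewrite /= drop0.
  rewrite /= in ex ez; exists x; rewrite ex /= ez inv_letterK.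
  have [hU _] : x \in U /\ x.2 = z.2 by apply: fU; rewrite EU inE eqxx.
  split=> //; first by left; rewrite -ex.
  move=> y [hy|hy] e; last by have := inK _ _ hy e; rewrite EV.
  by have := inK _ _ hy e; rewrite EU inE ex => /eqP.
by case: K EU.
Qed.

Definition bygen (v : X) x := x.1.1 == v.

Lemma paired_filter_gen T v : paired T -> paired (filter (bygen v) T).
Proof.
move=> pT u; case: (pselect (exists2 z, z \in T & z.1.1 = v /\ z.2 = u)) => [[z zT [gz tz]]|H].
  rewrite (_ : filter _ _ = filter (bytag u) T); first exact: pT.
  rewrite -filter_predI; apply: eq_in_filter => y yT; rewrite /= /bytag /bygen.
  case: (eqVneq y.2 u) => //= e; apply/eqP; rewrite -gz.
  by apply: (paired_gen pT yT zT); rewrite e.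
left; apply: filter0_in => z; rewrite mem_filter => /andP [/eqP gz zT] /eqP tz.
by apply: H; exists z.
Qed.

(** An arc over [v] leaving the interval would cross the arc from [a] to [a'], whose generator is
    not adjacent to [v]. *)
Lemma paired_under_arc T (A I C : seq tagged) a a' v : paired T -> planar T ->
  T = A ++ a :: I ++ a' :: C -> a.2 = a'.2 -> ~ R v a.1.1 -> paired (filter (bygen v) I).
Proof.
move=> pT plT eT a2 nR u.
case: (pselect (exists2 z, z \in I & z.1.1 = v /\ z.2 = u)) => [[z zI [gz <-]]|H]; last first.
  left; apply: filter0_in => z; rewrite mem_filter => /andP [/eqP gz zI] /eqP tz.
  by apply: H; exists z.
have [I1 [I2 eI]] : exists I1 I2, I = I1 ++ z :: I2.
  by case/splitPr: zI => K1 K2; exists K1, K2.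
have inT y : y \in I -> y \in T by move=> yI; rewrite eT mem_cat in_cons mem_cat yI !orbT.
have az : a.2 <> z.2.
  move=> e; have := paired_size a.2 pT; rewrite size_filter eT eI.
  have [b1 b2 b3] : [/\ bytag a.2 a, bytag a.2 z & bytag a.2 a'] by rewrite /bytag -a2 e eqxx.
  by rewrite !count_cat /= !count_cat /= b1 b2 b3; lia.
have fT : filter (bytag z.2) T = filter (bytag z.2) (filter (bygen v) I).
  have fcons y K : y.2 <> z.2 -> filter (bytag z.2) (y :: K) = filter (bytag z.2) K.
    by rewrite /= /bytag; case: eqP.
  rewrite eT filter_cat fcons // filter_cat fcons -?a2 //.
  rewrite (_ : filter _ A = [::]) /=; last first.
    apply: filter0_in => y /splitPr h /eqP ty; case: h eT => K1 K2 eT.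
    have := planar_split pT plT (T1 := K1) (T2 := K2) (T3 := I1) (T4 := I2) (a := y) (b := a)
      (c := z) (d := a') (T5 := C) _ ty a2.
    rewrite (_ : y.1.1 = v); last first.
      by rewrite -gz; apply: (paired_gen pT _ (inT z zI) ty); rewrite eT -catA mem_cat inE eqxx orbT.
    move=> H; apply/nR/H; last by rewrite ty; apply/nesym.
    by rewrite eT eI !(cat_cons, =^~ catA).
  rewrite (_ : filter _ C = [::]) ?cats0; last first.
    apply: filter0_in => y /splitPr; case e4: _ / => [K1 K2] /eqP ty.
    have := planar_split pT plT (T1 := A) (T2 := I1) (T3 := I2) (T4 := K1) (a := a) (b := z)
      (c := a') (d := y) (T5 := K2) _ a2 (esym ty) az.
    by rewrite gz => H; apply/nR/Rsym/H; rewrite eT eI e4 !(cat_cons, =^~ catA).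
  rewrite -filter_predI; apply: eq_in_filter => y yI; rewrite /= /bytag /bygen.
  case: (eqVneq y.2 z.2) => //= e; apply/esym/eqP; rewrite -gz.
  exact: (paired_gen pT (inT y yI) (inT z zI)).
by rewrite -fT; apply: pT.
Qed.

Lemma planar_subseq T L : planar T -> subseq L T -> planar L.
Proof. by move=> plT sL s s' s1 s1' t t' tt' sub; apply: plT tt' (subseq_trans sub sL). Qed.

(** Arcs over a single generator cannot cross, no generator being adjacent to itself; so an arc that
    encloses a letter encloses a whole arc. *)
Lemma innermost_arc L v : paired L -> planar L -> (forall z, z \in L -> z.1.1 = v) -> L <> [::] ->
  exists L1 a a' L2, [/\ L = L1 ++ a :: a' :: L2, a.2 = a'.2 & a'.1 = inv_letter a.1].
Proof.
have [n] := ubnP (size L); elim: n L => // n IH [|a L] //= hs pL plL gL _.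
have [a' [a2 a1 hz _]] := partner pL (erefl _ : a :: L = [::] ++ a :: L).
have [M [N eL]] : exists M N, L = M ++ a' :: N.
  by case: hz => // /splitPr [M N]; exists M, N.
case: M eL => [|b M] eL; first by exists [::], a, a', N; rewrite eL.
set K := b :: M in eL; have sK : subseq K (a :: L).
  by apply: subseq_trans (subseq_cons _ _); rewrite eL; apply: prefix_subseq.
have gK z : z \in K -> z.1.1 = v by move/(mem_subseq sK); apply: gL.
have pK : paired K.
  have := @paired_under_arc _ [::] K N a a' v pL plL _ (esym a2) _.
  rewrite (all_filterP _); last by apply/allP => z /gK /eqP.
  apply; first by rewrite eL.
  by rewrite gL ?inE ?eqxx //; apply: Rirr.
have [||L1 [c [c' [L2 [eK c2 c1]]]]] := IH K _ pK (planar_subseq plL sK) gK.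
- by move: hs; rewrite eL size_cat /=; lia.
- by [].
by exists (a :: L1), c, c', (L2 ++ a' :: N); split=> //; rewrite eL eK /= -catA.
Qed.

End Matching.

Lemma split_last (T : Type) (p : pred T) s : has p s ->
  exists s1 x s2, [/\ s = s1 ++ x :: s2, p x & ~~ has p s2].
Proof.
elim/last_ind: s => // s x IH; rewrite has_rcons.
case: (boolP (p x)) => [px _|np /= /IH [s1 [y [s2 [-> py ns]]]]].
  by exists s, x, [::]; rewrite cats1.
exists s1, y, (rcons s2 x); split=> //; first by rewrite rcons_cat.
by rewrite has_rcons negb_or np.
Qed.

Lemma split_first_uniq (T : Type) (p : pred T) s1 x s2 s1' x' s2' : s1 ++ x :: s2 = s1' ++ x' :: s2' ->
  p x -> p x' -> ~~ has p s1 -> ~~ has p s1' -> s1 = s1'.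
Proof.
elim: s1 s1' => [|y s1 IH] [|y' s1'] //=.
- by case=> -> _ px _ _; rewrite px.
- by case=> -> _ _ px; rewrite px.
- by case=> <- e px px'; rewrite !negb_or => /andP [_ n1] /andP [_ n2]; rewrite (IH s1').
Qed.

(** * Elements of a right-angled Artin group as words *)

Section RaagWords.
Variable Gamma : simplicial_graph.
Local Notation X := {classic Gamma}.
Local Notation R := (@adj Gamma).
Local Notation letter := (X * bool)%type.
Local Notation word := (seq letter).
Local Notation tagged := (letter * nat)%type.
Local Notation A := (raag Gamma).
Implicit Types (s : letter) (u v x y : X) (w : word) (T : seq tagged).

Definition cls w : A := @class_of (pres_moves (@raag_relator Gamma)) w.

Lemma cls_cat w w' : cls (w ++ w') = (cls w * cls w')%g.
Proof. exact: esym (class_mulE _ _). Qed.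
Lemma cls_inv w : cls (inv_word w) = (cls w)^-1%g.
Proof. exact: esym (class_invE _). Qed.
Lemma cls0 : cls [::] = 1%g. Proof. by []. Qed.
Lemma cls_ex (g : A) : exists w, cls w = g.
Proof. by exists (repr g); apply: class_of_repr. Qed.
Lemma cls_cons s w : cls (s :: w) = (cls [:: s] * cls w)%g.
Proof. by rewrite -cls_cat. Qed.

Lemma cls_ind (Q : word -> word -> Prop) :
  (forall w, Q w w) -> (forall w w', Q w w' -> Q w' w) ->
  (forall w w' w2, Q w w' -> Q w' w2 -> Q w w2) ->
  (forall l s r, Q (l ++ [:: s; inv_letter s] ++ r) (l ++ r)) ->
  (forall l u v r, R u v ->
     Q (l ++ [:: (u, true); (v, true); (u, false); (v, false)] ++ r) (l ++ r)) ->
  forall w w', cls w = cls w' -> Q w w'.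
Proof.
move=> qr qs qt qc qR w w' /class_ofP; elim=> {w w'}.
- by move=> w w' [l s r|l _ r [u v uv]]; [apply: qc|apply: qR].
- exact: qr.
- by move=> w w' _; apply: qs.
- by move=> w w' w2 _ h _; apply: qt h.
Qed.

Lemma cls_letter u : cls [:: (u, true)] = (cls [:: (u, false)])^-1%g.
Proof. by rewrite -cls_inv. Qed.

Lemma cls_adj_gen u v : R u v -> commute (cls [:: (u, false)]) (cls [:: (v, false)]).
Proof.
move=> uv; have : cls [:: (u, true); (v, true); (u, false); (v, false)] = 1%g.
  have e : raag_relator [:: (u, true); (v, true); (u, false); (v, false)] by constructor.
  by apply/class_ofP/rst_step; have := pres_relator [::] [::] e.
rewrite !(cls_cons _ (_ :: _)) !cls_letter => H.
apply: (mulgI (cls [:: (v, false)])^-1%g); rewrite mulKg.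
by apply: (mulgI (cls [:: (u, false)])^-1%g); rewrite mulVg.
Qed.

Lemma cls_adj s s' : R s.1 s'.1 -> commute (cls [:: s]) (cls [:: s']).
Proof.
case: s => u b; case: s' => v c /= /cls_adj_gen H.
by case: b; case: c; rewrite ?cls_letter //;
  [apply/commuteV/commute_sym/commuteV/commute_sym|apply/commute_sym/commuteV/commute_sym|apply/commuteV].
Qed.

Lemma cls_adj_word s w : (forall s', s' \in w -> R s.1 s'.1) -> commute (cls [:: s]) (cls w).
Proof.
elim: w => [|s' w IH] H; first by rewrite cls0; apply: commute1.
rewrite (cls_cons s' w); apply: commuteM; first by apply/cls_adj/H; rewrite inE eqxx.
by apply: IH => z hz; apply: H; rewrite inE hz orbT.
Qed.

(** Being matched is invariant under all moves; one swap turns a commutator relator into two nested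
    cancellations. *)
Lemma cls_matched w : cls w = 1%g -> @matched X R w.
Proof.
rewrite -cls0 => h; suff : @matched X R w <-> @matched X R [::] by case=> _; apply; apply: matched_nil.
elim/cls_ind: h => {w} //.
- by move=> w w' [].
- by move=> w w' w2 [h1 h2] [h3 h4]; split; auto.
- by move=> l s r; split; [apply/matched_delete/(@adj_sym Gamma)|apply: matched_insert].
move=> l u v r uv; have D := @matched_delete X R (@adj_sym Gamma).
have S := @matched_swap X R (@adj_sym Gamma) (@adj_irr Gamma).
split.
  move=> /(S l (u, true) (v, true) ((u, false) :: (v, false) :: r) uv) H.
  apply: (D l (v, true) r); have := D (rcons l (v, true)) (u, true) ((v, false) :: r).
  by rewrite !cat_rcons; apply.
move=> H; apply: (S l (v, true) (u, true)); first exact: adj_sym.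
have := @matched_insert X R (rcons l (v, true)) (u, true) ((v, false) :: r).
by rewrite !cat_rcons; apply; apply: matched_insert.
Qed.

Definition sgl s : int := if s.2 then (-1)%R else 1%R.
(** The exponent sum of [v], an invariant of the group element. *)
Definition vsum v w : int := (\sum_(s <- w | s.1 == v) sgl s)%R.

Lemma vsum_cat v w w' : vsum v (w ++ w') = (vsum v w + vsum v w')%R.
Proof. exact: big_cat. Qed.

Lemma vsum_inv v w : vsum v (inv_word w) = (- vsum v w)%R.
Proof.
elim: w => [|s w IH]; first by rewrite /vsum !big_nil.
rewrite -cat1s inv_word_cat !vsum_cat IH /vsum !big_cons !big_nil /inv_letter /sgl /=.
by case: (s.1 == v); case: s.2 => /=; lia.
Qed.

Lemma vsum_cls v w w' : cls w = cls w' -> vsum v w = vsum v w'.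
Proof.
elim/cls_ind => {w w'} //.
- by move=> w w' w2 -> ->.
- move=> l s r; rewrite !vsum_cat (_ : vsum v [:: s; inv_letter s] = 0%R) ?GRing.add0r //.
  by rewrite /vsum !big_cons big_nil /inv_letter /sgl /=; case: (s.1 == v); case: s.2 => /=; lia.
move=> l x y r _; rewrite !vsum_cat (_ : vsum v [:: _; _; _; _] = 0%R) ?GRing.add0r //.
by rewrite /vsum !big_cons big_nil /sgl /=; case: (x == v); case: (y == v) => /=; lia.
Qed.

Definition reduced w := forall w', cls w = cls w' -> size w <= size w'.

Lemma reduced_ex (g : A) : exists2 w, cls w = g & reduced w.
Proof.
have [w] := cls_ex g; elim: {w}(size w) {-2}w (leqnn (size w)) => [|n IH] w hw ew.
  by exists w => // w' _; apply: leq_trans hw _.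
case: (pselect (exists2 w', cls w' = g & size w' <= n)) => [[w' e' h']|H].
  exact: (IH w').
exists w => // w' e'; rewrite leqNgt; apply/negP => lt; apply: H.
by exists w'; rewrite -?e' //; rewrite -ltnS; apply: leq_trans lt hw.
Qed.

Lemma reduced_inv w : reduced w -> reduced (inv_word w).
Proof.
move=> rw w' e; rewrite /inv_word size_rev size_map.
have : cls w = cls (inv_word w') by rewrite cls_inv -e cls_inv invgK.
by move/rw; rewrite /inv_word size_rev size_map.
Qed.

Lemma reduced_sep w1 s w2 w3 : reduced (w1 ++ s :: w2 ++ inv_letter s :: w3) ->
  (forall s', s' \in w2 -> R s.1 s'.1) -> False.
Proof.
move=> rw H; have c := cls_adj_word H.
have : cls (w1 ++ s :: w2 ++ inv_letter s :: w3) = cls (w1 ++ w2 ++ w3).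
  rewrite !cls_cat cls_cons cls_cat (cls_cons (inv_letter s)); congr (_ * _)%g.
  rewrite mulgA c -!mulgA; congr (_ * _)%g.
  have -> : cls [:: inv_letter s] = (cls [:: s])^-1%g by rewrite -cls_inv.
  by rewrite mulVKg.
by move/rw; rewrite !size_cat /= !size_cat /=; lia.
Qed.

(** Take a matched pair with the fewest letters between. A letter between them is matched beyond the
    pair, as a match inside would be a closer pair; its arc then crosses that of the pair, so it
    commutes with both ends, and the pair could be cancelled. *)
Lemma reduced_no_pair T T1 T2 T3 (a b c : seq tagged) (x y : tagged) :
  @paired X T -> @planar X R T -> T = T1 ++ T2 ++ T3 ->
  reduced (map fst T2) -> T2 = a ++ x :: b ++ y :: c -> x.2 = y.2 -> False.
Proof.
move=> pT plT eT rw; have [n] := ubnP (size b).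
elim: n a x b y c => // n IH a x b y c hb e xy.
have eTx : T = (T1 ++ a) ++ x :: (b ++ y :: c ++ T3) by rewrite eT e !(cat_cons, =^~ catA).
have [z [_ z2 _ zu]] := partner pT eTx.
have ey : y = z by apply: zu => //; right; rewrite mem_cat inE eqxx orbT.
have rw' := rw; rewrite e map_cat /= map_cat /= ey z2 in rw'.
apply: (reduced_sep rw') => s /mapP [v vb ->].
have [b1 [b2 eb]] : exists b1 b2, b = b1 ++ v :: b2.
  by case/splitPr: vb => b1 b2; exists b1, b2.
have vx : v.2 <> x.2.
  move=> vx; have vz : v = z by apply: zu => //; right; rewrite mem_cat eb mem_cat inE eqxx orbT.
  have eTy : T = (T1 ++ a ++ x :: b1) ++ v :: (b2 ++ y :: c ++ T3).
    by rewrite eT e eb !(cat_cons, =^~ catA).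
  have [z' [_ _ _ zu']] := partner pT eTy.
  have e1 : x = z' by apply: zu' => //; left; rewrite !mem_cat inE eqxx !orbT.
  have e2 : y = z' by apply: zu'; [right; rewrite mem_cat inE eqxx orbT|rewrite vx].
  by have := congr1 (@fst _ _) (etrans e1 (esym e2)); rewrite ey z2; case: x.1 => t [].
have eTv : T = (T1 ++ a ++ x :: b1) ++ v :: (b2 ++ y :: c ++ T3).
  by rewrite eT e eb !(cat_cons, =^~ catA).
have [v' [t' _ hv' _]] := partner pT eTv.
have xv := nesym vx.
have out1 K1 K2 : T1 ++ a = K1 ++ v' :: K2 -> R x.1.1 v.1.1.
  move=> eK; apply: (@adj_sym Gamma); rewrite (_ : v.1.1 = v'.1.1); last first.
    apply: (paired_gen pT) => //; first by rewrite eTv mem_cat inE eqxx orbT.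
    by rewrite eTx mem_cat eK mem_cat inE eqxx !orbT.
  apply: (planar_split pT plT (T1 := K1) (T2 := K2) (T3 := b1) (T4 := b2) (T5 := c ++ T3) _ _ xy).
  - by rewrite eTv catA eK !(cat_cons, =^~ catA).
  - exact: t'.
  - by rewrite t'.
case: hv' => hv'.
  move: hv'; rewrite catA mem_cat => /orP [/splitPr hh|].
    by case: hh out1 => K1 K2; apply.
  rewrite inE => /orP [/eqP ev|/splitPr hh]; first by case: vx; rewrite -ev.
  exfalso; case: hh eb => K1 K2 eb; apply: (IH (a ++ x :: K1) v' K2 v (b2 ++ y :: c)) => //.
    by move: hb; rewrite eb !size_cat /= ?size_cat /=; lia.
  by rewrite e eb !(cat_cons, =^~ catA).
move: hv'; rewrite mem_cat inE => /or3P [/splitPr hh|/eqP ev|/splitPr hh].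
- exfalso; case: hh eb => K1 K2 eb; apply: (IH (a ++ x :: b1) v K1 v' (K2 ++ y :: c)) => //.
    by move: hb; rewrite eb !size_cat /= ?size_cat /=; lia.
  by rewrite e eb !(cat_cons, =^~ catA).
- by case: vx; rewrite xy -ev.
case e3: _ / hh => [K1 K2].
apply: (planar_split pT plT (T1 := T1 ++ a) (T2 := b1) (T3 := b2) (T4 := K1) (T5 := K2) _ xy (esym t') xv).
by rewrite eTv e3 !(cat_cons, =^~ catA).
Qed.

End RaagWords.

(** * Supports of centralizing words *)

Section Centralizers.
Variable Gamma : simplicial_graph.
Local Notation X := {classic Gamma}.
Local Notation R := (@adj Gamma).
Local Notation letter := (X * bool)%type.
Local Notation word := (seq letter).
Local Notation tagged := (letter * nat)%type.
Implicit Types (s : letter) (w : word).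

Lemma paired_vsum0 (v : X) (L : seq tagged) : @paired X L -> (forall z, z \in L -> z.1.1 = v) ->
  vsum v (map fst L) = 0%R.
Proof.
have [n] := ubnP (size L); elim: n L => // n IH [|z L]; first by rewrite /vsum big_nil.
move=> hs pL gL; have [z' [z2 z1 hz _]] := partner pL (erefl _ : z :: L = [::] ++ z :: L).
have {hz} [L1 [L2 eL]] : exists L1 L2, L = L1 ++ z' :: L2.
  by case: hz => // /splitPr [L1 L2]; exists L1, L2.
rewrite eL in hs pL gL *; have gz : z.1.1 = v by apply: gL; rewrite inE eqxx.
have -> : vsum v (map fst (z :: L1 ++ z' :: L2)) = vsum v (map fst (L1 ++ L2)).
  rewrite /vsum /= big_cons !map_cat !big_cat /= big_cons z1 /inv_letter /sgl /= gz eqxx.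
  by case: z.1.2 => /=; lia.
apply: IH; first by move: hs; rewrite /= !size_cat /=; lia.
- move=> t; case: (eqVneq t z.2) => [->|nt].
    left; have := pL z.2; rewrite /= filter_cat /= /bytag z2 eqxx -/(bytag _) filter_cat.
    case=> [//|[s]]; case: (filter _ L1) => [|y K] /=; first by case: (filter _ L2).
    by case: K.
  have := pL t; rewrite /= !filter_cat /= /bytag z2 eq_sym (negbTE nt).
  by [].
- by move=> y; rewrite mem_cat => hy; apply: gL; rewrite inE mem_cat inE; case/orP: hy => ->; rewrite ?orbT.
Qed.

Lemma vsum_filter (v : X) (L : seq tagged) :
  vsum v (map fst L) = vsum v (map fst (filter (fun z => z.1.1 == v) L)).
Proof. by rewrite /vsum !big_map big_filter_cond; apply: eq_bigl => z /=; rewrite andbb. Qed.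

Lemma mem_inv_word s w : s \in inv_word w -> exists2 s', s' \in w & s.1 = s'.1.
Proof. by rewrite /inv_word mem_rev => /mapP [s' h ->]; exists s'. Qed.

(* Take the last letter [a] of [r] outside the star of [v]; it is matched with
   its copy in [r^-1], so the letters [v] under that arc cancel in pairs, while
   their exponents add up to that of [t]. *)
Lemma centralizer_support (v : X) w t : reduced w -> commute (cls w) (cls t) ->
  (forall s, s \in t -> s.1 = v \/ R s.1 v) -> vsum v t <> 0%R ->
  forall s, s \in w -> s.1 = v \/ R s.1 v.
Proof.
move=> rw cw ht vt s sw; apply: contrapT => /not_orP [xv nR]; set x : X := s.1 in xv nR.
have [T [eT pT plT]] : @matched X R (w ++ t ++ inv_word w ++ inv_word t).
  by apply: cls_matched; rewrite !cls_cat !cls_inv !mulgA cw mulgK mulgV.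
have [T1 [T' [eT1 m1 eT']]] := map_fst_cat eT; have [T2 [T'' [eT2 m2 eT'']]] := map_fst_cat eT'.
have [T3 [T4 [eT3 m3 m4]]] := map_fst_cat eT''; rewrite {}eT3 in eT2; rewrite {}eT2 in eT1.
move=> {T' T'' eT' eT'' eT}; rename eT1 into eT.
have [A [a [B [e1 /eqP ga nB]]]] : exists A a B, [/\ T1 = A ++ a :: B, a.1.1 == x &
    ~~ has (fun z : tagged => z.1.1 == x) B].
  apply: (@split_last _ (fun z : tagged => z.1.1 == x)); rewrite -m1 in sw.
  by case/mapP: sw => z zT es; apply/hasP; exists z; rewrite // -es.
have np (K : seq tagged) z : ~~ has (fun z : tagged => z.1.1 == x) K -> z \in K -> z.1.1 = x -> False.
  by move=> /hasPn H /H /eqP.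
have bad s' : s' \in t -> s'.1 = x -> False.
  by move=> /ht H e; rewrite e in H; case: H.
have bad2 z : z \in T2 -> z.1.1 = x -> False.
  by move=> hz; apply: bad; rewrite -m2; apply: map_f.
have bad4 z : z \in T4 -> z.1.1 = x -> False.
  move=> hz e; have : z.1 \in inv_word t by rewrite -m4; apply: map_f.
  by case/mem_inv_word => s' /bad H es; apply: H; rewrite -es.
have rw1 : reduced (map fst T1) by rewrite m1.
have rw3 : reduced (map fst T3) by rewrite m3; apply: reduced_inv.
have pair1 := @reduced_no_pair _ T [::] T1 (T2 ++ T3 ++ T4) _ _ _ _ _ pT plT eT rw1.
have eT3 : T = (T1 ++ T2) ++ T3 ++ T4 by rewrite eT -catA.
have pair3 := @reduced_no_pair _ T (T1 ++ T2) T3 T4 _ _ _ _ _ pT plT eT3 rw3.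
have eTa : T = A ++ a :: (B ++ T2 ++ T3 ++ T4) by rewrite eT e1 !(cat_cons, =^~ catA).
have [a' [a2 a1 ha' _]] := partner pT eTa.
have ga' : a'.1.1 = x by rewrite a1.
(* The partner of [a] is not in [T1], since letters of a reduced word are never matched with each
   other, nor in [T2] or [T4], since [t] and its inverse avoid [x]. *)
have {ha'} h3 : a' \in T3.
  case: ha' => [/splitPr h|].
    by case: h e1 => K1 K2 e1; case: (pair1 K1 K2 B a' a) => //; rewrite e1 -catA.
  rewrite !mem_cat => /or4P [/np|/bad2|//|/bad4] H; last by case: H.
    by case: (H nB).
  by case: H.
have [A' [B' e3]] : exists A' B', T3 = A' ++ a' :: B'.
  by case/splitPr: h3 => K1 K2; exists K1, K2.
(* An earlier letter over [x] in [T3] would have its partner before [a], and two arcs over [x] would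
   cross. *)
have nA' : ~~ has (fun z : tagged => z.1.1 == x) A'.
  apply/hasPn => z zA; apply/eqP => gz.
  have [A1 [A2 eA]] : exists A1 A2, A' = A1 ++ z :: A2.
    by case/splitPr: zA => K1 K2; exists K1, K2.
  have eTz : T = (A ++ a :: B ++ T2 ++ A1) ++ z :: (A2 ++ a' :: B' ++ T4).
    by rewrite eTa e3 eA !(cat_cons, =^~ catA).
  have [z' [z2 z1 hz' _]] := partner pT eTz.
  have gz' : z'.1.1 = x by rewrite z1.
  case: hz'.
    rewrite !mem_cat inE !mem_cat => /orP [/splitPr h|/orP [/eqP ez|]].
    - case: h eTz => K1 K2 eTz.
      have := planar_split pT plT (T1 := K1) (T2 := K2) (T3 := B ++ T2 ++ A1) (T4 := A2)
        (T5 := B' ++ T4) (a := z') (b := a) (c := z) (d := a') _ z2 (esym a2).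
      rewrite gz' ga => H; apply: (@adj_irr Gamma x); apply: H.
        by rewrite eTz !(cat_cons, =^~ catA).
      move=> e; apply: (pair3 A1 A2 B' z a'); first by rewrite e3 eA -catA.
      by rewrite -z2 e a2.
    - apply: (pair3 A1 A2 B' z a'); first by rewrite e3 eA -catA.
      by rewrite -z2 ez a2.
    case/or3P => [/(np _ _ nB)|/bad2|/splitPr h]; [exact|exact|].
    case: h eA => K1 K2 eA; apply: (pair3 K1 K2 (A2 ++ a' :: B') z' z) => //.
    by rewrite e3 eA !(cat_cons, =^~ catA).
  rewrite !mem_cat inE mem_cat => /orP [/splitPr h|/orP [/eqP ez|/orP [/splitPr h|/bad4]]]; last exact.
  - case: h eA => K1 K2 eA; apply: (pair3 A1 K1 (K2 ++ a' :: B') z z') => //.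
    by rewrite e3 eA !(cat_cons, =^~ catA).
  - apply: (pair3 A1 A2 B' z a'); first by rewrite e3 eA -catA.
    by rewrite -z2 ez.
  case: h e3 => K1 K2 e3; apply: (pair3 A1 (A2 ++ a' :: K1) K2 z z') => //.
  by rewrite e3 eA !(cat_cons, =^~ catA).
(* [B] is what follows the last [x] in [w], and [A'] is what precedes the first [x] in the inverse
   of [w]. *)
have eA' : map fst A' = inv_word (map fst B).
  have ew : w = map fst A ++ [:: a.1] ++ map fst B by rewrite -m1 e1 map_cat.
  have e : map fst A' ++ a'.1 :: map fst B' =
      inv_word (map fst B) ++ inv_letter a.1 :: inv_word (map fst A).
    by move: m3; rewrite e3 map_cat ew !inv_word_cat -catA.
  apply: (split_first_uniq (p := fun s => s.1 == x) e) => //=.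
  - by rewrite ga'.
  - by rewrite ga.
  - by rewrite has_map.
  apply/hasPn => s' /mem_inv_word [s2 /mapP [z zB ->] ->].
  by move/hasPn: nB => /(_ z zB).
set I := B ++ T2 ++ A'.
have eTI : T = A ++ a :: I ++ a' :: (B' ++ T4).
  by rewrite eTa e3 /I !(cat_cons, =^~ catA).
apply: vt; have <- : vsum v (map fst I) = vsum v t.
  by rewrite /I !map_cat !vsum_cat eA' vsum_inv m2; lia.
rewrite vsum_filter; apply: paired_vsum0; last by move=> z; rewrite mem_filter => /andP [/eqP].
apply: (@paired_under_arc X R (@adj_sym Gamma) T A I (B' ++ T4) a a' v pT plT eTI (esym a2)).
rewrite ga.
by move/(@adj_sym Gamma).
Qed.

End Centralizers.

(** * Powers of generators *)

Section Generators.
Variable Gamma : simplicial_graph.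
Local Notation X := {classic Gamma}.
Local Notation R := (@adj Gamma).
Implicit Types (u v x : X) (g : raag Gamma).

Definition gen u : raag Gamma := cls [:: (u, false)].

Lemma cls_gen u b : cls [:: (u, b)] = zexp (gen u) (if b then (-1)%R else 1%R).
Proof. by case: b; rewrite ?zexp1 // cls_letter zexpN. Qed.

Lemma zexp_gen v (k : int) : exists w : seq (X * bool),
  [/\ cls w = zexp (gen v) k, forall s, s \in w -> s.1 = v & vsum v w = k].
Proof.
elim/zexp_ind: k => [|k [w [e gw vw]]|k [w [e gw vw]]].
- by exists [::]; split=> //; rewrite /vsum big_nil.
- exists (w ++ [:: (v, false)]); split.
  + by rewrite cls_cat e zexpS.
  + by move=> s; rewrite mem_cat => /orP [/gw //|]; rewrite inE => /eqP ->.
  + by rewrite vsum_cat vw /vsum big_cons big_nil eqxx.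
- exists (w ++ [:: (v, true)]); split.
  + by rewrite cls_cat e zexpB1 cls_letter.
  + by move=> s; rewrite mem_cat => /orP [/gw //|]; rewrite inE => /eqP ->.
  + by rewrite vsum_cat vw /vsum big_cons big_nil eqxx.
Qed.

Lemma vsum0 v (w : seq (X * bool)) : (forall s, s \in w -> s.1 <> v) -> vsum v w = 0%R.
Proof.
move=> H; rewrite /vsum big_seq_cond big1 // => s /andP [/H h /eqP].
by [].
Qed.

Lemma zexp_gen2 u v (k a : int) : u <> v -> exists w : seq (X * bool),
  [/\ cls w = (zexp (gen u) k * zexp (gen v) a)%g, forall s, s \in w -> s.1 = u \/ s.1 = v
    & vsum u w = k].
Proof.
move=> uv; have [w1 [e1 g1 v1]] := zexp_gen u k; have [w2 [e2 g2 v2]] := zexp_gen v a.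
exists (w1 ++ w2); split; first by rewrite cls_cat e1 e2.
  by move=> s; rewrite mem_cat => /orP [/g1|/g2]; [left|right].
by rewrite vsum_cat v1 vsum0 ?GRing.addr0 // => s /g2 -> /esym.
Qed.

Lemma cls_gens2 u v (w : seq (X * bool)) : commute (gen u) (gen v) ->
  (forall s, s \in w -> s.1 = u \/ s.1 = v) ->
  exists k a, cls w = (zexp (gen u) k * zexp (gen v) a)%g.
Proof.
move=> c; elim: w => [|[x b] w IH] H; first by exists 0%R, 0%R; rewrite cls0 !zexp0 mulg1.
have [s hs|k [a e]] := IH; first by apply: H; rewrite inE hs orbT.
rewrite cls_cons e cls_gen; case: (H (x, b)); rewrite ?inE ?eqxx //= => ->.
  by exists ((if b then -1 else 1) + k)%R, a; rewrite zexpD mulgA.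
exists k, ((if b then -1 else 1) + a)%R; rewrite zexpD !mulgA; congr (_ * _)%g.
exact/commute_zexp2/commute_sym.
Qed.

Lemma cls_gens1 v (w : seq (X * bool)) : (forall s, s \in w -> s.1 = v) ->
  exists a, cls w = zexp (gen v) a.
Proof.
move=> H; have [|s hs|k [a e]] := @cls_gens2 v v w.
- exact: commute_refl.
- by left; apply: H.
by exists (k + a)%R; rewrite e zexpD.
Qed.

Lemma commute_support u v (k a : int) (w : seq (X * bool)) : R u v -> k <> 0%R -> reduced w ->
  commute (cls w) (zexp (gen u) k * zexp (gen v) a)%g ->
  forall s, s \in w -> s.1 = u \/ R s.1 u.
Proof.
move=> uv k0 rw; have ne : u <> v by move=> e; apply: (@adj_irr Gamma u); rewrite {2}e.
have [t [<- gt vt]] := zexp_gen2 k a ne => c.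
apply: (centralizer_support rw c); last by rewrite vt.
by move=> s /gt [->|->]; [left|right; apply: adj_sym].
Qed.

Lemma gen2_inj0 u v (k a : int) : u <> v -> (zexp (gen u) k * zexp (gen v) a)%g = 1%g -> k = 0%R.
Proof.
move=> uv; have [t [<- _ vt]] := zexp_gen2 k a uv.
by rewrite -cls0 => /(vsum_cls u); rewrite vt /vsum big_nil.
Qed.

End Generators.

(** * The generators of the cycle group *)

Section CycleGenerators.
Variables (n : nat) (n_ge5 : 5 <= n).
Local Notation Gamma := (cycle_graph n).
Implicit Types (i u v : 'I_n).

Lemma ordS_val i : nat_of_ord (ordS i) = if i.+1 < n then i.+1 else 0.
Proof.
rewrite /=; case: ltnP => h; first by rewrite modn_small.
by rewrite (_ : i.+1 = n) ?modnn //; have := ltn_ord i; lia.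
Qed.

Lemma ordS_nat i u : u = ordS i <->
  (i.+1 < n /\ nat_of_ord u = i.+1) \/ (i.+1 = n /\ nat_of_ord u = 0).
Proof.
split=> [->|h]; first by rewrite ordS_val; have := ltn_ord i; case: ifP; lia.
by apply: val_inj; change (nat_of_ord u = nat_of_ord (ordS i)); rewrite ordS_val; case: ifP; lia.
Qed.

Lemma ord_neq (i j : 'I_n) : nat_of_ord i <> nat_of_ord j -> i <> j.
Proof. by move=> h e; apply: h; rewrite e. Qed.

Lemma cyclic_nb_adj i u : cyclic_nb i u -> @adj Gamma u i.
Proof.
move=> h; split; last by case: h; [right|left].
apply: ord_neq; have := ltn_ord i; have := ltn_ord u; case: h => /ordS_nat; lia.
Qed.

Lemma no_triangle i u v : cyclic_nb i u -> v = u \/ @adj Gamma v u -> v = i \/ @adj Gamma v i ->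
  v = u \/ v = i.
Proof.
move=> nb [->|[_ h1]]; first by left.
case=> [->|[_ h2]]; first by right.
exfalso; have := ltn_ord i; have := ltn_ord u; have := ltn_ord v.
by case: nb h1 h2 => /ordS_nat ? [] /ordS_nat ? [] /ordS_nat ?; lia.
Qed.

(** In a cycle of length 4 the vertex opposite to [i] would be a second common neighbour; with at
    least 5 vertices there is none. *)
Lemma no_square (v s : 'I_n) : let i := ordS v in s = ordS i \/ @adj Gamma s (ordS i) ->
  s = v \/ @adj Gamma s v -> s = i.
Proof.
move=> i; have /ordS_nat hi : i = ordS v by [].
clearbody i; have /ordS_nat hu : ordS i = ordS i by [].
move: (ordS i) hu => u hu h1 h2; apply: val_inj; change (nat_of_ord s = nat_of_ord i).
have := ltn_ord i; have := ltn_ord u; have := ltn_ord v; have := ltn_ord s.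
case: h1 => [/(congr1 (@nat_of_ord n)) ?|[_ [] /ordS_nat ?]];
case: h2 => [/(congr1 (@nat_of_ord n)) ?|[_ [] /ordS_nat ?]]; lia.
Qed.

Lemma cycle_generators_raag : cycle_generators (fun i : 'I_n => @gen Gamma i).
Proof.
split.
- by move=> i u /cyclic_nb_adj; apply: cls_adj_gen.
- move=> i u k a /cyclic_nb_adj ui; apply: gen2_inj0 => e.
  by apply: (@adj_irr Gamma u); rewrite {2}e.
- move=> i u k a g nb k0 a0; have [w <- rw] := reduced_ex g => c1 c2.
  have ui := cyclic_nb_adj nb.
  apply: cls_gens2; first exact: cls_adj_gen.
  move=> s sw; apply: (@no_triangle i u s.1 nb).
    apply: (@commute_support Gamma u i k 0 w ui k0 rw) => //.
    by rewrite zexp0 mulg1; apply: commute_sym.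
  apply: (@commute_support Gamma i u a 0 w _ a0 rw) => //; first exact: adj_sym.
  by rewrite zexp0 mulg1; apply: commute_sym.
- move=> v k a k' a' i c; case: (eqVneq k' 0%R) => [->|/eqP k0]; first by right.
  left; set u := ordS i in c *; set g := (_ * _)%g in c.
  have [w ew rw] := reduced_ex g; rewrite -ew in c.
  have vi : @adj Gamma v i by apply: cyclic_nb_adj; right.
  have H := @commute_support Gamma v i k' a' w vi k0 rw c.
  have ui : @adj Gamma u i by apply: cyclic_nb_adj; left.
  have ne : (u : {classic Gamma}) <> i by case: ui.
  have [t [et _ <-]] := @zexp_gen2 Gamma u i k a ne.
  rewrite (@vsum_cls Gamma u _ _ (etrans et (esym ew))); apply: (@vsum0 Gamma) => s /H hs es.
  have ui' : u = i by apply: (@no_square v u); [left|rewrite -es].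
  by case: ui.
move=> v k a k' a' g i k0 k0'; have [w <- rw] := reduced_ex g => c1 c2.
have vi : @adj Gamma v i by apply: cyclic_nb_adj; right.
have ui : @adj Gamma (ordS i) i by apply: cyclic_nb_adj; left.
apply: cls_gens1 => s sw; apply: (@no_square v s.1).
  exact: (@commute_support Gamma (ordS i) i k a w ui k0 rw c1).
exact: (@commute_support Gamma v i k' a' w vi k0' rw c2).
Qed.

Lemma cycle_generators_iso (G H : groupType) (f : {multiplicative G -> H}) (X : 'I_n -> G) :
  bijective f -> cycle_generators X -> cycle_generators (fun i => f (X i)).
Proof.
move=> [f' fK f'K] [h1 h2 h3 h4 h5]; have fz x k : zexp (f x) k = f (zexp x k) by rewrite mult_zexp.
have inj := can_inj fK.
have fc x y : commute (f x) (f y) -> commute x y.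
  by rewrite /commute -!gmulfM => /inj.
split.
- by move=> i u /h1; apply: gmulf_commute.
- move=> i u k a nb; rewrite !fz -gmulfM -(mult1 f) => /inj; exact: h2.
- move=> i u k a g nb k0 a0; rewrite !fz -[g]f'K => /fc c1 /fc c2.
  have [k' [a' ->]] := h3 _ _ _ _ _ nb k0 a0 c1 c2.
  by exists k', a'; rewrite !fz gmulfM.
- by move=> v k a k' a' i; rewrite !fz -!gmulfM => /fc; apply: h4.
move=> v k a k' a' g i k0 k0'; rewrite !fz -!gmulfM -[g]f'K => /fc c1 /fc c2.
by have [b ->] := h5 _ _ _ _ _ _ k0 k0' c1 c2; exists b; rewrite fz.
Qed.

End CycleGenerators.

Theorem not_diagram_group_raag_cycle n : odd n -> 5 <= n ->
  ~ is_diagram_group (raag (cycle_graph n)).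
Proof.
move=> on n5 [P [w [_ [f bf]]]].
have := @cycle_generators_even P w n _ (cycle_generators_iso bf (cycle_generators_raag n5)).
by rewrite on => H; have := H (leq_trans (isT : 0 < 5) n5).
Qed.

Lemma mult_ex (G H : groupType) (f : G -> H) : {morph f : x y / (x * y)%g >-> (x * y)%g} ->
  exists F : {multiplicative G -> H}, forall x, F x = f x.
Proof.
move=> fM; pose m := isMultiplicative.Build G H f fM.
pose F : {multiplicative G -> H} := HB.pack f m.
by exists F.
Qed.

Lemma embeds_trans (G H K : groupType) : embeds G H -> embeds H K -> embeds G K.
Proof.
move=> [f fi] [g gi]; have [|F hF] := @mult_ex G K (g \o f).
  by move=> x y; rewrite /= !gmulfM.
by exists F => x y; rewrite !hF => /gi /fi.
Qed.

(** * The embedding *)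

Section Evaluation.
Variables (Gamma : simplicial_graph) (H : groupType) (h : Gamma -> H).
Local Notation X := {classic Gamma}.

Definition letter_val (s : X * bool) : H := if s.2 then (h s.1)^-1%g else h s.1.
Definition word_val (w : seq (X * bool)) : H := foldr (fun s g => letter_val s * g)%g 1%g w.

Lemma word_val_cat w w' : word_val (w ++ w') = (word_val w * word_val w')%g.
Proof. by elim: w => [|s w IH] /=; rewrite ?mul1g // IH mulgA. Qed.

Hypothesis hC : forall u v, adj u v -> commute (h u) (h v).

Lemma word_val_cls w w' : cls w = cls w' -> word_val w = word_val w'.
Proof.
elim/cls_ind => {w w'} //.
- by move=> w w' w2 -> ->.
- move=> l s r; rewrite !word_val_cat (_ : word_val [:: s; _] = 1%g) ?mul1g //.
  by rewrite /= /letter_val /= mulg1; case: s.2; rewrite /= ?mulVg ?mulgV.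
move=> l u v r /hC c; rewrite !word_val_cat (_ : word_val [:: _; _; _; _] = 1%g) ?mul1g //.
by rewrite /= /letter_val /= mulg1 c mulKg mulVg.
Qed.

Lemma raag_hom : exists F : {multiplicative raag Gamma -> H}, forall w, F (cls w) = word_val w.
Proof.
have [|F hF] := @mult_ex (raag Gamma) H (fun g => word_val (repr g)); last first.
  by exists F => w; rewrite hF; apply: word_val_cls; apply: class_of_repr.
move=> x y; rewrite -word_val_cat; apply: word_val_cls.
have clsK (g : raag Gamma) : cls (repr g) = g by apply: class_of_repr.
by rewrite cls_cat !clsK.
Qed.

End Evaluation.

(** [psi] is a mere function, because its intended instance, rewriting along cosets, is
    multiplicative only on a subgroup. *)
Lemma raag_hom_inj (Gamma : simplicial_graph) (H : groupType) (F : {multiplicative raag Gamma -> H})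
  (psi : H -> raag Gamma) : (forall w, psi (F (cls w)) = cls w) -> injective F.
Proof.
move=> e g g' /(congr1 psi); have [w <-] := cls_ex g; have [w' <-] := cls_ex g'.
by rewrite !e.
Qed.

(** * Rewriting in a subgroup of index two *)

Section Sheets.
Variables (Delta : simplicial_graph) (H : groupType) (v : Delta).
(** [c false x] is the value of a generator [x] other than [v], [c true x] that of its conjugate
    [v x v^-1], and [V] that of [v^2]. [c_link] says that the values respect the commutation of [x]
    with [v]. *)
Variables (c : bool -> Delta -> H) (V : H).
Local Notation X := {classic Delta}.
Hypothesis c_comm : forall e x y, x <> v -> y <> v -> adj x y -> commute (c e x) (c e y).
Hypothesis c_link : forall x, adj x v -> c true x = c false x /\ commute (c false x) V.

(* Reidemeister-Schreier rewriting for the index two subgroup of the words with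
   an even exponent of [v]; the boolean is the current coset. *)
Definition sheet_letter (e : bool) (s : X * bool) : bool * H :=
  if s.1 == (v : X) then (~~ e, if e == s.2 then 1%g else if s.2 then V^-1%g else V)
  else (e, if s.2 then (c e s.1)^-1%g else c e s.1).

Fixpoint sheet_word (e : bool) (w : seq (X * bool)) : bool * H :=
  if w is s :: w' then
    let: (e1, g1) := sheet_letter e s in let: (e2, g2) := sheet_word e1 w' in (e2, (g1 * g2)%g)
  else (e, 1%g).

Lemma sheet_word_cat e w w' : sheet_word e (w ++ w') =
  ((sheet_word (sheet_word e w).1 w').1, ((sheet_word e w).2 * (sheet_word (sheet_word e w).1 w').2)%g).
Proof.
elim: w e => [|s w IH] e /=; first by rewrite mul1g; case: sheet_word.
case: sheet_letter => e1 g1; rewrite IH /=; case: (sheet_word e1 w) => e2 g2 /=.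
by rewrite mulgA.
Qed.

Lemma sheet_cancel e s : sheet_word e [:: s; inv_letter s] = (e, 1%g).
Proof.
rewrite /= /sheet_letter /=; case: (s.1 == (v : X)) => /=; rewrite mulg1 ?negbK.
  by case: e; case: s.2; rewrite /= ?mulg1 ?mulVg ?mulgV.
by case: s.2; rewrite /= ?mulVg ?mulgV.
Qed.

Lemma sheet_relator e x y : adj x y ->
  sheet_word e [:: (x, true); (y, true); (x, false); (y, false)] = (e, 1%g).
Proof.
move=> xy; rewrite /= /sheet_letter /=.
have rel (a b : H) : commute a b -> (a^-1 * (b^-1 * (a * b)) = 1)%g.
  by move=> ab; rewrite ab mulKg mulVg.
case: (eqVneq (x : X) v) => [ex|nx]; case: (eqVneq (y : X) v) => [ey|ny] /=;
  rewrite ?mulg1.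
- by case: (@adj_irr Delta v); rewrite -{1}ex -ey.
- have [c1 c2] : c true y = c false y /\ commute (c false y) V.
    by apply: c_link; rewrite -ex; apply: adj_sym.
  case: e; rewrite /= ?mul1g c1 ?mulVg //; congr (_, _).
  exact/rel/commute_sym.
- have [c1 c2] : c true x = c false x /\ commute (c false x) V by apply: c_link; rewrite -ey.
  by case: e; rewrite /= ?mul1g ?mulg1 c1 ?mulVg // rel.
- by congr (_, _); apply: rel; apply: (c_comm _ (elimN eqP nx) (elimN eqP ny)).
Qed.

Lemma sheet_word_cls e w w' : cls w = cls w' -> sheet_word e w = sheet_word e w'.
Proof.
move=> h; elim/cls_ind: h e => {w w'} //.
- by move=> w w' w2 h1 h2 e; rewrite h1 h2.
- by move=> l s r e; rewrite !sheet_word_cat sheet_cancel /= mul1g.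
- by move=> l x y r xy e; rewrite !sheet_word_cat sheet_relator //= mul1g.
Qed.

End Sheets.

Definition theta_edge (m i j : nat) : bool :=
  [&& i < m, j < m & (j == i.+1) || ((i == 0) && (j == m.-1))] ||
  ((j == m) && ((i == 0) || (i == 3))).
Definition theta_rel (m i j : nat) : bool := (i != j) && (theta_edge m i j || theta_edge m j i).

Lemma theta_sym m k (i j : 'I_k) : theta_rel m i j -> theta_rel m j i.
Proof. by rewrite /theta_rel eq_sym orbC. Qed.
Lemma theta_irr m k (i : 'I_k) : ~ theta_rel m i i.
Proof. by rewrite /theta_rel eqxx. Qed.

(* For [k = m + 1]: the cycle [0, ..., m - 1] with one more vertex [m], joined
   to [0] and [3]. For [k = m]: the cycle. *)
Definition theta (m k : nat) : simplicial_graph :=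
  SimplicialGraph (@theta_sym m k) (@theta_irr m k).

(** * From a cycle to the next longer one *)

Section ThetaStep.
Variables (m k : nat) (m_ge5 : 5 <= m) (hk : k = m \/ (m = 5 /\ k = 4)).
Local Notation Delta := (theta m k.+1).
Local Notation Gamma := (theta m.+1 m.+2).
Local Notation D i := (@gen Delta (inord i : 'I_k.+1)).
Local Notation G i := (@gen Gamma (inord i : 'I_m.+2)).

Lemma D_comm i j : i <= k -> j <= k -> theta_rel m i j -> commute (D i) (D j).
Proof. by move=> hi hj h; apply: cls_adj_gen; rewrite /= !inordK. Qed.
Lemma G_comm i j : i <= m.+1 -> j <= m.+1 -> theta_rel m.+1 i j -> commute (G i) (G j).
Proof. by move=> hi hj h; apply: cls_adj_gen; rewrite /= !inordK. Qed.

(** The inverse of [step_word] on generators, read in each of the two cosets. A generator with value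
    [None] is sent to 1, which retracts the subgroup of index two onto the wanted one. *)
Definition sheet_index (e : bool) (x : nat) : option nat :=
  if x == 0 then Some 0 else if x == 2 then Some 3 else
  if e then (if (3 <= x) && (x < m) then Some x.+1 else None)
  else if x == k then Some 1 else if x == 3 then Some 2 else None.

Definition sheet_val (e : bool) (x : 'I_k.+1) : raag Gamma :=
  if sheet_index e x is Some a then G a else 1%g.

Lemma sheet_indexP e (x y a b : nat) : x <= k -> y <= k -> x <> 1 -> y <> 1 -> theta_rel m x y ->
  sheet_index e x = Some a -> sheet_index e y = Some b ->
  [/\ a <= m.+1, b <= m.+1 & theta_rel m.+1 a b].
Proof.
move=> hx hy x1 y1 h; rewrite /sheet_index.
repeat (case: ifP => ?); try by []; move=> [<-] [<-];
  move: h; rewrite /theta_rel /theta_edge => h; split; lia.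
Qed.

Lemma sheet_val_comm e (x y : Delta) : x <> inord 1 -> y <> inord 1 -> adj x y ->
  commute (sheet_val e x) (sheet_val e y).
Proof.
move=> x1 y1 h; rewrite /sheet_val.
have ne (z : 'I_k.+1) : z <> inord 1 -> nat_of_ord z <> 1.
  by move=> nz e1; apply: nz; rewrite -e1 inord_val.
case ea : (sheet_index e x) => [a|]; last exact/commute_sym/commute1.
case eb : (sheet_index e y) => [b|]; last exact: commute1.
have [ha hb hab] := sheet_indexP (ltn_ord x) (ltn_ord y) (ne _ x1) (ne _ y1) h ea eb.
exact: G_comm.
Qed.

Lemma sheet_val_link (x : Delta) : adj x (inord 1 : 'I_k.+1) ->
  sheet_val true x = sheet_val false x /\ commute (sheet_val false x) (G m.+1).
Proof.
rewrite /= inordK; last by lia.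
move=> h; have : nat_of_ord x = 0 \/ nat_of_ord x = 2.
  by move: h; rewrite /theta_rel /theta_edge; lia.
by case=> ex; rewrite /sheet_val /sheet_index ex /=; split=> //;
   apply: G_comm => //; rewrite /theta_rel /theta_edge; lia.
Qed.

(** Passing to even exponents of vertex 1 doubles the graph along the neighbours 0 and 2 of 1. The
    path 0, [k], 3, 2 in one copy and the path 2, 3, ..., [m - 1], 0 in the other form a cycle of
    length [m + 1], and the square of vertex 1, joined to 0 and 2, becomes the new additional
    vertex. In the pentagon the vertex 4 is itself the shortcut from 0 to 3, whence the case
    [k = 4]. *)
Definition step_word (j : nat) : seq ('I_k.+1 * bool) :=
  if j == 0 then [:: (inord 0, false)] else if j == 1 then [:: (inord k, false)]
  else if j == 2 then [:: (inord 3, false)] else if j == 3 then [:: (inord 2, false)]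
  else if j <= m then [:: (inord 1, false); (inord j.-1, false); (inord 1, true)]
  else [:: (inord 1, false); (inord 1, false)].

Definition step_gen (j : nat) : raag Delta := @cls Delta (step_word j).

Lemma step_genE j : step_gen j =
  if j == 0 then D 0 else if j == 1 then D k else if j == 2 then D 3 else if j == 3 then D 2
  else if j <= m then (D 1 * (D j.-1 * (D 1)^-1))%g else (D 1 * D 1)%g.
Proof.
rewrite /step_gen /step_word; do 4 case: ifP => // _; case: ifP => _.
  by rewrite -cls_letter /gen -!cls_cat.
by rewrite /gen -!cls_cat.
Qed.

Lemma step_gen_comm_lt (i j : nat) : j <= m.+1 -> i <= m.+1 -> theta_edge m.+1 i j ->
  commute (step_gen i) (step_gen j).
Proof.
have e1 : 1 <= k by lia.
have e2 : 2 <= k by lia.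
have e3 : 3 <= k by lia.
have th (a b : nat) : a <= k -> b <= k -> theta_rel m a b -> commute (D a) (D b) := @D_comm a b.
move=> hj hi; rewrite !step_genE.
have cases : theta_edge m.+1 i j -> [\/ i = 0 /\ j = 1, i = 1 /\ j = 2, i = 2 /\ j = 3 | 
   [\/ i = 3 /\ j = 4, [/\ 4 <= i, j = i.+1 & j <= m], i = 0 /\ j = m |
     j = m.+1 /\ (i = 0 \/ i = 3)]].
  move=> h; have : [|| (i == 0) && (j == 1), (i == 1) && (j == 2), (i == 2) && (j == 3), (i == 3) && (j == 4),
    [&& 4 <= i, j == i.+1 & j <= m], (i == 0) && (j == m) | (j == m.+1) && ((i == 0) || (i == 3))].
    by move: h; rewrite /theta_edge; lia.
  case/or4P => [/andP [/eqP ? /eqP ?]|/andP [/eqP ? /eqP ?]|/andP [/eqP ? /eqP ?]|];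
    [by constructor 1|by constructor 2|by constructor 3|move=> h'; constructor 4].
  case/or4P: h' => [/andP [/eqP ? /eqP ?]|/and3P [? /eqP ? ?]|/andP [/eqP ? /eqP ?]|/andP [/eqP ? /orP o]].
  - by constructor 1.
  - by constructor 2.
  - by constructor 3.
  - by constructor 4; split=> //; case: o => /eqP; [left|right].
move=> /cases [[-> ->]|[-> ->]|[-> ->]|[[-> ->]|[h4 -> hm]|[-> ->]|[-> hi3]]] /=.
- by apply: th; rewrite ?/theta_rel ?/theta_edge; lia.
- by apply: th; rewrite ?/theta_rel ?/theta_edge; lia.
- by apply: th; rewrite ?/theta_rel ?/theta_edge; lia.
- rewrite (_ : 4 <= m) ; last by lia.
  have c1 : commute (D 2) (D 1) by apply: th; rewrite ?/theta_rel ?/theta_edge; lia.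
  have c3 : commute (D 2) (D 3) by apply: th; rewrite ?/theta_rel ?/theta_edge; lia.
  by apply: commuteM => //; apply: commuteM => //; apply: commuteV.
- have -> : (i == 0) = false by lia.
  have -> : (i == 1) = false by lia.
  have -> : (i == 2) = false by lia.
  have -> : (i == 3) = false by lia.
  have -> : (i.+1 == 2) = false by lia.
  have -> : (i.+1 == 1) = false by lia.
  have -> : (i.+1 == 3) = false by lia.
  have -> : i <= m by lia.
  rewrite hm; have c : commute (D i.-1) (D i) by apply: th; rewrite ?/theta_rel ?/theta_edge; lia.
  by rewrite /commute -!mulgA !mulKg; congr (_ * _)%g; rewrite !mulgA; congr (_ * _)%g.
- have -> : (m == 0) = false by lia.
  have -> : (m == 1) = false by lia.
  have -> : (m == 2) = false by lia.
  have -> : (m == 3) = false by lia.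
  rewrite leqnn.
  have c1 : commute (D 0) (D 1) by apply: th; rewrite ?/theta_rel ?/theta_edge; lia.
  have c3 : commute (D 0) (D m.-1) by apply: th; rewrite ?/theta_rel ?/theta_edge; lia.
  by apply: commuteM => //; apply: commuteM => //; apply: commuteV.
have -> : (m.+1 == 1) = false by lia.
have -> : (m.+1 == 2) = false by lia.
have -> : (m.+1 == 3) = false by lia.
have -> : (m.+1 <= m) = false by lia.
case: hi3 => -> /=.
  by apply: commuteM; apply: th; rewrite ?/theta_rel ?/theta_edge; lia.
by apply: commuteM; apply: th; rewrite ?/theta_rel ?/theta_edge; lia.
Qed.

Lemma step_gen_comm (i j : Gamma) : adj i j -> commute (step_gen i) (step_gen j).
Proof.
have hi := ltn_ord i; have hj := ltn_ord j.
move=> /andP [_ /orP [h|h]]; first by apply: step_gen_comm_lt => //; lia.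
by apply/commute_sym/step_gen_comm_lt => //; lia.
Qed.

Local Notation sheet := (@sheet_word Delta (raag Gamma) (inord 1 : 'I_k.+1) sheet_val (G m.+1)).

Lemma sheet_step (j : Gamma) : sheet false (step_word j) = (false, @gen Gamma j).
Proof.
have hj := ltn_ord j; rewrite -[in RHS](inord_val j); move: (nat_of_ord j) hj => {}j hj.
have n1 (x : nat) : x <= k -> x <> 1 -> ((inord x : {classic Delta}) == (inord 1 : 'I_k.+1)) = false.
  move=> hx x1; apply/negP => /eqP /(congr1 (@nat_of_ord k.+1)); rewrite !inordK //; lia.
have sv e (x : nat) : x <= k -> sheet_val e (inord x) = if sheet_index e x is Some a then G a else 1%g.
  by move=> hx; rewrite /sheet_val inordK.
have s1 (x a : nat) : x <= k -> x <> 1 -> sheet_index false x = Some a ->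
    sheet false [:: (inord x, false)] = (false, G a).
  by move=> hx x1 ea; rewrite /= /sheet_letter /= n1 //= sv // ea mulg1.
rewrite /step_word; case: ifP => [/eqP ->|?]; first by apply: s1.
case: ifP => [/eqP ->|?].
  apply: s1; rewrite ?leqnn //; first by lia.
  by rewrite /sheet_index eqxx; do 2 (case: ifP; first by lia).
case: ifP => [/eqP ->|?].
  by apply: s1; [lia|lia|rewrite /sheet_index /=; case: ifP => //; lia].
case: ifP => [/eqP ->|?]; first by apply: s1; [lia|lia|].
case: ifP => hm; rewrite /= /sheet_letter /= !eqxx /=.
  rewrite n1 /=; [|lia|lia].
  rewrite ?eqxx /= !mulg1 mul1g sv; last by lia.
  rewrite /sheet_index (_ : (j.-1 == 0) = false); last by lia.
  rewrite (_ : (j.-1 == 2) = false); last by lia.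
  rewrite (_ : (2 < j.-1) && (j.-1 < m)); last by lia.
  by rewrite prednK //; lia.
by rewrite mulg1 mul1g (_ : m.+1 = j) //; lia.
Qed.

(** Every [step_word] starts and ends in the coset [false] and is rewritten to its generator, so
    rewriting along cosets is a left inverse. *)
Theorem embeds_theta_step : embeds (raag Gamma) (raag Delta).
Proof.
have [F hF] := raag_hom step_gen_comm; exists F.
pose psi (g : raag Delta) := (sheet false (repr g)).2.
have sc := @sheet_word_cls Delta (raag Gamma) (inord 1 : 'I_k.+1) sheet_val (G m.+1)
  sheet_val_comm sheet_val_link.
apply: (@raag_hom_inj _ _ F psi) => w; rewrite hF /psi.
suff [W eW sW] : exists2 W, @cls Delta W = word_val (fun j : Gamma => step_gen j) w &
    sheet false W = (false, cls w).
  have -> : sheet false (repr (word_val (fun j : Gamma => step_gen j) w)) = sheet false W.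
    by apply: sc; rewrite eW; apply: class_of_repr.
  by rewrite sW.
elim: w => [|[j b] w [W eW sW]]; first by exists [::].
pose W0 := if b then inv_word (step_word j) else step_word j.
have s0 : sheet false W0 = (false, cls [:: (j, b)]).
  rewrite /W0; case: b {W0}; last exact: sheet_step.
  have : sheet false (step_word j ++ inv_word (step_word j)) = sheet false [::].
    by apply: sc; rewrite cls_cat cls_inv mulgV.
  rewrite sheet_word_cat sheet_step /=; case: (sheet false (inv_word _)) => e g /= [-> hg].
  by rewrite cls_letter; congr (_, _); apply: (mulgI (gen j)); rewrite hg mulgV.
exists (W0 ++ W).
  rewrite cls_cat eW /= /letter_val /=; congr (_ * _)%g.
  by rewrite /W0; case: (b); rewrite ?cls_inv.
by rewrite sheet_word_cat s0 /= sW (@cls_cons Gamma (j, b) w).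
Qed.

End ThetaStep.

Lemma raag_retract_inj (Gamma : simplicial_graph) (H : groupType)
  (F : {multiplicative raag Gamma -> H}) (F' : {multiplicative H -> raag Gamma}) :
  (forall u, F' (F (gen u)) = gen u) -> injective F.
Proof.
move=> e; apply: (raag_hom_inj (psi := F')); elim=> [|[u b] w IH].
  by rewrite cls0 !mult1.
by rewrite (cls_cons (u, b) w) !gmulfM IH cls_gen !mult_zexp e.
Qed.

Lemma raag_hom_gen (Gamma : simplicial_graph) (H : groupType) (h : Gamma -> H) :
  (forall u v, adj u v -> commute (h u) (h v)) ->
  exists F : {multiplicative raag Gamma -> H}, forall u, F (gen u) = h u.
Proof.
move=> hC; have [F hF] := raag_hom hC; exists F => u.
by rewrite /gen hF /= /letter_val mulg1.
Qed.

(** The cycle is the full subgraph on the vertices up to [n], and sending any other vertex to 1 is a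
    retraction. *)
Lemma embeds_cycle_theta n k : 5 <= n.+1 -> n <= k ->
  embeds (raag (cycle_graph n.+1)) (raag (theta n.+1 k.+1)).
Proof.
move=> n5 nk; set C := cycle_graph n.+1; set T := theta n.+1 k.+1.
have ladj (i j : 'I_n.+1) : j = ordS i -> theta_rel n.+1 i j.
  have := ltn_ord i; have := ltn_ord j.
  by move=> h1 h2 /(ordS_nat n5); rewrite /theta_rel /theta_edge; lia.
have [F hF] : exists F : {multiplicative raag C -> raag T},
    forall i : C, F (gen i) = @gen T (inord i : 'I_k.+1).
  apply: raag_hom_gen => i j [_ ij]; apply: cls_adj_gen.
  have hi := ltn_ord i; have hj := ltn_ord j.
  rewrite /= !inordK; [|lia|lia].
  by case: ij => /ladj //; rewrite /theta_rel eq_sym orbC.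
have [F' hF'] : exists F' : {multiplicative raag T -> raag C},
    forall x : T, F' (gen x) = if x <= n then @gen C (inord x : 'I_n.+1) else 1%g.
  apply: raag_hom_gen => x y xy; case: ifP => hx; last exact/commute_sym/commute1.
  case: ifP => hy; last exact: commute1.
  apply: cls_adj_gen; move: xy; rewrite /= /theta_rel => /andP [/eqP xy h]; split.
    by move=> /(congr1 (@nat_of_ord _)); rewrite !inordK.
  have [e|e] : ((x.+1 < n.+1 /\ nat_of_ord y = x.+1) \/ (x.+1 = n.+1 /\ nat_of_ord y = 0)) \/
      ((y.+1 < n.+1 /\ nat_of_ord x = y.+1) \/ (y.+1 = n.+1 /\ nat_of_ord x = 0)).
    by move: h; rewrite /theta_edge; lia.
    by left; apply/(ordS_nat n5); rewrite !inordK.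
  by right; apply/(ordS_nat n5); rewrite !inordK.
exists F; apply: (raag_retract_inj (F' := F')) => i.
have hi := ltn_ord i; rewrite hF hF' inordK; last by lia.
by rewrite -ltnS hi; congr gen; apply: inord_val.
Qed.

Theorem embeds_cycle_pentagon n : 5 <= n -> embeds (raag (cycle_graph n)) (raag (theta 5 5)).
Proof.
have st m : embeds (raag (theta (6 + m) (7 + m))) (raag (theta 5 5)).
  elim: m => [|m IH]; first by apply: (@embeds_theta_step 5 4) => //; right.
  by apply: embeds_trans IH; apply: (@embeds_theta_step (6 + m) (6 + m)) => //; left.
case: n => // n n5; case: (eqVneq n 4) => [->|n4]; first exact: embeds_cycle_theta.
apply: (embeds_trans (@embeds_cycle_theta n n.+1 n5 (leqnSn n))).
by have := st (n - 5); rewrite (_ : 6 + (n - 5) = n.+1) 1?(_ : 7 + (n - 5) = n.+2) //; lia.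
Qed.

Definition far (i j : nat) : bool := (i.+1 < j) || (j.+1 < i).
Lemma far_sym i j : far i j -> far j i. Proof. by rewrite /far orbC. Qed.
Lemma far_irr i : ~ far i i. Proof. by rewrite /far; lia. Qed.
(** The complement of the infinite path 0, 1, 2, ...; its vertices stand for the positions at which
    a word is rewritten. *)
Definition antipath : simplicial_graph := SimplicialGraph far_sym far_irr.

Lemma map_filter_split (S S' : Type) (f : S -> S') (p : pred S) B L1 a L' :
  map f (filter p B) = L1 ++ a :: L' -> exists B1 x B2,
  [/\ B = B1 ++ x :: B2, p x, f x = a, map f (filter p B1) = L1 & map f (filter p B2) = L'].
Proof.
elim: B L1 => [|x B IH] L1 /=; first by case: L1.
case: (boolP (p x)) => px; last first.
  move=> /IH [B1 [y [B2 [-> py fy e1 e2]]]].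
  by exists (x :: B1), y, B2; split=> //=; rewrite (negbTE px).
case: L1 => [|b L1] /= [fx]; first by move=> e; exists [::], x, B.
move=> /IH [B1 [y [B2 [-> py fy e1 e2]]]].
by exists (x :: B1), y, B2; split=> //=; rewrite px /= fx e1.
Qed.

(** * The pentagon group inside the group of the complement of a path *)

Section Chain.
Local Notation X := {classic (theta 5 5)}.
Local Notation Y := {classic antipath}.
Local Notation letter := (X * bool)%type.
Local Notation deco := ((X * bool) * (nat -> nat))%type.
Implicit Types (B U V : seq deco) (d : deco) (r : nat).

(* The letter [r] of the antipath occurs in the image of the vertex [2r mod 5];
   [r] and [r + 1] then lie over non-adjacent vertices of the pentagon. *)
Definition lab r : nat := (2 * r) %% 5.
Definition labels (v : 'I_5) : seq nat := [seq r <- iota 0 13 | lab r == v].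
Definition block (s : letter) : seq (Y * bool) := [seq (r : Y, s.2) | r <- labels s.1].
(** A tagging of the image word is stored along the pentagon word: a decorated letter [d] carries
    the function [d.2] that gives the tag of each letter of its block. *)
Definition dblock d : seq ((Y * bool) * nat) := [seq ((r : Y, d.1.2), d.2 r) | r <- labels d.1.1].
Definition over r d := lab r == (d.1.1 : 'I_5).
Definition strand r B : seq ((Y * bool) * nat) := [seq ((r : Y, d.1.2), d.2 r) | d <- B & over r d].

Lemma uniq_labels v : uniq (labels v).
Proof. by rewrite filter_uniq // iota_uniq. Qed.

Lemma filter_dblock r d : r < 13 ->
  filter (bygen (r : Y)) (dblock d) = if over r d then [:: ((r : Y, d.1.2), d.2 r)] else [::].
Proof.
move=> hr; rewrite filter_map.
have -> : filter (preim (fun r0 => ((r0 : Y, d.1.2), d.2 r0)) (bygen (r : Y))) (labels d.1.1) =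
    filter (pred1 r) (labels d.1.1).
  by apply: eq_filter => x; rewrite /= /bygen /=; apply/eqP/eqP.
case: ifP => ho.
  rewrite filter_pred1_uniq ?uniq_labels //.
  by rewrite mem_filter mem_iota -/(over r d) ho.
rewrite (_ : filter _ _ = [::]) //; apply: filter0_in => x.
by rewrite mem_filter => /andP [hx _] /eqP ex; move: ho; rewrite /over -ex hx.
Qed.

Lemma filter_dblocks r B : r < 13 ->
  filter (bygen (r : Y)) (flatten (map dblock B)) = strand r B.
Proof.
move=> hr; elim: B => //= d B IH; rewrite filter_cat IH filter_dblock // /strand /=.
by case: (over r d).
Qed.

Lemma tags_ex (L : seq nat) b (T : seq ((Y * bool) * nat)) : uniq L ->
  map fst T = [seq (r : Y, b) | r <- L] -> exists f : nat -> nat, T = [seq ((r : Y, b), f r) | r <- L].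
Proof.
elim: L T => [|r L IH] [|[s t] T] //=.
move=> /andP [nr u] [-> /(IH _ u) [f ->]].
exists (fun x => if x == r then t else f x); rewrite eqxx; congr (_ :: _).
by apply/eq_in_map => x xL; case: eqP => // ex; move: nr; rewrite -ex xL.
Qed.

Lemma deco_ex (w : seq letter) T : map fst T = flatten (map block w) ->
  exists B, map fst B = w /\ T = flatten (map dblock B).
Proof.
elim: w T => [|s w IH] T /=; first by case: T => // _; exists [::].
move=> /map_fst_cat [T1 [T2 [-> /(tags_ex (uniq_labels _)) [f ->] /IH [B [<- ->]]]]].
by exists ((s, f) :: B).
Qed.

Section Reduced.
Variable B0 : seq deco.
Hypothesis red : reduced (map fst B0).
Local Notation T := (flatten (map dblock B0)).
Hypotheses (pT : @paired Y T) (plT : @planar Y (@adj antipath) T).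

Definition strand_ok r B := paired (strand r B).

Lemma strand_split r B L1 a a' L2 : strand r B = L1 ++ a :: a' :: L2 ->
  exists B1 x B2 y B3, [/\ B = B1 ++ x :: B2 ++ y :: B3, over r x /\ over r y,
    a = ((r : Y, x.1.2), x.2 r), a' = ((r : Y, y.1.2), y.2 r) & ~~ has (over r) B2].
Proof.
move=> e; have [B1 [x [B' [-> ox ea _ e']]]] := map_filter_split e.
have [B2 [y [B3 [-> oy ea' e0 _]]]] := map_filter_split (L1 := [::]) e'.
exists B1, x, B2, y, B3; split=> //.
by rewrite has_filter; case: filter e0.
Qed.

(** Take an innermost arc of the strand of [r] and let [B'] be the pentagon letters below it. The
    letters [r - 1] and [r + 1] do not commute with [r], so their arcs cannot leave [B']. Some
    letter of [B'] does not commute with the two ends of the arc, which would otherwise cancel in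
    the reduced word. *)
Lemma strand_step r U B V : r < 13 -> B0 = U ++ B ++ V -> strand_ok r B ->
  has (over r) B -> exists U' B' V', [/\ B = U' ++ B' ++ V', ~~ has (over r) B',
    forall r', r' < 13 -> r' = r.+1 \/ r = r'.+1 -> strand_ok r' B' &
    has (fun d => ~~ theta_rel 5 (lab r) (d.1.1 : 'I_5)) B'].
Proof.
move=> hr e ok hs.
have eT : T = flatten (map dblock U) ++ flatten (map dblock B) ++ flatten (map dblock V).
  by rewrite e !map_cat !flatten_cat.
have plB : @planar Y (@adj antipath) (strand r B).
  apply: planar_subseq plT _; rewrite -filter_dblocks //.
  apply: subseq_trans (filter_subseq _ _) _; rewrite eT.
  by apply: subseq_trans (suffix_subseq _ _); apply: prefix_subseq.
have gB z : z \in strand r B -> z.1.1 = r.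
  by rewrite -filter_dblocks // mem_filter => /andP [/eqP].
have nB : strand r B <> [::].
  move=> e0; move: hs; rewrite has_filter; case ef : (filter (over r) B) => [|d D] // _.
  by move: e0; rewrite /strand ef.
have [L1 [a [a' [L2 [eS a2 a1]]]]] :=
  @innermost_arc Y _ (@adj_sym antipath) (@adj_irr antipath) _ (r : Y) ok plB gB nB.
have [B1 [x [B2 [y [B3 [eB [ox oy] ea ea' nB2]]]]]] := strand_split eS.
have exy : y.1 = inv_letter x.1.
  move: a1; rewrite ea ea' /= => /(congr1 (fun s => s.2)) /= eb.
  move: ox oy; rewrite /over => /eqP ox /eqP oy; case: (y) (x) ox oy eb => [[v b] f] [[v' b'] f'] /= -> /val_inj -> ->.
  by [].
exists (B1 ++ [:: x]), B2, (y :: B3); split.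
- by rewrite eB -catA.
- by [].
- move=> r' hr' nr; rewrite /strand_ok -filter_dblocks //.
  have [X1 [X2 eX]] : exists X1 X2, dblock x = X1 ++ a :: X2.
    have : a \in dblock x.
      rewrite ea; apply: (map_f (fun r0 => ((r0 : Y, x.1.2), x.2 r0))).
      by rewrite mem_filter mem_iota -/(over r x) ox.
    by case/splitPr => X1 X2; exists X1, X2.
  have [Y1 [Y2 eY]] : exists Y1 Y2, dblock y = Y1 ++ a' :: Y2.
    have : a' \in dblock y.
      rewrite ea'; apply: (map_f (fun r0 => ((r0 : Y, y.1.2), y.2 r0))).
      by rewrite mem_filter mem_iota -/(over r y) oy.
    by case/splitPr => Y1 Y2; exists Y1, Y2.
  have nov z : over r z -> over r' z = false.
    move=> /eqP oz; apply/eqP; rewrite -oz /lab; case: nr; lia.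
  have fx := @filter_dblock r' x hr'; rewrite nov // eX filter_cat in fx.
  have fy := @filter_dblock r' y hr'; rewrite nov // eY filter_cat in fy.
  have fX2 : filter (bygen (r' : Y)) X2 = [::].
    by move: fx; case: filter => //=; case: bygen; case: filter.
  have fY1 : filter (bygen (r' : Y)) Y1 = [::] by move: fy; case: filter.
  have eT' : T = (flatten (map dblock U) ++ flatten (map dblock B1) ++ X1) ++
      a :: (X2 ++ flatten (map dblock B2) ++ Y1) ++ a' ::
      (Y2 ++ flatten (map dblock B3) ++ flatten (map dblock V)).
    rewrite eT eB !map_cat /= !map_cat /= !flatten_cat /= !flatten_cat /= eX eY.
    by rewrite !(cat_cons, =^~ catA).
  have := @paired_under_arc Y _ (@adj_sym antipath) _ _ _ _ a a' (r' : Y) pT plT eT' a2.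
  rewrite !filter_cat fX2 fY1 cats0 /=; apply; rewrite ea /= /far; case: nr; lia.
apply/negPn/negP => /hasPn H.
have rd := red; rewrite e eB in rd.
rewrite !map_cat /= !map_cat /= exy -!catA /= -!catA /= in rd.
apply: (@reduced_sep _ (map fst U ++ map fst B1) x.1 (map fst B2) (map fst B3 ++ map fst V)).
  by move: rd; rewrite -!catA.
move=> s /mapP [d dB ->]; have := H d dB; rewrite negbK.
by move: ox; rewrite /over => /eqP ->.
Qed.

(** The vertices of the pentagon at distance 2 from [lab r] are the labels of [r + 1] and of
    [r - 1]; the latter is written [r + 4] to avoid truncated subtraction. *)
Lemma nonadjacent_lab r (v : 'I_5) : ~~ theta_rel 5 (lab r) v -> lab r <> v ->
  nat_of_ord v = lab r.+1 \/ nat_of_ord v = lab (r + 4).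
Proof.
have := ltn_ord v; move: (nat_of_ord v) => {}v hv; rewrite /theta_rel /theta_edge /lab; lia.
Qed.

Lemma strand_next r B : ~~ has (over r) B ->
  has (fun d => ~~ theta_rel 5 (lab r) (d.1.1 : 'I_5)) B -> has (over r.+1) B \/ has (over (r + 4)) B.
Proof.
move=> /hasPn nr /hasP [d dB nt]; have /negP no := nr d dB.
case: (nonadjacent_lab nt) => [e|e|e].
- by apply: no; apply/eqP.
- by left; apply/hasP; exists d => //; apply/eqP.
- by right; apply/hasP; exists d => //; apply/eqP.
Qed.

Lemma over_shift r r' : r = r' %[mod 5] -> over r =1 over r'.
Proof. by move=> e d; rewrite /over (_ : lab r = lab r') // /lab -modnMmr e modnMmr. Qed.

(** The arcs found so far leave no letter over [r], ..., [r + k - 1], and the next one removes those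
    over [r + k]. The noncommuting letter below it cannot lie over [r + k - 1], so it lies over
    [r + k + 1]; for [k = 4] this is the vertex of [r] again, which is excluded. *)
Lemma no_chain_up k j r U B V : 0 < k -> k + j = 4 -> r + 4 <= 12 -> B0 = U ++ B ++ V ->
  (forall i, i < k -> ~~ has (over (r + i)) B) -> strand_ok (r + k) B -> has (over (r + k)) B -> False.
Proof.
elim: j k U B V => [|j IH] k U B V k0 hk hr e fr ok hs.
all: have hrk : r + k < 13 by lia.
all: have [U' [B' [V' [eB nB okB hB]]]] := strand_step hrk e ok hs.
all: have fr' i : i <= k -> ~~ has (over (r + i)) B' by
  (rewrite leq_eqVlt => /orP [/eqP -> //|/fr]; rewrite eB !has_cat !negb_or => /and3P []).
all: have up : has (over (r + k).+1) B' by
  (case: (strand_next nB hB) => // h; have := fr' k.-1 (leq_pred k);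
   rewrite -(eq_has (@over_shift (r + k + 4) _ _)) ?h //; lia).
- have := fr' 0 (leq0n k); rewrite -(eq_has (@over_shift (r + k).+1 _ _)) ?up //; lia.
apply: (IH k.+1 (U ++ U') B' (V' ++ V)) => //; rewrite ?addnS //.
- lia.
- by rewrite e eB -!catA.
- by apply: okB; [lia|left].
Qed.

Lemma no_chain_down k j r U B V : 0 < k -> k + j = 4 -> 4 <= r < 13 -> B0 = U ++ B ++ V ->
  (forall i, i < k -> ~~ has (over (r - i)) B) -> strand_ok (r - k) B -> has (over (r - k)) B -> False.
Proof.
elim: j k U B V => [|j IH] k U B V k0 hk hr e fr ok hs.
all: have hrk : r - k < 13 by lia.
all: have [U' [B' [V' [eB nB okB hB]]]] := strand_step hrk e ok hs.
all: have fr' i : i <= k -> ~~ has (over (r - i)) B' by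
  (rewrite leq_eqVlt => /orP [/eqP -> //|/fr]; rewrite eB !has_cat !negb_or => /and3P []).
all: have dn : has (over (r - k + 4)) B' by
  (case: (strand_next nB hB) => // h; have := fr' k.-1 (leq_pred k);
   rewrite -(eq_has (@over_shift (r - k).+1 _ _)) ?h //; lia).
- have := fr' 0 (leq0n k); rewrite -(eq_has (@over_shift (r - k + 4) _ _)) ?dn //; lia.
apply: (IH k.+1 (U ++ U') B' (V' ++ V)) => //.
- lia.
- by rewrite e eB -!catA.
- by apply: okB; [lia|right; lia].
- by rewrite -(eq_has (@over_shift (r - k + 4) _ _)) ?dn //; lia.
Qed.

Lemma reduced_deco_nil : B0 = [::].
Proof.
case e0 : B0 => [//|d B]; exfalso; have e : B0 = [::] ++ B0 ++ [::] by rewrite cats0.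
have [r hr od] : exists2 r, 4 <= r <= 8 & over r d.
  have hd := ltn_ord (d.1.1 : 'I_5).
  (* 3 is the inverse of 2 modulo 5, and the summand 1 compensates the shift by 4. *)
  exists (4 + (3 * (d.1.1 : 'I_5) + 1) %% 5); first by lia.
  by apply/eqP; rewrite /lab; lia.
have r13 : r < 13 by lia.
have ok : strand_ok r B0 by rewrite /strand_ok -filter_dblocks //; apply: paired_filter_gen.
have hs : has (over r) B0 by rewrite e0 /= od.
have [U' [B' [V' [eB nB okB hB]]]] := strand_step r13 e ok hs.
case: (strand_next nB hB) => h.
  apply: (@no_chain_up 1 3 r U' B' V') => //; rewrite ?addn1 //; first by lia.
  - by case=> // _; rewrite addn0.
  - by apply: okB; [lia|left].
apply: (@no_chain_down 1 3 r U' B' V') => //; first by lia.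
- by case=> // _; rewrite subn0.
- by apply: okB; [lia|right; lia].
- by rewrite -(eq_has (@over_shift (r + 4) _ _)) //; lia.
Qed.

End Reduced.

Lemma cls_commute_words (Gamma : simplicial_graph) (w w' : seq ({classic Gamma} * bool)) :
  (forall s s', s \in w -> s' \in w' -> adj s.1 s'.1) -> commute (cls w) (cls w').
Proof.
elim: w => [|s w IH] H; first exact/commute_sym/commute1.
rewrite (cls_cons s w); apply/commute_sym/commuteM; apply/commute_sym.
  by apply: cls_adj_word => s' hs'; apply: H => //; rewrite inE eqxx.
by apply: IH => s1 s2 h1 h2; apply: H => //; rewrite inE h1 orbT.
Qed.

(** The letters of one block differ by multiples of 5, hence commute with each other. *)
Lemma cls_block_inv v : cls (block (v, true)) = (cls (block (v, false)))^-1%g.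
Proof.
rewrite /block; have := uniq_labels v; have : all (fun r => lab r == v) (labels v) by apply: filter_all.
elim: (labels v) => [|r L IH] /=; first by rewrite cls0 invg1.
move=> /andP [lr aL] /andP [nr u].
rewrite (@cls_cons antipath (r : Y, true)) (@cls_cons antipath (r : Y, false)) IH // cls_letter -invgM.
congr (_^-1)%g; apply/commute_sym/(@cls_adj_word antipath (r : Y, false)).
move=> s' /mapP [r' hr' ->] /=; have := allP aL _ hr'; move: lr => /eqP <- /eqP e.
have rr' : r <> r' by move=> er; rewrite er hr' in nr.
by move: e; rewrite /far /lab; lia.
Qed.

Theorem pentagon_antipath : exists F : {multiplicative raag (theta 5 5) -> raag antipath},
  (forall v : 'I_5, F (@gen (theta 5 5) v) = cls (block (v, false))) /\ injective F.
Proof.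
have hC (u v : theta 5 5) : adj u v -> commute (cls (block (u, false))) (cls (block (v, false))).
  move=> uv; apply: cls_commute_words => s s' /mapP [r hr ->] /mapP [r' hr' ->].
  move: hr hr'; rewrite !mem_filter => /andP [/eqP lr _] /andP [/eqP lr' _].
  by move: uv; rewrite /= /theta_rel /theta_edge -lr -lr' /far /lab; lia.
have [F hF] := raag_hom hC; exists F; split.
  by move=> v; rewrite /gen hF /= /letter_val mulg1.
have FE w : F (cls w) = cls (flatten (map block w)).
  rewrite hF; elim: w => [|[v b] w IH] //=; rewrite IH cls_cat; congr (_ * _)%g.
  by case: b; rewrite /letter_val //= cls_block_inv.
apply: mult_inj => g; have [w <- rw] := reduced_ex g; rewrite FE => /cls_matched [T [eT pT plT]].
have [B [eB eTB]] := deco_ex eT; rewrite -eB in rw.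
rewrite eTB in pT plT; have B0 := reduced_deco_nil rw pT plT.
by rewrite -eB B0 cls0.
Qed.

End Chain.

(** * A diagram group containing the pentagon group *)

Inductive abc := La | Lb | Lc.

Inductive abc_rel : seq abc -> seq abc -> Prop :=
| RelA : abc_rel [:: La; La] [:: Lb]
| RelB : abc_rel [:: Lb] [:: Lc]
| RelC : abc_rel [:: Lc] [:: La; La].

Lemma abc_rel_nonempty u v : abc_rel u v -> u <> [::] /\ v <> [::].
Proof. by case. Qed.

Lemma abc_rel_asym u v : abc_rel u v -> ~ abc_rel v u.
Proof. by move=> h h'; case: h h' => h'; inversion h'. Qed.

Definition abc_presentation : semigroup_presentation :=
  SemigroupPresentation abc_rel_nonempty abc_rel_asym.

Section Labels.
Local Notation P := abc_presentation.
Local Notation word := (seq abc).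
Local Notation edge := (squier_edge P).
Local Notation redge := (@squier_rev P).
Local Notation label_word := (seq ({classic antipath} * bool)).
Local Notation lift := (@lift P).
Local Notation valid := (@valid P).
Local Notation endw := (@endw P).
Implicit Types (e : edge) (p q : seq edge).

(** The length after replacing [b] and [c] by [aa]. The relations preserve it, so the weight of what
    stands left of an edge is a position that does not change under sliding. *)
Definition weight (w : word) : nat := sumn (map (fun x => if x is La then 1 else 2) w).

Lemma weight_cat w w' : weight (w ++ w') = weight w + weight w'.
Proof. by rewrite /weight map_cat sumn_cat. Qed.

Lemma weight_applicable u v : @applicable P u v -> weight u = weight v.
Proof. by case; case. Qed.

(** Of the three edges of a loop at [aa] only the one between [b] and [c] is counted, so that going
    round once gives one letter. *)
Definition edge_label e : label_word :=
  match se_from e, se_to e with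
  | [:: Lb], [:: Lc] => [:: (weight (se_left e) : {classic antipath}, false)]
  | [:: Lc], [:: Lb] => [:: (weight (se_left e) : {classic antipath}, true)]
  | _, _ => [::]
  end.

Arguments edge_label : simpl never.

Definition path_label p : label_word := flatten (map edge_label p).

Lemma path_label_cat p q : path_label (p ++ q) = path_label p ++ path_label q.
Proof. by rewrite /path_label map_cat flatten_cat. Qed.

Lemma edge_label_rev e : edge_label (redge e) = inv_word (edge_label e).
Proof.
case: e => a u v b h; rewrite /edge_label /=.
by case: u h => [|[] [|? ?]] //; case: v => [|[] [|? ?]].
Qed.

Lemma edge_label_ext e f : se_left e = se_left f -> se_from e = se_from f -> se_to e = se_to f ->
  edge_label e = edge_label f.
Proof. by rewrite /edge_label => -> -> ->. Qed.

Lemma edge_label_in e s : s \in edge_label e -> s.1 = weight (se_left e) /\ weight (se_from e) = 2.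
Proof.
rewrite /edge_label; case: (se_from e) => [|[] [|? ?]] //; case: (se_to e) => [|[] [|? ?]] //;
  by rewrite inE => /eqP ->.
Qed.

(** In a square, two counted edges sit at positions differing by at least 2, since the left one
    rewrites a subword of weight 2; their letters commute. *)
Lemma path_label_hom x p q : hom x p q -> cls (path_label p) = cls (path_label q).
Proof.
elim=> {p q} [p q [_ _ m]|p|p q _ ->|p q r _ -> _ ->] //.
case: m => [l e r|l e1 e2 f1 f2 r s]; rewrite !path_label_cat !cls_cat; congr (_ * _)%g.
  by rewrite cls0 mulg1 [rev_edge e]/(redge e) edge_label_rev cls_inv mulgV mul1g.
congr (_ * _)%g; case: s => a u1 v1 b u2 v2 c h1 h2; rewrite cls0 !mulg1.
set e1' := SquierEdge a _ h1; set e2' := SquierEdge (a ++ v1 ++ b) c h2.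
set f1' := SquierEdge (a ++ u1 ++ b) c h2; set f2' := SquierEdge a _ h1.
have -> : edge_label e1' = edge_label f2' by apply: edge_label_ext.
have -> : edge_label e2' = edge_label f1'.
  by rewrite /edge_label /= !weight_cat (weight_applicable h1).
apply: cls_commute_words => s s' /edge_label_in [-> w2] /edge_label_in [-> _].
by move: w2; rewrite /= !weight_cat /far /= => ->; lia.
Qed.

Local Notation w0 := (nseq 14 La : seq (alphabet P)).
Local Notation D := (@diagram_group P w0).

Lemma path_label_mult : exists L : {multiplicative D -> raag antipath},
  forall g, L g = cls (path_label (lrep g)).
Proof.
apply: mult_ex => x y; rewrite (path_label_hom (lrepM x y)).
by rewrite path_label_cat cls_cat.
Qed.

Lemma relAP : @applicable P [:: La; La] [:: Lb]. Proof. by left; constructor. Qed.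
Lemma relBP : @applicable P [:: Lb] [:: Lc]. Proof. by left; constructor. Qed.
Lemma relCP : @applicable P [:: Lc] [:: La; La]. Proof. by left; constructor. Qed.

Definition abc_loop : seq edge :=
  [:: SquierEdge [::] [::] relAP; SquierEdge [::] [::] relBP; SquierEdge [::] [::] relCP].

Definition loop_at r : seq edge := map (lift (nseq r La) (nseq (12 - r) La)) abc_loop.

Lemma weight_nseq r : weight (nseq r La) = r.
Proof. by elim: r => // r IH; rewrite -addn1 nseqD weight_cat IH. Qed.

Lemma loop_at_valid r : r < 13 -> valid w0 (loop_at r) /\ endw w0 (loop_at r) = w0.
Proof.
move=> hr; have -> : w0 = nseq r La ++ [:: La; La] ++ nseq (12 - r) La.
  by rewrite -[[:: La; La]]/(nseq 2 La) -!nseqD; congr nseq; lia.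
by split; [apply: valid_lift|rewrite endw_lift].
Qed.

Lemma loop_at_label r : path_label (loop_at r) = [:: (r : {classic antipath}, false)].
Proof. by rewrite /path_label /loop_at /= /edge_label /= cats0 weight_nseq. Qed.

Lemma act_base g p : valid w0 p -> hom w0 (lrep g) p -> act g (base w0) = walk (base w0) p.
Proof.
move=> hp h; have [hg eg] := lrepP g.
rewrite /base act_cl // cats0 walk_cl //=.
by apply/clP.
Qed.

(** The two loops act on different sides of the cut after [r + 2] letters. *)
Lemma atom_comm r s (g g' : D) : r.+1 < s -> s < 13 -> hom w0 (lrep g) (loop_at r) ->
  hom w0 (lrep g') (loop_at s) -> commute g g'.
Proof.
move=> rs hs hg hg'; have hr : r < 13 by lia.
have [vr _] := loop_at_valid hr; have [vs _] := loop_at_valid hs.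
have e0 : ev (base w0) = nseq r.+2 La ++ nseq (12 - r) La.
  by rewrite ev_base -nseqD; congr nseq; lia.
apply: (@lfix_rfix_comm _ _ (base w0) (nseq r.+2 La) (nseq (12 - r) La)); split=> //.
  have e : nseq r.+2 La = nseq r La ++ [:: La; La] ++ [::].
    by rewrite -[[:: La; La]]/(nseq 2 La) cats0 -nseqD addn2.
  exists (map (lift (nseq r La) [::]) abc_loop); rewrite e; split.
  - exact: valid_lift.
  - by rewrite endw_lift.
  - by rewrite (act_base vr hg) maplift_lift.
have e : nseq (12 - r) La = nseq (s - r.+2) La ++ [:: La; La] ++ nseq (12 - s) La.
  by rewrite -[[:: La; La]]/(nseq 2 La) -!nseqD; congr nseq; lia.
exists (map (lift (nseq (s - r.+2) La) (nseq (12 - s) La)) abc_loop); rewrite e; split.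
- exact: valid_lift.
- by rewrite endw_lift.
- rewrite (act_base vs hg') maplift_lift cats0 -nseqD /loop_at.
  by rewrite (_ : r.+2 + (s - r.+2) = s) //; lia.
Qed.

Theorem embeds_pentagon_diagram : embeds (raag (theta 5 5)) D.
Proof.
(* A loop at a position beyond 12 does not fit into 14 letters, so such positions get the trivial
   element; [LP] below is limited accordingly to letters less than 13, which cover the image of
   [F]. *)
have atoms r : exists g : D, if r < 13 then hom w0 (lrep g) (loop_at r) else g = 1%g.
  case: (boolP (r < 13)) => hr; last by exists 1%g.
  by have [v e] := loop_at_valid hr; apply: lrep_ex.
have [a ha] := choice atoms; have [L hL] := path_label_mult.
have aC (r s : antipath) : adj r s -> commute (a r) (a s).
  wlog rs : r s / r.+1 < s.
    by move=> H /orP [h|h]; [apply: H|apply/commute_sym/H] => //; rewrite /= /far h.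
  move=> _; have := ha s; case: ifP => hs; last by move=> ->; apply: commute1.
  have := ha r; case: ifP => hr; first exact: atom_comm.
  by move=> -> _; apply/commute_sym/commute1.
have [Psi hPsi] := raag_hom_gen aC; have [F [hF Fi]] := pentagon_antipath.
have LP (w : label_word) : (forall s, s \in w -> s.1 < 13) -> L (Psi (cls w)) = cls w.
  elim: w => [|[r b] w IH] H; first by rewrite cls0 !mult1.
  rewrite (@cls_cons antipath (r, b) w) !gmulfM IH; last by move=> s hs; apply: H; rewrite inE hs orbT.
  congr (_ * _)%g; rewrite cls_gen !mult_zexp hPsi hL; congr zexp.
  have := ha r; rewrite (_ : r < 13); last by have := H (r, b); rewrite inE eqxx; apply.
  by move/path_label_hom => ->; rewrite loop_at_label.
have LPF w : L (Psi (F (cls w))) = F (cls w).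
  elim: w => [|[v b] w IH]; first by rewrite cls0 !mult1.
  rewrite (@cls_cons (theta 5 5) (v, b) w) !gmulfM IH; congr (_ * _)%g.
  rewrite cls_gen !mult_zexp hF; congr zexp; apply: LP => s /mapP [r + ->].
  by rewrite mem_filter mem_iota => /andP [_ /andP [_]].
have [Phi hPhi] := @mult_ex (raag (theta 5 5)) D (Psi \o F) (fun x y => etrans (congr1 Psi (gmulfM x y)) (gmulfM _ _)).
exists Phi => x y; rewrite !hPhi /= => e; apply: Fi.
by move: e; have [w <-] := cls_ex x; have [w' <-] := cls_ex y => /(congr1 L); rewrite !LPF.
Qed.

Lemma abc_is_diagram_group : is_diagram_group D.
Proof.
exists P, w0; split=> //; have [f hf] := @mult_ex D D id (fun x y => erefl).
by exists f; exists id => x; rewrite hf.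
Qed.

End Labels.

Theorem corollary1p14 (n : nat) (n_odd : odd n) (n_ge5 : 5 <= n) :
  (exists G : groupType,
     is_diagram_group G /\ embeds (raag (cycle_graph n)) G) /\
  ~ is_diagram_group (raag (cycle_graph n)).
Proof.
split; last exact: not_diagram_group_raag_cycle.
exists (@diagram_group abc_presentation (nseq 14 La)).
split; first exact: abc_is_diagram_group.
exact: embeds_trans (embeds_cycle_pentagon n_ge5) embeds_pentagon_diagram.
Qed.
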